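(* In the setting described in the context (random walk $\mathbf S_n$ on $\mathbb Z^d$ attracted to a stable law of index $\boldsymbol\alpha$, with scaling sequences $a_n^{(i)}$ and recentering sequences $b_n^{(i)}$), suppose that the local assumption (H) stated in the context holds, with the slowly varying functions $\varphi_i$ and exponents $\gamma_i$. Let $\hat{\mathbf S}_n:=\mathbf S_n-\lfloor\mathbf b_n\rfloor$ (componentwise integer part). Then there are constants $c_2,C_2>0$ such that for every $n\ge1$ and every $\mathbf x=(x_1,\dots,x_d)\in\mathbb Z^d$, $$\mathbf P\big(\hat{\mathbf S}_n=\mathbf x\big)\le\frac{C_2}{\prod_{i=1}^d\max\{|x_i|,a_n^{(i)}\}}\times\min_{i\in\{1,\dots,d\}}\Big\{n\,\varphi_i(|x_i|)\,|x_i|^{-\gamma_i}+e^{-c_2(|x_i|/a_n^{(i)})^2}\mathbf 1_{\{\alpha_i=2\}}\Big\},$$ where $\varphi_i(|x_i|)|x_i|^{-\gamma_i}$ is read as $+\infty$ when $x_i=0$.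
   Context: Setting. Let $d\ge 1$, let $(\mathbf X_j)_{j\ge1}$ be i.i.d. $\mathbb Z^d$-valued random vectors, $\mathbf X_j=(X_j^{(1)},\dots,X_j^{(d)})$, $\mathbf S_0=\mathbf 0$ and $\mathbf S_n=\sum_{j=1}^n\mathbf X_j=(S_n^{(1)},\dots,S_n^{(d)})$. The walk is aperiodic: the support of $\mathbf X_1$ is not contained in a translate of a proper subgroup of $\mathbb Z^d$. There is $\boldsymbol\alpha=(\alpha_1,\dots,\alpha_d)\in(0,2]^d$ such that $$\Big(\frac{S_n^{(1)}-b_n^{(1)}}{a_n^{(1)}},\dots,\frac{S_n^{(d)}-b_n^{(d)}}{a_n^{(d)}}\Big)\Rightarrow\mathbf Z\quad\text{in distribution},$$ where $\mathbf Z$ is a multivariate stable law with non-degenerate density $g_{\boldsymbol\alpha}$ on $\mathbb R^d$, and the sequences are as follows. If $\alpha_i\in(0,2)$, there are a slowly varying function $L_i$ and $p_i,q_i\ge0$, $p_i+q_i=1$, with $\mathbf P(X_1^{(i)}>x)\sim p_iL_i(x)x^{-\alpha_i}$ and $\mathbf P(X_1^{(i)}\le -x)\sim q_iL_i(x)x^{-\alpha_i}$ as $x\to+\infty$ (read as $o(L_i(x)x^{-\alpha_i})$ when $p_i=0$, resp. $q_i=0$). If $\alpha_i=2$, $\sigma_i(x):=\mathbf E[(X_1^{(i)})^2\mathbf 1_{\{|X_1^{(i)}|\le x\}}]$ is slowly varying. Scaling sequences: $a_n^{(i)}>0$ satisfies $L_i(a_n^{(i)})(a_n^{(i)})^{-\alpha_i}\sim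 1/n$ if $\alpha_i\in(0,2)$ and $\sigma_i(a_n^{(i)})(a_n^{(i)})^{-2}\sim1/n$ if $\alpha_i=2$. Recentering: $\mathbf b_n=(b_n^{(1)},\dots,b_n^{(d)})$ with $b_n^{(i)}=0$ if $\alpha_i\in(0,1)$; $b_n^{(i)}=n\mu_i$ if $\alpha_i>1$, where $\mu_i=\mathbf E[X_1^{(i)}]$; $b_n^{(i)}=n\mu_i(a_n^{(i)})$ if $\alpha_i=1$, where $\mu_i(x)=\mathbf E[X_1^{(i)}\mathbf 1_{\{|X_1^{(i)}|\le x\}}]$. Tail domination assumption: there are slowly varying functions $\varphi_i$ and exponents $\gamma_i\ge\alpha_i$ with $\mathbf P(X_1^{(i)}\le -x)+\mathbf P(X_1^{(i)}>x)\le\varphi_i(x)x^{-\gamma_i}$ for all $x\in\mathbb N$ and $1\le i\le d$. These are chosen so that: if $\mathbf E[(X_1^{(i)})^2]=+\infty$ then $\gamma_i=\alpha_i$, with $\varphi_i$ a constant multiple of $L_i$ when $\alpha_i<2$ and $\varphi_i=O(\sigma_i)$ when $\alpha_i=2$; if $\mathbf E[(X_1^{(i)})^2]<+\infty$ then $\sum_{n\ge1}\varphi_i(n)n^{1-\gamma_i}<+\infty$. Local assumption (H): there is a constant $\mathrm C_d$ such that, with the same $\varphi_i,\gamma_i$, for every $i\in\{1,\dots,d\}$ and every $\mathbf x\in\mathbb Z^d$, $$\mathbf P(\mathbf X_1=\mathbf x)\le\frac{\mathrm C_d\,\varphi_i(|x_i|)(1+|x_i|)^{-\gamma_i}}{\prod_{j=1}^d(1+|x_j|)}\times\prod_{j\ne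 i}h^{(i)}_{|x_i|}(|x_j|),$$ where the functions $h_u^{(i)}(v)$ ($u,v\in\mathbb N=\{0,1,2,\dots\}$) satisfy: (i) $h_u^{(i)}(v)\le1$; (ii) $\sup_{u\ge0}\sum_{v\ge0}\frac{h_u^{(i)}(v)}{1+v}<+\infty$; (iii) $\sup_{u,v\ge0;\,u'\in[u,2u]}\frac{h^{(i)}_{u'}(v)}{h^{(i)}_u(v)}<+\infty$. (Here $\varphi_i(0)$ is some positive constant.) All regularly varying quantities are regarded as positive (where relevant) functions of positive real numbers. *)

(* Defs.v *)
From mathcomp Require Import all_boot all_order all_algebra.
From mathcomp Require Import all_classical all_reals all_analysis.
Import Order.TTheory GRing.Theory Num.Theory.
Import numFieldNormedType.Exports.

Set Implicit Arguments.
Unset Strict Implicit.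
Unset Printing Implicit Defensive.

Local Open Scope classical_set_scope.
Local Open Scope ring_scope.

(* Random elements of a type E equipped with the sigma-algebra G. *)
Section random_elements.
Context {R : realType} {dO : measure_display} {Omega : measurableType dO}.
Context {E : Type} (G : set_system E).

Definition random_element (Y : Omega -> E) : Prop :=
  forall A, G A -> measurable (Y @^-1` A).

(* As setT belongs to G, the product rule on initial segments contains the
   product rule on all finite subfamilies. *)
Definition mutually_independent (P : probability Omega R)
    (Y : nat -> Omega -> E) : Prop :=
  forall (n : nat) (A : nat -> set E), (forall k, G (A k)) ->
    P (\bigcap_(k in `I_n) (Y k @^-1` A k)) =
    (\prod_(k < n) P (Y k @^-1` A k))%E.

Definition same_law (P : probability Omega R) (Y : Omega -> E)
    {dO' : measure_display} {Omega' : measurableType dO'}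
    (Q : probability Omega' R) (Z : Omega' -> E) : Prop :=
  forall A, G A -> P (Y @^-1` A) = Q (Z @^-1` A).

Definition iid (P : probability Omega R) (Y : nat -> Omega -> E) : Prop :=
  [/\ forall k, random_element (Y k),
      mutually_independent P Y &
      forall k, same_law P (Y k) P (Y 0%N)].

End random_elements.

Section vectors.
Context {R : realType} {d : nat}.

Definition borel_sets : set_system 'rV[R]_d := <<s @open 'rV[R]_d >>.

Definition borel_vector : Type := g_sigma_algebraType (@open 'rV[R]_d).

(* All subsets of the countable group Z^d. *)
Definition discrete_sets : set_system 'rV[int]_d := [set: set 'rV[int]_d].

Definition aperiodic (A : set 'rV[int]_d) : Prop :=
  ~ exists (H : set 'rV[int]_d) (v : 'rV[int]_d),
      [/\ H 0, (forall x y, H x -> H y -> H (x - y)), H <> setT &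
          A `<=` [set v + y | y in H]].

Definition cvg_in_law {dO : measure_display} {Omega : measurableType dO}
    (P : probability Omega R) (Y : nat -> Omega -> 'rV[R]_d)
    {dO' : measure_display} {Omega' : measurableType dO'}
    (Q : probability Omega' R) (Z : Omega' -> 'rV[R]_d) : Prop :=
  forall f : 'rV[R]_d -> R, continuous f -> bounded_fun f ->
    'E_P[f \o Y n]%E @[n --> \oo] --> 'E_Q[f \o Z]%E.

(* Stability with one index per coordinate: a sum of m independent copies of Z
   is distributed as (m^(1/alpha_i) Z_i)_i up to a translation. *)
Definition stable_vector (alpha : 'I_d -> R)
    {dO : measure_display} {Omega : measurableType dO}
    (Q : probability Omega R) (Z : Omega -> 'rV[R]_d) : Prop :=
  exists (dW : measure_display) (Om : measurableType dW)
    (Q' : probability Om R) (W : nat -> Om -> 'rV[R]_d),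
    [/\ iid borel_sets Q' W, same_law borel_sets Q' (W 0%N) Q Z &
     forall m : nat, (0 < m)%N -> exists c : 'rV[R]_d,
       same_law borel_sets Q' (fun w => \sum_(k < m) W k w)
         Q (fun w => \row_i (m%:R `^ (alpha i)^-1 * Z w 0 i) + c)].

End vectors.

(* Iterated Lebesgue integral over R^n; by Tonelli it is the integral against
   the n-dimensional Lebesgue measure for nonnegative Borel functions. *)
Fixpoint iterated_integral {R : realType} (n : nat) :
    ('rV[R]_n -> \bar R) -> \bar R :=
  match n with
  | 0 => fun f => f 0
  | n'.+1 => fun f => (\int[@lebesgue_measure R]_t
      iterated_integral (fun v : 'rV[R]_n' => f (row_mx (t%:M : 'rV[R]_1) v)))%E
  end.

Definition has_density {R : realType} {d : nat}
    {dO : measure_display} {Omega : measurableType dO}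
    (Q : probability Omega R) (Z : Omega -> 'rV[R]_d) (g : 'rV[R]_d -> R) :
    Prop :=
  [/\ forall z, 0 <= g z,
      measurable_fun setT (g : borel_vector -> R) &
      forall A, borel_sets A ->
        Q (Z @^-1` A) = iterated_integral (fun z => (g z * \1_A z)%:E)].

(* Measurability is part of the usual notion; positivity is only required near
   infinity, so that truncated moments (which vanish near 0) are covered. *)
Definition slowly_varying {R : realType} (L : R -> R) : Prop :=
  [/\ measurable_fun (`]0, +oo[%classic : set R) L,
      (\forall x \near +oo, 0 < L x) &
      forall c : R, 0 < c -> L (c * x) / L x @[x --> +oo] --> (1 : R)].

Section walk.
Context {R : realType} {d : nat}.
Context {dO : measure_display} {Omega : measurableType dO}.
Variable P : probability Omega R.

(* The step called X_j (j >= 1) in the mathematical text is X j.-1, so that the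
   generic step X_1 is X 0. *)
Variable X : nat -> Omega -> 'rV[int]_d.

Definition walk (n : nat) (w : Omega) : 'rV[int]_d := \sum_(j < n) X j w.

Definition step_coord (i : 'I_d) (w : Omega) : R := (X 0%N w 0 i)%:~R.

Definition step_support : set 'rV[int]_d :=
  [set x | (0 < P (X 0%N @^-1` [set x]))%E].

Definition second_moment (i : 'I_d) : \bar R :=
  'E_P[(fun w => step_coord i w ^+ 2)%R]%E.

Definition trunc_second_moment (i : 'I_d) (x : R) : R :=
  fine 'E_P[(fun w => step_coord i w ^+ 2 * (`|step_coord i w| <= x)%R%:R)%R]%E.

Definition mean (i : 'I_d) : R := fine 'E_P[step_coord i]%E.

Definition trunc_mean (i : 'I_d) (x : R) : R :=
  fine 'E_P[(fun w => step_coord i w * (`|step_coord i w| <= x)%R%:R)%R]%E.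

Definition right_tail (i : 'I_d) (x : R) : \bar R :=
  P [set w | x < step_coord i w].

Definition left_tail (i : 'I_d) (x : R) : \bar R :=
  P [set w | step_coord i w <= - x].

(* Tails are compared to L_i(x) x^(-alpha_i) through the limit of the ratio,
   which covers the vanishing of p_i or q_i. *)
Definition marginal_tails (alpha p q : 'I_d -> R) (L : 'I_d -> R -> R) : Prop :=
  forall i,
    (alpha i < 2 ->
      [/\ slowly_varying (L i), forall x, 0 < x -> 0 < L i x,
          [/\ 0 <= p i, 0 <= q i & p i + q i = 1],
          fine (right_tail i x) / (L i x * x `^ (- alpha i))
            @[x --> +oo] --> p i &
          fine (left_tail i x) / (L i x * x `^ (- alpha i))
            @[x --> +oo] --> q i]) /\
    (alpha i = 2 -> slowly_varying (trunc_second_moment i)).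

Definition scaling (alpha : 'I_d -> R) (L : 'I_d -> R -> R)
    (a : nat -> 'I_d -> R) : Prop :=
  forall i,
    [/\ forall n, (0 < n)%N -> 0 < a n i,
        alpha i < 2 ->
          n%:R * (L i (a n i) * a n i `^ (- alpha i)) @[n --> \oo] --> (1 : R) &
        alpha i = 2 ->
          n%:R * (trunc_second_moment i (a n i) * (a n i) ^- 2)
            @[n --> \oo] --> (1 : R)].

Definition recentering (alpha : 'I_d -> R) (a : nat -> 'I_d -> R)
    (n : nat) (i : 'I_d) : R :=
  if alpha i < 1 then 0
  else if alpha i == 1 then n%:R * trunc_mean i (a n i)
  else n%:R * mean i.

Definition normalized_walk (a b : nat -> 'I_d -> R) (n : nat) (w : Omega) :
    'rV[R]_d :=
  \row_i (((walk n w 0 i)%:~R - b n i) / a n i).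

Definition centered_walk (b : nat -> 'I_d -> R) (n : nat) (w : Omega) :
    'rV[int]_d :=
  walk n w - \row_i Num.floor (b n i).

(* The domination is asked at k >= 1 only: at k = 0 its right-hand side is
   infinite, whereas powR 0 (- gamma i) is 0. *)
Definition tail_domination (alpha : 'I_d -> R) (L : 'I_d -> R -> R)
    (phi : 'I_d -> R -> R) (gamma : 'I_d -> R) : Prop :=
  forall i,
    [/\ slowly_varying (phi i) /\ (forall x, 0 <= x -> 0 < phi i x),
        alpha i <= gamma i,
        forall k : nat, (0 < k)%N ->
          (left_tail i k%:R + right_tail i k%:R <=
           (phi i k%:R * k%:R `^ (- gamma i))%:E)%E,
        second_moment i = +oo%E ->
          [/\ gamma i = alpha i,
              alpha i < 2 ->
                exists c : R, forall x, 0 < x -> phi i x = c * L i x &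
              alpha i = 2 ->
                exists K : R, \forall x \near +oo,
                  phi i x <= K * trunc_second_moment i x] &
        (second_moment i < +oo)%E ->
          (\sum_(1 <= n <oo) (phi i n%:R * n%:R `^ (1 - gamma i))%:E < +oo)%E].

(* The bound on the ratio h_u'(v) / h_u(v) is written as a product so that
   zeros of h are not hidden by the convention x / 0 = 0. *)
Definition admissible_weight (h : nat -> nat -> R) : Prop :=
  [/\ forall u v, 0 <= h u v <= 1,
      (ereal_sup [set (\sum_(0 <= v <oo) (h u v / (1 + v%:R))%:E)%E
                 | u in [set: nat]] < +oo)%E &
      exists K : R, forall u u' v, (u <= u' <= 2 * u)%N ->
        h u' v <= K * h u v].

Definition local_assumption (phi : 'I_d -> R -> R) (gamma : 'I_d -> R)
    (h : 'I_d -> nat -> nat -> R) : Prop :=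
  (forall i, admissible_weight (h i)) /\
  exists C : R, forall (i : 'I_d) (x : 'rV[int]_d),
    (P (X 0%N @^-1` [set x]) <=
     (C * phi i `|x 0%R i|%N%:R * (1 + `|x 0%R i|%N%:R) `^ (- gamma i)
        / (\prod_j (1 + `|x 0%R j|%N%:R))
      * \prod_(j | j != i) h i `|x 0%R i|%N `|x 0%R j|%N)%:E)%E.

End walk.

Definition tail_term {R : realType} (phi : R -> R) (gamma : R) (k : nat) :
    \bar R :=
  if k == 0%N then +oo%E else (phi k%:R * k%:R `^ (- gamma))%:E.

(* Main.v *)
Require Import Defs.
From mathcomp Require Import all_boot all_order all_algebra.
From mathcomp Require Import all_classical all_reals all_analysis.
From mathcomp Require Import measurable_realfun.
From mathcomp Require Import complex.
From mathcomp Require Import ring lra zify.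
Import Order.TTheory GRing.Theory Num.Theory.
Import numFieldNormedType.Exports.
Set Implicit Arguments.
Unset Strict Implicit.
Unset Printing Implicit Defensive.
Local Open Scope classical_set_scope.
Local Open Scope ring_scope.

(* Write T_i(k) for phi_i(k) k^(-gamma_i), regularized near 0 (Potter bounds), and replace the scaling
   sequences by a'_n = max(a_n, A_0).  Bounds on the characteristic function near and away from 0
   (aperiodicity, density of the limit) give P(S_n = x on the coordinates of A) <= C / prod_A a'_n for
   every set A of coordinates.  If some |x_i| >> a'_n, look at the steps.  When all the steps are small
   compared with the large coordinates of x, one half of the path deviates in a large coordinate, which
   a Fuk-Nagaev inequality makes unlikely, while the other half is controlled by the local bound.
   Otherwise some step z is large in a nonempty set J' of coordinates; assumption (H), with |z_t|
   (t in J') sorted by dyadic scale, lets one sum over the positions of z, and the path without this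
   step only has to reach its target on the coordinates outside J', which is handled by induction on
   the number of prescribed coordinates. *)

(** * Potter bounds *)

(** Paths are summed with steps in a finite cube of side [2 * M + 1], with bounds that do not depend
    on [M]; the law of the walk is recovered as [M] tends to infinity, so that removing, reordering
    and pinning steps is finite algebra. The obstacle is that a path deprived of a large step z must
    hit a target that moves with z. In the coordinates of J' the rest of the path determines z, and
    the factors 1 / |x_t|, t in J', must come from (H), which provides them as 1 / (1 + |z_t|); the
    other coordinates of z are summed by condition (ii) on h. This is why the induction hypothesis
    concerns marginal events on a set of coordinates. Scales stay frozen at the original time n
    while steps are removed: each removal frees a coordinate, so at most d steps are ever missing,
    and the local bounds tolerate this lag. The gain in coordinate i comes from the removed step if
    i is in J', from the remaining path otherwise, hence an optional tail factor in the
    induction. *)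

Lemma lebesgue_scale (R : realType) (c : R) (A : set R) : 0 < c ->
  measurable A ->
  (@lebesgue_measure R A = c%:E * @lebesgue_measure R ((fun s : R => (c * s)%R) @^-1` A))%E.
Proof.
move=> c0 mA.
have mf : measurable_fun [set: measurableTypeR R] (fun s : measurableTypeR R => c * s : measurableTypeR R) by exact: measurable_funM.
pose mu : {measure set (measurableTypeR R) -> \bar R} :=
  mscale (NngNum (ltW c0)) (measure_function.measure_function_pushforward__canonical__measure_function_Measure (@lebesgue_measure R) mf).
rewrite (@lebesgue_measure_unique R mu)//.
move=> X /ocitvP [->|[[a b] /= ab ->]].
  by rewrite !measure0.
rewrite /mu /mscale /pushforward /=.
have E : (fun s : measurableTypeR R => c * s : measurableTypeR R) @^-1` `]a, b]%classic = `]a / c, b / c]%classic.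
  by apply/seteqP; split=> x /=; rewrite !in_itv /= ltr_pdivrMr // ler_pdivlMr // mulrC.
rewrite -[X in (_ * X)%E]/(@lebesgue_measure R ((fun s : measurableTypeR R => c * s : measurableTypeR R) @^-1` `]a, b]%classic)) E.
rewrite !lebesgue_measure_itv /= !lte_fin ab ltr_pM2r ?invr_gt0// ab.
rewrite -!EFinB -EFinM; congr (_%:E).
by field; lra.
Qed.

(** Egorov's theorem makes the pointwise convergence of the ratios uniform outside a set of small
    measure; the measurability of [f] enters here. *)
Lemma slowly_varying_egorov (R : realType) (f : R -> R) (x : nat -> R) (b e : R) :
  slowly_varying f -> (forall k, 0 < x k) -> x @ \oo --> +oo -> 0 < e ->
  exists B k0, [/\ measurable B, (@lebesgue_measure R B < e%:E)%E &
   forall k s, (k0 <= k)%N -> 1 <= s <= b -> ~ B s -> `|f (s * x k) / f (x k) - 1| < 1 / 2].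
Proof.
move=> [mf _ sv] xp xoo e0.
have mA : measurable `[1, b]%classic by [].
have [| | |] := @measurable_realfun.pointwise_almost_uniform _ R _ (@lebesgue_measure R)
  (fun k s => f (s * x k) / f (x k)) (fun=> 1) `[1, b]%classic e _ mA _ _ e0.
- move=> n; apply: measurable_funM => //.
  suff H : measurable_fun (`[1, b]%classic : set R) (f \o (fun s : R => s * x n)) by exact: H.
  apply: (measurable_comp (F := `]0, +oo[%classic : set R) _ _ mf) => //.
    by move=> _ [s /= + <-]; rewrite !in_itv /= andbT => /andP[s1 _]; rewrite mulr_gt0 // (lt_le_trans _ s1).
  exact: measurable_funM.
- have := @lebesgue_measure_itv R `[1, b]; rewrite /= => H; apply: (@le_lt_trans _ _ (if (1%:E < b%:E)%E then (b%:E - 1%:E)%E else 0%E)); first by rewrite le_eqVlt; apply/orP; left; apply/eqP; exact: H.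
  by case: ifP => // _; rewrite -EFinB ltry.
- move=> s /=; rewrite in_itv/= => /andP[s1 _].
  have s0 : 0 < s by exact: lt_le_trans s1.
  have := sv s s0.
  by move=> /(cvg_comp _ _ xoo).
move=> B [mB Be unif].
pose S : set (R -> R) := [set h | forall y, (`[1, b]%classic `\` B) y -> `|1 - h y| < 1 / 2].
have [|k0 _ hk0] := unif S.
  case: (@uniform_nbhs (measurableTypeR R) (`[1, b]%classic `\` B) R (fun=> 1) S) => _; apply.
  exists [set xy : R * R | ball xy.1 (1/2) xy.2]; split.
    by have := @entourage_ball R R (PosNum (ltac:(lra) : 0 < (1/2 : R))).
  by move=> h /= hh y yB; have := hh y yB; rewrite -ball_normE.
exists B, k0; split=> // k s kk sb nB.
by rewrite distrC; apply: hk0.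
Qed.

(** By contradiction, along points [x k] and factors [c k] that violate the bounds: [f (x k)] and
    [f (c k * x k)] are both comparable with [f] at the common point [c k * s * x k], as soon as [s]
    avoids two exceptional sets. The constant 16 is not optimized. *)
Lemma slowly_varying_local (R : realType) (f : R -> R) : slowly_varying f ->
  exists2 x0 : R, 1 <= x0 & forall x c, x0 <= x -> 1 <= c <= 2 ->
    [/\ 0 < f x, f (c * x) <= 16 * f x & f x <= 16 * f (c * x)].
Proof.
move=> svf; have [mf pos sv] := svf.
have [M [_ Mpos]] := pos.
apply: contrapT => /forall2NP h.
have hx (k : nat) : exists xc : R * R, [/\ k%:R + 1 + `|M| <= xc.1, 1 <= xc.2 <= 2 &
   ~ [/\ 0 < f xc.1, f (xc.2 * xc.1) <= 16 * f xc.1 & f xc.1 <= 16 * f (xc.2 * xc.1)]].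
  have [|] := h (k%:R + 1 + `|M|).
    by move=> /negP; rewrite -ltNge => ?; have := normr_ge0 M; have := ler0n R k; lra.
  move=> /existsNP[x /existsNP[c /not_implyP[h1 /not_implyP[h2 h3]]]].
  by exists (x, c).
have [xc {}hx] := choice hx.
pose x k := (xc k).1; pose c k := (xc k).2.
have xk k : k%:R <= x k.
  by have [+ _ _] := hx k; rewrite -/(x k); have := normr_ge0 M; lra.
have xM k : M < x k.
  by have [+ _ _] := hx k; rewrite -/(x k); have := ler_norm M; have := ler0n R k; lra.
have xp k : 0 < x k.
  by have [+ _ _] := hx k; rewrite -/(x k); have := normr_ge0 M; have := ler0n R k; lra.
have c12 k : 1 <= c k <= 2 by have [] := hx k.
have cp k : 0 < c k by have := c12 k; lra.
have yk k : x k <= c k * x k by rewrite ler_peMl ?(ltW (xp k))//; have := c12 k; lra.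
have xoo : x @ \oo --> +oo.
  by apply: (@ger_cvgy _ _ _ _ (fun k => k%:R)); [exact: nearW | exact: cvgr_idn].
have yoo : (fun k => c k * x k) @ \oo --> +oo.
  by apply: (@ger_cvgy _ _ _ _ x) => //; exact: nearW.
(* [c k * s] ranges over [[1, 4]] when both factors lie in [[1, 2]]. *)
have [B1 [k1 [mB1 lB1 hB1]]] := @slowly_varying_egorov _ f x 4 (1/4) svf xp xoo ltac:(lra).
have [B2 [k2 [mB2 lB2 hB2]]] := @slowly_varying_egorov _ f (fun k => c k * x k) 2 (1/4) svf
  (fun k => mulr_gt0 (cp k) (xp k)) yoo ltac:(lra).
pose k := maxn k1 k2.
suff : exists s, [/\ 1 <= s <= 2, ~ B1 (c k * s) & ~ B2 s].
  move=> [s [s12 nB1 nB2]]; have [_ _] := hx k; apply.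
  rewrite -/(x k) -/(c k).
  have ck := c12 k.
  have h1 := hB1 k (c k * s) (leq_maxl _ _) ltac:(nra) nB1.
  have h2 := hB2 k s (leq_maxr _ _) s12 nB2.
  have fx : 0 < f (x k) by exact: Mpos.
  have fy : 0 < f (c k * x k) by apply: Mpos; exact: lt_le_trans (yk k).
  rewrite -mulrA (mulrCA (c k)) in h1.
  move: h1 h2; set F := f (s * _).
  rewrite !ltr_norml => /andP[a1 a2] /andP[b1 b2].
  have {}a1 : 1/2 * f (x k) < F by rewrite -ltr_pdivlMr//; lra.
  have {}a2 : F < 3/2 * f (x k) by rewrite -ltr_pdivrMr//; lra.
  have {}b1 : 1/2 * f (c k * x k) < F by rewrite -ltr_pdivlMr//; lra.
  have {}b2 : F < 3/2 * f (c k * x k) by rewrite -ltr_pdivrMr//; lra.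
  by split => //; lra.
(* As [c k >= 1], the preimage of [B1] under multiplication by [c k] is no larger than [B1]; the two
   bad sets have total measure below 1/2 and cannot cover [[1, 2]]. *)
apply: contrapT => hno.
have : (@lebesgue_measure R `[1%R, 2%R]%classic <= @lebesgue_measure R (B2 `|` ((fun s : R => (c k * s)%R) @^-1` B1)))%E.
  have mf' : measurable_fun [set: R] (fun s : R => c k * s) by exact: measurable_funM.
  have mp : measurable ((fun s : R => (c k * s)%R) @^-1` B1).
    by rewrite -[X in measurable X]setTI; exact: mf'.
  apply: le_measure; rewrite ?inE//; first exact: measurableU.
  move=> s /=; rewrite in_itv /= => s12.
  have [|nB2] := pselect (B2 s); first by left.
  have [|nB1] := pselect (B1 (c k * s)); first by right.
  by case: hno; exists s.
rewrite lebesgue_measure_itv/= lte_fin ltr1n -EFinB; apply/negP; rewrite -ltNge.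
have mf' : measurable_fun [set: R] (fun s : R => c k * s) by exact: measurable_funM.
have mp : measurable ((fun s : R => (c k * s)%R) @^-1` B1).
  by rewrite -[X in measurable X]setTI; exact: mf'.
apply: (le_lt_trans (measureU2 _ _ _)) => //.
have l1 : (@lebesgue_measure R ((fun s : R => (c k * s)%R) @^-1` B1) <= @lebesgue_measure R B1)%E.
  rewrite (lebesgue_scale (cp k) mB1) lee_pemull// ?measure_ge0// lee_fin.
  by have := c12 k; lra.
apply: (@lt_le_trans _ _ ((1/4)%:E + (1/4)%:E)%E).
  by apply: lteD => //; exact: le_lt_trans lB1.
by rewrite -EFinD lee_fin; lra.
Qed.

(** Each doubling of the argument changes [f] by a factor at most 2^delta either way, and the
    incomplete last doubling costs the factor 16 of the local bound. *)
Lemma slowly_varying_potter (R : realType) (f : R -> R) (delta : R) :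
  slowly_varying f -> 0 < delta ->
  exists2 x0 : R, 1 <= x0 & forall x y, x0 <= x -> x <= y ->
    [/\ 0 < f x, f y <= 16 * (y / x) `^ delta * f x
      & f x <= 16 * (y / x) `^ delta * f y].
Proof.
move=> svf d0; have [x0 x01 hx0] := slowly_varying_local svf.
have [_ _ sv] := svf.
have h2 : 1 < 2 `^ delta :> R.
  have := @gt0_ltr_powR R _ d0 1 2; rewrite powR1; apply; rewrite ?nnegrE//; lra.
have /cvgr_dist_lt : f (2 * x) / f x @[x --> +oo] --> (1 : R) by exact: sv.
(* This tolerance is 1 - 2^(-delta): the ratio f(2x) / f(x) then exceeds 2^(-delta) and stays below
   2 - 2^(-delta) <= 2^delta. *)
have e0 : 0 < (2 `^ delta - 1) / 2 `^ delta :> R by rewrite divr_gt0; lra.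
move=> /(_ _ e0) [M [_ hM]].
have {}hM x : M < x -> x0 <= x -> f (2 * x) <= 2 `^ delta * f x /\ f x <= 2 `^ delta * f (2 * x).
  move=> Mx x0x; have := hM x Mx.
  have [fx _ _] := hx0 x 1 x0x ltac:(lra).
  rewrite distrC ltr_norml => /andP[].
  have -> : (2 `^ delta - 1) / 2 `^ delta = 1 - (2 `^ delta)^-1 :> R by field; lra.
  have w1 : (2 `^ delta)^-1 <= 1 :> R by rewrite invf_le1; lra.
  have w2 : 1 < (2 `^ delta) :> R by lra.
  have w3 : 2 - (2 `^ delta)^-1 <= 2 `^ delta :> R.
    have : 0 < (2 `^ delta)^-1 :> R by rewrite invr_gt0; lra.
    have : (2 `^ delta)^-1 * (2 `^ delta) = 1 :> R by rewrite mulVf//; lra.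
    by nra.
  move=> h3 h4; split.
    by rewrite -ler_pdivrMr//; lra.
  have : (2 `^ delta)^-1 < f (2 * x) / f x by lra.
  rewrite ltr_pdivlMr// ltr_pdivrMl; last lra.
  by move/ltW.
exists (Num.max (M + 1) x0); first by rewrite le_max x01 orbT.
move=> x y; rewrite ge_max => /andP[Mx x0x] xy.
have [n hn] : exists n : nat, y <= 2 ^+ n * x.
  exists (Num.bound (y / x)); rewrite -ler_pdivrMr; last lra.
  apply: (@le_trans _ _ (Num.bound (y / x))%:R).
    by apply: ltW; apply: archi_boundP; rewrite divr_ge0; lra.
  by rewrite -natrX ler_nat ltnW// ltn_expl.
elim: n x y Mx x0x xy hn => [|n IH] x y Mx x0x xy hn.
  have <- : x = y by lra.
  rewrite divff ?powR1; last lra.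
  have [fx _ _] := hx0 x 1 x0x ltac:(lra).
  by split; lra.
have [fx _ _] := hx0 x 1 x0x ltac:(lra).
have [y2|y2] := leP y (2 * x).
  have [] := hx0 x (y / x) x0x.
    by rewrite ler_pdivlMr ?ler_pdivrMr; lra.
  rewrite divfK; last lra.
  move=> _ h3 h4; split=> //.
    apply: (le_trans h3); rewrite ler_pM2r// ler_peMr// -(powRr0 (y/x)).
    by apply: ler_powR; [rewrite ler_pdivlMr; lra | lra].
  have fy : 0 < f y by lra.
  apply: (le_trans h4); rewrite ler_pM2r// ler_peMr// -(powRr0 (y/x)).
  by apply: ler_powR; [rewrite ler_pdivlMr; lra | lra].
have [f2 h3 h4] := IH (2 * x) y ltac:(lra) ltac:(lra) (ltW y2) ltac:(by rewrite exprSr in hn; lra).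
have [h5 h6] := hM x ltac:(lra) x0x.
have e : (y / x) `^ delta = 2 `^ delta * (y / (2 * x)) `^ delta.
  rewrite -powRM //; last by rewrite divr_ge0; lra.
  by congr (_ `^ _); field; lra.
have q0 : 0 <= (y / (2 * x)) `^ delta by exact: powR_ge0.
split => //; rewrite e.
  apply: (le_trans h3); rewrite mulrCA -!mulrA.
  rewrite (mulrCA (2 `^ _)) ler_wpM2l// (mulrCA (2 `^ _)).
  by rewrite ler_wpM2l.
apply: (le_trans h6).
rewrite (_ : 16 * _ * _ = 2 `^ delta * (16 * (y / (2 * x)) `^ delta * f y)); last by ring.
by rewrite ler_wpM2l// powR_ge0.
Qed.

(** * Path sums *)

Section bounded_expectation.
Context {R : realType} {dO : measure_display} {Omega : measurableType dO}.
Variable P : probability Omega R.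

(** The class on which the real-valued expectation [Er] is linear and monotone, with no
    integrability condition to carry along. *)
Definition bmf (f : Omega -> R) : Prop :=
  measurable_fun [set: Omega] f /\ exists K : R, forall w, `|f w| <= K.

Definition Er (f : Omega -> R) : R := fine 'E_P[f]%E.

Lemma ErE f : Er f = \int[P]_w f w.
Proof. by rewrite /Er unlock. Qed.

Lemma bmf_integrable f : bmf f -> P.-integrable setT (EFin \o f).
Proof.
move=> [mf [K hK]]; apply: measurable_bounded_integrable => //.
  by rewrite -ge0_fin_numE ?measure_ge0// fin_num_measure.
exists K; split; first exact: num_real.
by move=> x /ltW Kx w _; exact: le_trans (hK w) Kx.
Qed.

Lemma bmf_cst c : bmf (fun=> c).
Proof. by split; [exact: measurable_cst | exists `|c|]. Qed.

Lemma bmfD f g : bmf f -> bmf g -> bmf (fun w => f w + g w).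
Proof.
move=> [mf [K hK]] [mg [K' hK']]; split; first exact: measurable_funD.
by exists (K + K') => w; exact: le_trans (ler_normD _ _) (lerD (hK w) (hK' w)).
Qed.

Lemma bmfM f g : bmf f -> bmf g -> bmf (fun w => f w * g w).
Proof.
move=> [mf [K hK]] [mg [K' hK']]; split; first exact: measurable_funM.
by exists (K * K') => w; rewrite normrM ler_pM.
Qed.

Lemma bmfZ c f : bmf f -> bmf (fun w => c * f w).
Proof. by move=> bf; apply: bmfM => //; exact: bmf_cst. Qed.

Lemma bmf_sum I (r : seq I) (Q : pred I) (F : I -> Omega -> R) :
  (forall i, bmf (F i)) -> bmf (fun w => \sum_(i <- r | Q i) F i w).
Proof.
move=> bF; elim: r => [|a r IH].
  by under eq_fun do rewrite big_nil; exact: bmf_cst.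
under eq_fun do rewrite big_cons.
by case: (Q a) => //; apply: bmfD.
Qed.

Lemma bmf_prod I (r : seq I) (Q : pred I) (F : I -> Omega -> R) :
  (forall i, bmf (F i)) -> bmf (fun w => \prod_(i <- r | Q i) F i w).
Proof.
move=> bF; elim: r => [|a r IH].
  by under eq_fun do rewrite big_nil; exact: bmf_cst.
under eq_fun do rewrite big_cons.
by case: (Q a) => //; apply: bmfM.
Qed.

Lemma ErD f g : bmf f -> bmf g -> Er (fun w => f w + g w) = Er f + Er g.
Proof. by move=> bf bg; rewrite !ErE RintegralD//; exact: bmf_integrable. Qed.

Lemma ErZ c f : bmf f -> Er (fun w => c * f w) = c * Er f.
Proof. by move=> bf; rewrite !ErE RintegralZl//; exact: bmf_integrable. Qed.

Lemma Er_cst c : Er (fun=> c) = c.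
Proof. by rewrite /Er expectation_cst. Qed.

Lemma ErB f g : bmf f -> bmf g -> Er (fun w => f w - g w) = Er f - Er g.
Proof.
move=> bf bg; under [in LHS]eq_fun do rewrite -mulN1r.
by rewrite ErD ?ErZ ?mulN1r//; exact: bmfZ.
Qed.

Lemma Er_sum I (r : seq I) (Q : pred I) (F : I -> Omega -> R) :
  (forall i, bmf (F i)) ->
  Er (fun w => \sum_(i <- r | Q i) F i w) = \sum_(i <- r | Q i) Er (F i).
Proof.
move=> bF; elim: r => [|a r IH].
  by rewrite big_nil; under eq_fun do rewrite big_nil; rewrite Er_cst.
rewrite big_cons -IH; under eq_fun do rewrite big_cons.
by case: (Q a) => //; rewrite ErD//; exact: bmf_sum.
Qed.

Lemma Er_indic A : measurable A -> Er (\1_A) = fine (P A).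
Proof. by move=> mA; rewrite /Er expectation_indic. Qed.

Lemma le_Er f g : bmf f -> bmf g -> (forall w, f w <= g w) -> Er f <= Er g.
Proof.
by move=> bf bg fg; rewrite !ErE le_Rintegral//; exact: bmf_integrable.
Qed.

Lemma Er_ge0 f : (forall w, 0 <= f w) -> 0 <= Er f.
Proof. by move=> f0; rewrite ErE Rintegral_ge0. Qed.

Lemma Er_norm f : bmf f -> `|Er f| <= Er (fun w => `|f w|).
Proof.
by move=> bf; rewrite !ErE le_normr_Rintegral//; exact: bmf_integrable.
Qed.

Lemma bmf_norm f : bmf f -> bmf (fun w => `|f w|).
Proof.
move=> [mf [K hK]]; split; first exact: measurableT_comp.
by exists K => w; rewrite normr_id.
Qed.

End bounded_expectation.

Section discrete.
Context {R : realType} {dO : measure_display} {Omega : measurableType dO}.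

Definition discrete_rv (E : Type) (Y : Omega -> E) : Prop :=
  forall A : set E, measurable (Y @^-1` A).

Lemma discrete_rv_comp (E F : Type) (Y : Omega -> E) (g : E -> F) :
  discrete_rv Y -> discrete_rv (g \o Y).
Proof. by move=> dY A; rewrite comp_preimage; exact: dY. Qed.

(** Countability turns any preimage into a countable union of rectangles, enumerated through
    [unpickle]. *)
Lemma discrete_rv_pair (E F : countType) (Y : Omega -> E) (Y' : Omega -> F) :
  discrete_rv Y -> discrete_rv Y' -> discrete_rv (fun w => (Y w, Y' w)).
Proof.
move=> dY dY' A.
pose S (k : nat) := if (unpickle k : option (E * F)) is Some ef then
  [set w | A ef] `&` (Y @^-1` [set ef.1] `&` Y' @^-1` [set ef.2]) else set0.
rewrite (_ : _ @^-1` A = \bigcup_k S k).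
  apply: bigcup_measurable => k _; rewrite /S; case: (unpickle k) => // ef.
  apply: measurableI; last by apply: measurableI; [exact: dY | exact: dY'].
  have [Aef|nA] := pselect (A ef).
    by rewrite (_ : [set w | A ef] = setT)//; apply/seteqP; split.
  by rewrite (_ : [set w | A ef] = set0)//; apply/seteqP; split.
apply/seteqP; split=> w /=.
  by move=> AY; exists (pickle (Y w, Y' w)) => //; rewrite /S pickleK.
by move=> [k _]; rewrite /S; case: (unpickle k) => [[e f]|]//= [Aef [-> ->]].
Qed.

Lemma discrete_bmf (E : Type) (Y : Omega -> E) (F : E -> R) :
  discrete_rv Y -> (exists K : R, forall e, `|F e| <= K) -> bmf (F \o Y).
Proof.
move=> dY [K hK]; split.
  by move=> _ B _; rewrite setTI comp_preimage; exact: dY.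
by exists K => w; exact: hK.
Qed.

Lemma discrete_sum_rv d n m (Y : nat -> Omega -> 'rV[int]_d) :
  (forall k, discrete_rv (Y k)) ->
  discrete_rv (fun w => \sum_(m <= k < m + n) Y k w).
Proof.
move=> dY; elim: n => [|n IH].
  move=> A; rewrite addn0 (_ : (fun _ => _) = cst 0); last first.
    by apply/funext => w; rewrite big_geq.
  by rewrite preimage_cst; case: ifP.
rewrite addnS; under eq_fun do rewrite big_nat_recr ?leq_addr//=.
exact: (discrete_rv_comp (fun p => p.1 + p.2) (discrete_rv_pair IH (dY _))).
Qed.

End discrete.

(** * Weighted sums over finite families of paths *)

Section path_sum.
Context {R : realType} {d : nat} {I : finType}.
Variable pt : I -> 'rV[int]_d.
Implicit Types (w : I -> R) (f g : 'rV[int]_d -> R).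

(* [Ex w n f] sums [f] over the end points of the [n]-step paths, each path
   being weighted by the product of the weights of its steps. *)
Fixpoint Ex w (n : nat) f : R :=
  if n is n'.+1 then \sum_e w e * Ex w n' (fun y => f (pt e + y)) else f 0.

Lemma ExS w n f : Ex w n.+1 f = \sum_e w e * Ex w n (fun y => f (pt e + y)).
Proof. by []. Qed.

Lemma Ex_ge0 w n f : (forall e, 0 <= w e) -> (forall y, 0 <= f y) ->
  0 <= Ex w n f.
Proof.
move=> w0; elim: n f => [|n IH] f f0 //=.
by apply: sumr_ge0 => e _; rewrite mulr_ge0// IH.
Qed.

Lemma le_Ex w n f g : (forall e, 0 <= w e) -> (forall y, f y <= g y) ->
  Ex w n f <= Ex w n g.
Proof.
move=> w0; elim: n f g => [|n IH] f g fg //=.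
by apply: ler_sum => e _; rewrite ler_wpM2l// IH.
Qed.

Lemma le_Ex_weight w w' n f : (forall e, 0 <= w e <= w' e) ->
  (forall y, 0 <= f y) -> Ex w n f <= Ex w' n f.
Proof.
move=> ww'; elim: n f => [|n IH] f f0 //=.
apply: ler_sum => e _; have /andP[? ?] := ww' e.
by apply: ler_pM => //; [apply: Ex_ge0 => // e'; case/andP: (ww' e')| exact: IH].
Qed.

Lemma Ex_sum w n J (r : seq J) (Q : pred J) (F : J -> 'rV[int]_d -> R) :
  Ex w n (fun y => \sum_(j <- r | Q j) F j y) = \sum_(j <- r | Q j) Ex w n (F j).
Proof.
elim: n F => [|n IH] F //=.
rewrite exchange_big /=; apply: eq_bigr => e _.
by rewrite IH mulr_sumr.
Qed.

Lemma ExZ w n c f : Ex w n (fun y => c * f y) = c * Ex w n f.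
Proof.
elim: n f => [|n IH] f //=; rewrite mulr_sumr; apply: eq_bigr => e _.
by rewrite IH mulrCA.
Qed.

Lemma ExD w n f g : Ex w n (fun y => f y + g y) = Ex w n f + Ex w n g.
Proof.
elim: n f g => [|n IH] f g //=; rewrite -big_split /=; apply: eq_bigr => e _.
by rewrite IH mulrDr.
Qed.

Lemma Ex_add w m n f :
  Ex w (m + n) f = Ex w m (fun x => Ex w n (fun y => f (x + y))).
Proof.
elim: m f => [|m IH] f /=.
  by under [in RHS]eq_fun do rewrite add0r.
apply: eq_bigr => e _; rewrite IH; congr (_ * Ex _ _ _).
by apply/funext => x; under eq_fun do rewrite addrA.
Qed.

Lemma Ex_swap w w' m n (F : 'rV[int]_d -> 'rV[int]_d -> R) :
  Ex w m (fun x => Ex w' n (F x)) = Ex w' n (fun y => Ex w m (F^~ y)).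
Proof.
elim: m F => [|m IH] F //=.
by rewrite Ex_sum; apply: eq_bigr => e _; rewrite IH ExZ.
Qed.

(** Factorization of the Laplace transform; the constant [c] collects the contributions of the steps
    already taken, so that the induction closes. *)
Lemma Ex_expR w n (i : 'I_d) (c lam : R) :
  Ex w n (fun y => expR (c + lam * (y 0 i)%:~R)) =
  expR c * (\sum_e w e * expR (lam * (pt e 0 i)%:~R)) ^+ n.
Proof.
elim: n c => [|n IH] c /=; first by rewrite mxE mulr0 addr0 mulr1.
rewrite exprS mulrCA mulr_suml; apply: eq_bigr => e _.
under eq_fun do rewrite mxE intrD mulrDr addrA.
by rewrite IH expRD; ring.
Qed.

(* Distinguish the first step of the path that is not small. *)
Lemma Ex_big_step w (small : pred I) n f : (forall e, 0 <= w e) ->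
  (forall y, 0 <= f y) ->
  Ex w n f <= Ex (fun e => w e * (small e)%:R) n f +
    n%:R * \sum_(e | ~~ small e) w e * Ex w n.-1 (fun y => f (pt e + y)).
Proof.
move=> w0; elim: n f => [|n IH] f f0 /=; first by rewrite mul0r addr0.
rewrite (bigID small) /= -[n.+1%:R]/((1 + n)%:R) natrD mulrDl mul1r.
rewrite addrCA [leLHS]addrC lerD2l.
have -> : \sum_e w e * (small e)%:R * Ex (fun e0 => w e0 * (small e0)%:R) n (fun y => f (pt e + y))
  = \sum_(e | small e) w e * Ex (fun e0 => w e0 * (small e0)%:R) n (fun y => f (pt e + y)).
  rewrite [LHS](bigID small) /= [X in _ + X]big1 ?addr0; last first.
    by move=> e /negbTE ->; rewrite mulr0 mul0r.
  by apply: eq_bigr => e ->; rewrite mulr1.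
apply: (@le_trans _ _ (\sum_(e | small e) w e * (Ex (fun e0 => w e0 * (small e0)%:R) n (fun y => f (pt e + y)) +
  n%:R * \sum_(e' | ~~ small e') w e' * Ex w n.-1 (fun y => f (pt e + (pt e' + y)))))).
  by apply: ler_sum => e _; rewrite ler_wpM2l// IH.
under [leLHS]eq_bigr do rewrite mulrDr mulrCA.
rewrite big_split /= lerD2l -mulr_sumr.
case: n {IH} => [|n]; first by rewrite !mul0r.
rewrite ler_wpM2l// /=.
under eq_bigr do rewrite mulr_sumr.
rewrite exchange_big /=; apply: ler_sum => e' _.
under eq_bigr do rewrite mulrCA.
rewrite -mulr_sumr ler_wpM2l//.
rewrite [leRHS](bigID small) /= -[leLHS]addr0 lerD//; last first.
  by apply: sumr_ge0 => e _; rewrite mulr_ge0// Ex_ge0.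
apply: ler_sum => e _; rewrite ler_wpM2l// le_Ex// => y.
by rewrite addrCA.
Qed.

End path_sum.

(** The cube of the points with coordinates in [[-M, M]], as a finite type: [pt] undoes the shift by
    [M], so that the index [M] stands for the coordinate 0. *)
Definition box (d M : nat) : finType := {ffun 'I_d -> 'I_(M.*2.+1)}.

Definition pt d M (e : box d M) : 'rV[int]_d := \row_j ((e j : nat)%:Z - M%:Z).

Definition inbox d M (z : 'rV[int]_d) : bool := [forall j, (`|z 0%R j| <= M)%N].

Lemma pt_inj d M : injective (@pt d M).
Proof.
move=> e e' /rowP ee'; apply/ffunP => j; apply/val_inj => /=.
by have := ee' j; rewrite !mxE => /addIr [].
Qed.

Lemma inbox_pt d M (e : box d M) : inbox M (pt e).
Proof.
apply/forallP => j; rewrite mxE; move: (ltn_ord (e j)); move: (nat_of_ord (e j)) => k; rewrite -addnn; lia.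
Qed.

Lemma inbox_ex d M (z : 'rV[int]_d) : inbox M z -> exists e : box d M, pt e = z.
Proof.
move=> /forallP zM.
exists [ffun j => inord (absz (z 0 j + M%:Z))]; apply/rowP => j; rewrite mxE ffunE.
by rewrite inordK; have := zM j; rewrite -?addnn; lia.
Qed.

Lemma sum_box (R : realType) d M (z : 'rV[int]_d) (F : 'rV[int]_d -> R) :
  \sum_(e : box d M) (z == pt e)%:R * F (pt e) = (inbox M z)%:R * F z.
Proof.
have [zM|zM] := boolP (inbox M z).
  have [e0 e0z] := inbox_ex zM.
  rewrite (bigD1 e0)//= e0z eqxx !mul1r big1 ?addr0// => e ne.
  by rewrite -e0z (inj_eq (@pt_inj _ _)) eq_sym (negbTE ne) mul0r.
rewrite mul0r big1// => e _; case: eqP => [zE|_]; last by rewrite mul0r.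
by move: zM; rewrite zE inbox_pt.
Qed.

(** * The law of the walk as a limit of path sums *)

Section walk_law.
Context {R : realType} {d : nat} {dO : measure_display} {Omega : measurableType dO}.
Variable P : probability Omega R.
Variable X : nat -> Omega -> 'rV[int]_d.
Hypothesis hX : iid discrete_sets P X.

Definition step_pmf (z : 'rV[int]_d) : R := fine (P (X 0%N @^-1` [set z])).

Definition boxw M (e : box d M) : R := step_pmf (pt e).

Lemma step_rv k : discrete_rv (X k).
Proof. by have [h _ _] := hX; move=> A; exact: h. Qed.

Lemma walk_rv n : discrete_rv (walk X n).
Proof.
have := @discrete_sum_rv _ _ d n 0 X step_rv.
by rewrite /walk; under eq_fun do rewrite add0n big_mkord.
Qed.

Lemma step_pmf_ge0 z : 0 <= step_pmf z.
Proof. by rewrite fine_ge0. Qed.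

Lemma step_prob_fin k A : P (X k @^-1` A) \is a fin_num.
Proof. by apply: fin_num_measure; exact: step_rv. Qed.

Lemma Er_joint m (u : nat -> 'rV[int]_d) :
  Er P (fun w => \prod_(k < m) (X k w == u k)%:R) = \prod_(k < m) step_pmf (u k).
Proof.
have [hm hind hlaw] := hX.
rewrite (_ : (fun _ => _) = \1_(\bigcap_(k in `I_m) X k @^-1` [set u k])); last first.
  apply/funext => w; rewrite indicE.
  have [/forallP all_eq|/forallPn[k nk]] := boolP [forall k : 'I_m, X k w == u k].
    rewrite big1 => [|k _]; last by rewrite (all_eq k).
    rewrite mem_set// => k /= km; exact/eqP/(all_eq (Ordinal km)).
  rewrite (bigD1 k)//= (negbTE nk) mul0r memNset// => /(_ k (ltn_ord k)) /= /eqP.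
  exact/negP.
rewrite Er_indic; last first.
  rewrite bigcap_mkcond; apply: bigcapT_measurable => k.
  by case: ifP => // _; exact: step_rv.
rewrite (hind m (fun k => [set u k]))//.
under eq_bigr do rewrite hlaw// -(fineK (step_prob_fin _ _)).
by rewrite prodEFin.
Qed.

(** The first [m] steps are already revealed and equal to [u], the next [n] are only confined to the
    cube. An induction on [n] reveals them one at a time, and independence is used only for the
    product over revealed steps. *)
Definition path_fun M m n (u : nat -> 'rV[int]_d) f (w : Omega) : R :=
  (\prod_(k < m) (X k w == u k)%:R) *
  ((\prod_(m <= k < m + n) (inbox M (X k w))%:R) *
   f (\sum_(m <= k < m + n) X k w)).

Lemma bmf_path_fun M m n u f : (exists K : R, forall z, `|f z| <= K) ->
  bmf (path_fun M m n u f).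
Proof.
move=> bf; apply: bmfM; last apply: bmfM.
- apply: bmf_prod => k; apply: (discrete_bmf (F := fun z => (z == u k)%:R)); first exact: step_rv.
  by exists 1 => z; case: eqP; rewrite ?normr1 ?normr0.
- apply: bmf_prod => k; apply: (discrete_bmf (F := fun z => (inbox M z)%:R)); first exact: step_rv.
  by exists 1 => z; case: inbox; rewrite ?normr1 ?normr0.
- by apply: (discrete_bmf (F := f)) => //; apply: discrete_sum_rv; exact: step_rv.
Qed.

Lemma Er_path_fun M m n u f : (exists K : R, forall z, `|f z| <= K) ->
  Er P (path_fun M m n u f) = (\prod_(k < m) step_pmf (u k)) * Ex (@pt d M) (@boxw M) n f.
Proof.
elim: n m u f => [|n IH] m u f [K hK].
  rewrite /= -Er_joint mulrC -ErZ; last first.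
    apply: bmf_prod => k; apply: (discrete_bmf (F := fun z => (z == u k)%:R)); first exact: step_rv.
    by exists 1 => z; case: eqP; rewrite ?normr1 ?normr0.
  congr (Er P _); apply/funext => w; rewrite /path_fun addn0 !big_geq// mul1r mulrC.
  by [].
rewrite /= mulr_sumr.
pose u' z k := if k == m then z else u k.
rewrite (_ : path_fun M m n.+1 u f = fun w => \sum_(e : box d M)
   path_fun M m.+1 n (u' (pt e)) (fun y => f (pt e + y)) w); last first.
  apply/funext => w; rewrite /path_fun.
  rewrite -addSnnS big_ltn ?leq_addr// [X in f X]big_ltn ?leq_addr//.
  have -> : \sum_(e : box d M) \prod_(k < m.+1) (X k w == u' (pt e) k)%:R *
    (\prod_(m.+1 <= k < m.+1 + n) (inbox M (X k w))%:R *
     f (pt e + \sum_(m.+1 <= k < m.+1 + n) X k w)) =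
    \sum_(e : box d M) (X m w == pt e)%:R * (fun z => \prod_(k < m) (X k w == u k)%:R *
    (\prod_(m.+1 <= k < m.+1 + n) (inbox M (X k w))%:R *
     f (z + \sum_(m.+1 <= k < m.+1 + n) X k w))) (pt e).
    apply: eq_bigr => e _; rewrite big_ord_recr /= /u' eqxx.
    under eq_bigr => k _ do rewrite (ltn_eqF (ltn_ord k)).
    by ring.
  rewrite (@sum_box R d M (X m w) (fun z => \prod_(k < m) (X k w == u k)%:R *
    (\prod_(m.+1 <= k < m.+1 + n) (inbox M (X k w))%:R *
     f (z + \sum_(m.+1 <= k < m.+1 + n) X k w)))).
  by ring.
rewrite Er_sum; last first.
  by move=> e; apply: bmf_path_fun; exists K => z; exact: hK.
apply: eq_bigr => e _; rewrite IH; last by exists K => z; exact: hK.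
rewrite big_ord_recr /= /u' eqxx.
under eq_bigr => k _ do rewrite (ltn_eqF (ltn_ord k)).
by rewrite mulrA.
Qed.

Lemma Er_walk_inbox M n f : (exists K : R, forall z, `|f z| <= K) ->
  Er P (fun w => (\prod_(k < n) (inbox M (X k w))%:R) * f (walk X n w)) =
  Ex (@pt d M) (@boxw M) n f.
Proof.
move=> bf; have := @Er_path_fun M 0 n (fun=> 0) f bf.
rewrite big_ord0 mul1r => <-; congr (Er P _); apply/funext => w.
by rewrite /path_fun big_ord0 mul1r add0n !big_mkord.
Qed.

Definition escape M : R := 1 - Er P (fun w => (inbox M (X 0%N w))%:R).

Lemma bmf_inbox M k : bmf (fun w => (inbox M (X k w))%:R : R).
Proof.
apply: (discrete_bmf (F := fun z => (inbox M z)%:R)); first exact: step_rv.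
by exists 1 => z; case: inbox; rewrite ?normr1 ?normr0.
Qed.

Lemma Er_inbox M k : Er P (fun w => (inbox M (X k w))%:R) = 1 - escape M.
Proof.
have [hm hind hlaw] := hX.
rewrite /escape opprB addrC subrK.
have E j : Er P (fun w => (inbox M (X j w))%:R) = fine (P (X j @^-1` [set z | inbox M z])).
  rewrite -Er_indic; last exact: step_rv.
  congr (Er P _); apply/funext => w; rewrite indicE.
  congr (_%:R); congr nat_of_bool.
  by apply/idP/idP; rewrite inE.
by rewrite !E hlaw.
Qed.

(** Union bound: the product of the indicators that the steps stay in the cube differs from 1 by at
    most the number of escapes. *)
Lemma Er_walk_approx M n f K : (forall z, `|f z| <= K) ->
  `|Er P (f \o walk X n) - Ex (@pt d M) (@boxw M) n f| <= K * (n%:R * escape M).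
Proof.
move=> bf; rewrite -Er_walk_inbox; last by exists K.
have b1 : bmf (f \o walk X n) by apply: discrete_bmf; [exact: walk_rv | exists K].
have b2 : bmf (fun w => \prod_(k < n) (inbox M (X k w))%:R : R).
  by apply: bmf_prod => k; exact: bmf_inbox.
have K0 : 0 <= K by exact: le_trans (bf 0).
rewrite -ErB//; last by apply: bmfM.
apply: (le_trans (Er_norm _ _)).
  by apply: bmfD => //; under eq_fun do rewrite -mulN1r; apply: bmfZ; exact: bmfM.
have b3 k : bmf (fun w => 1 - (inbox M (X k w))%:R : R).
  apply: bmfD; first exact: bmf_cst.
  by under eq_fun do rewrite -mulN1r; apply: bmfZ; exact: bmf_inbox.
apply: (@le_trans _ _ (Er P (fun w => K * \sum_(k < n) (1 - (inbox M (X k w))%:R)))).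
  apply: le_Er.
  - apply: bmf_norm; apply: bmfD => //.
    by under eq_fun do rewrite -mulN1r; apply: bmfZ; exact: bmfM.
  - by apply: bmfZ; apply: bmf_sum.
  move=> w; rewrite /= -[X in X - _]mul1r -mulrBl normrM mulrC ler_pM//.
  elim: {b1 b2} n => [|m IH]; first by rewrite !big_ord0 subrr normr0.
  rewrite !big_ord_recr /=; case: (inbox M (X m w)).
    by rewrite mulr1 subrr addr0.
  rewrite mulr0 !subr0 normr1 lerDr sumr_ge0// => k _.
  by case: inbox; rewrite ?subrr ?subr0.
rewrite ErZ; last by apply: bmf_sum.
rewrite ler_wpM2l// Er_sum// (eq_bigr (fun=> escape M)) ?sumr_const ?card_ord ?mulr_natl//.
move=> k _; rewrite ErB; [|exact: bmf_cst|exact: bmf_inbox].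
by rewrite Er_cst Er_inbox opprB addrC subrK.
Qed.

Lemma escape_cvg : escape M @[M --> \oo] --> (0 : R).
Proof.
suff H : Er P (fun w => (inbox M (X 0%N w))%:R) @[M --> \oo] --> (1 : R).
  rewrite -[X in _ --> X](subrr (1 : R)).
  by apply: cvgB => //; exact: cvg_cst.
have E M : Er P (fun w => (inbox M (X 0%N w))%:R) = fine (P (X 0%N @^-1` [set z | inbox M z])).
  rewrite -Er_indic; last exact: step_rv.
  congr (Er P _); apply/funext => w; rewrite indicE.
  congr (_%:R); congr nat_of_bool.
  by apply/idP/idP; rewrite inE.
rewrite (_ : (fun _ => _) = (fun M => fine (P (X 0%N @^-1` [set z | inbox M z])))); last exact/funext.
suff : fine (P (X 0%N @^-1` [set z | inbox M z])) @[M --> \oo] --> fine (P setT).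
  by rewrite probability_setT.
have -> : setT = \bigcup_M (X 0%N @^-1` [set z | inbox M z]).
  apply/esym/seteqP; split=> // w _.
  exists (\max_j `|X 0%N w 0%R j|)%N => //=.
  by apply/forallP => j; exact: leq_bigmax.
apply: fine_cvg; rewrite fineK; last first.
  by apply: fin_num_measure; apply: bigcup_measurable => k _; exact: step_rv.
apply: nondecreasing_cvg_mu.
- by move=> M; exact: step_rv.
- by apply: bigcup_measurable => k _; exact: step_rv.
- move=> M M' MM'; apply/subsetPset => w /= /forallP h.
  by apply/forallP => j; exact: leq_trans (h j) MM'.
Qed.

Lemma Ex_walk_cvg n f : (exists K : R, forall z, `|f z| <= K) ->
  Ex (@pt d M) (@boxw M) n f @[M --> \oo] --> Er P (f \o walk X n).
Proof.
move=> [K hK].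
have K0 : 0 <= K by exact: le_trans (hK 0).
have cv : K * (n%:R * escape M) @[M --> \oo] --> (0 : R).
  rewrite -(mulr0 K) -[X in K * X](mulr0 n%:R).
  by apply: cvgM; [exact: cvg_cst | apply: cvgM; [exact: cvg_cst | exact: escape_cvg]].
rewrite -[X in _ --> X]subr0.
have -> : (fun M => Ex (@pt d M) (@boxw M) n f) =
  (fun M => Er P (f \o walk X n) - (Er P (f \o walk X n) - Ex (@pt d M) (@boxw M) n f)).
  by apply/funext => M; rewrite opprB addrC subrK.
apply: cvgB; first exact: cvg_cst.
apply/cvgr0Pnorm_lt => e e0.
have /cvgr0Pnorm_lt /(_ e e0) := cv.
apply: filterS => M; apply: le_lt_trans.
by apply: (le_trans (Er_walk_approx M n hK)); exact: ler_norm.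
Qed.

Lemma Ex_le_Er M n f : (forall y, 0 <= f y) -> (exists K : R, forall z, `|f z| <= K) ->
  Ex (@pt d M) (@boxw M) n f <= Er P (f \o walk X n).
Proof.
move=> f0 bf; rewrite -Er_walk_inbox//; apply: le_Er.
- apply: bmfM; first by apply: bmf_prod => k; exact: bmf_inbox.
  by apply: (discrete_bmf (F := f)) => //; exact: walk_rv.
- by apply: discrete_bmf => //; exact: walk_rv.
move=> w /=; rewrite ler_piMl//.
by apply: prodr_ile1 => k _; case: inbox; rewrite ?lexx ?ler01.
Qed.

End walk_law.

(** * Characteristic functions *)

Lemma cvg_exprn (R : realType) (x : nat -> R) (l : R) n :
  x @ \oo --> l -> (fun k => x k ^+ n) @ \oo --> l ^+ n.
Proof.
move=> xl; elim: n => [|n IH].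
  rewrite expr0 (_ : (fun _ => _) = fun=> 1); first exact: cvg_cst.
  by apply/funext => k; rewrite expr0.
rewrite exprS (_ : (fun _ => _) = fun k => x k * x k ^+ n); first exact: cvgM.
by apply/funext => k; rewrite exprS.
Qed.

Lemma cvg_scale0 (R : realType) (c : R) (x : nat -> R) :
  x @ \oo --> (0 : R) -> (fun k => c * x k) @ \oo --> (0 : R).
Proof. by move=> x0; rewrite -(mulr0 c); apply: cvgM => //; exact: cvg_cst. Qed.

Section continuity.
Context {R : realType} {T : topologicalType}.
Implicit Types f g : T -> R.

Lemma cont_add f g : continuous f -> continuous g -> continuous (fun x => f x + g x).
Proof. by move=> cf cg x; exact: continuousD (cf x) (cg x). Qed.

Lemma cont_mul f g : continuous f -> continuous g -> continuous (fun x => f x * g x).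
Proof. by move=> cf cg x; exact: continuousM (cf x) (cg x). Qed.

Lemma cont_comp f (h : R -> R) : continuous f -> continuous h -> continuous (fun x => h (f x)).
Proof. by move=> cf ch x; exact: continuous_comp (cf x) (ch _). Qed.

Lemma cont_cst c : continuous (fun _ : T => c : R).
Proof. exact: cst_continuous. Qed.

Lemma cont_sum I (s : seq I) (F : I -> T -> R) : (forall i, continuous (F i)) ->
  continuous (fun x => \sum_(i <- s) F i x).
Proof.
move=> cF; elim: s => [|i s IH].
  rewrite (_ : (fun x => \sum_(j <- [::]) F j x) = fun=> 0); first exact: cont_cst.
  by apply/funext => u; rewrite big_nil.
rewrite (_ : (fun x => \sum_(j <- i :: s) F j x) = fun x => F i x + \sum_(j <- s) F j x).
  exact: cont_add.
by apply/funext => u; rewrite big_cons.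
Qed.

End continuity.

Section trig.
Context {R : realType}.
Implicit Types x y A B : R.

Lemma lip1 (f g : R -> R) x y : (forall z : R, is_derive z (1 : R) f (g z)) ->
  (forall z, `|g z| <= 1) -> `|f x - f y| <= `|x - y|.
Proof.
move=> dfg g1; wlog xy : x y / x < y.
  move=> H; have [|yx|->] := ltgtP x y; [exact: H| |by rewrite !subrr].
  by rewrite distrC (distrC x); exact: H.
have [|c _ E] := @MVT R f g x y xy.
  apply: derivable_within_continuous => z _.
  by have [] := dfg z.
by rewrite distrC E normrM (distrC x) ler_piMl.
Qed.

Lemma cos_lip x y : `|cos x - cos y| <= `|x - y|.
Proof.
by apply: (@lip1 _ (fun z => - sin z)) => z; rewrite normrN; exact: sin_max.
Qed.

Lemma sin_lip x y : `|sin x - sin y| <= `|x - y|.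
Proof. by apply: (@lip1 _ cos) => z; exact: cos_max. Qed.

Lemma cos_eq1 x : `|x| <= pi -> cos x = 1 -> x = 0.
Proof.
move=> xpi cx; apply/eqP; rewrite -normr_eq0; apply/eqP.
apply: (@cos_inj R); rewrite ?in_itv /= ?normr_ge0 ?xpi ?lexx ?pi_ge0//.
by rewrite cos0; case: ger0P => _; rewrite ?cosN.
Qed.

Lemma sqr_cos_sin_le A B x : (A * cos x + B * sin x) ^+ 2 <= A ^+ 2 + B ^+ 2.
Proof.
rewrite -subr_ge0.
suff -> : A ^+ 2 + B ^+ 2 - (A * cos x + B * sin x) ^+ 2 = (A * sin x - B * cos x) ^+ 2.
  exact: sqr_ge0.
have := cos2Dsin2 x => E.
rewrite -[X in X + _ - _]mulr1 -[X in _ + X - _]mulr1 -E; ring.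
Qed.

Lemma unit_inner A B x : A ^+ 2 + B ^+ 2 = 1 -> A * cos x + B * sin x = 1 ->
  A = cos x /\ B = sin x.
Proof.
move=> AB E; have E2 := cos2Dsin2 x.
have : (A - cos x) ^+ 2 + (B - sin x) ^+ 2 = 0.
  have -> : (A - cos x) ^+ 2 + (B - sin x) ^+ 2 =
    (A ^+ 2 + B ^+ 2) + (cos x ^+ 2 + sin x ^+ 2) - (A * cos x + B * sin x) *+ 2 by ring.
  by rewrite AB E E2; ring.
move=> /eqP; rewrite paddr_eq0 ?sqr_ge0// !sqrf_eq0 !subr_eq0.
by move=> /andP[/eqP -> /eqP ->].
Qed.

Lemma unit_inner2 A B x y : A ^+ 2 + B ^+ 2 = 1 -> A * cos x + B * sin x = 1 ->
  A * cos y + B * sin y = 1 -> cos (x - y) = 1.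
Proof.
move=> AB /(unit_inner AB)[Ax Bx] E.
by rewrite cosB -Ax -Bx.
Qed.

End trig.

Section charfun.
Context {R : realType} {d : nat}.

Definition dot (th v : 'rV[R]_d) : R := \sum_j th 0 j * v 0 j.

Lemma dotDr th v w : dot th (v + w) = dot th v + dot th w.
Proof. by rewrite /dot -big_split; apply: eq_bigr => j _; rewrite mxE mulrDr. Qed.

Lemma dot0 th : dot th 0 = 0.
Proof. by rewrite /dot big1// => j _; rewrite mxE mulr0. Qed.

Lemma dot_continuous th : continuous (dot th).
Proof.
apply: cont_sum => j; apply: cont_mul; first exact: cont_cst.
exact: coord_continuous.
Qed.

Context {dO : measure_display} {Omega : measurableType dO}.
Variable P : probability Omega R.
Implicit Type V : Omega -> 'rV[R]_d.

Definition cosE V th := Er P (fun w => cos (dot th (V w))).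
Definition sinE V th := Er P (fun w => sin (dot th (V w))).
(** Squared modulus of the characteristic function of [V] at [th]; with cosine and sine means kept
    apart, all the analysis stays real. *)
Definition cf2 V th : R := cosE V th ^+ 2 + sinE V th ^+ 2.

Definition trig_meas V := forall th,
  bmf (fun w => cos (dot th (V w))) /\ bmf (fun w => sin (dot th (V w))).

Lemma cf2_inner V th : trig_meas V ->
  Er P (fun w => cosE V th * cos (dot th (V w)) + sinE V th * sin (dot th (V w))) = cf2 V th.
Proof.
move=> /(_ th) [mc ms]; rewrite ErD ?ErZ//; try exact: bmfZ.
Qed.

Lemma cf2_ge0 V th : 0 <= cf2 V th.
Proof. by rewrite addr_ge0 ?sqr_ge0. Qed.

(** By [cf2_inner], the squared modulus c is the mean of the inner product of a vector of norm sqrt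
    c with a unit vector, so c <= sqrt c. *)
Lemma cf2_le1 V th : trig_meas V -> cf2 V th <= 1.
Proof.
move=> mV; have := cf2_inner th mV; have [mc ms] := mV th.
set A := cosE V th; set B := sinE V th; set c := cf2 V th => E.
have c0 : 0 <= c by exact: cf2_ge0.
have : c <= Num.sqrt c.
  rewrite -{1}E -[leRHS](Er_cst P); apply: le_Er.
  - by apply: bmfD; exact: bmfZ.
  - exact: bmf_cst.
  move=> w; apply: (le_trans (ler_norm _)).
  by rewrite -sqrtr_sqr ler_wsqrtr// sqr_cos_sin_le.
rewrite -{1}(sqr_sqrtr c0) => h.
have s0 := sqrtr_ge0 c.
have : Num.sqrt c <= 1 by nra.
by move=> s1; rewrite -(sqr_sqrtr c0) expr_le1.
Qed.

Lemma Er_eq0 (f : Omega -> R) : bmf f -> (forall w, 0 <= f w) -> Er P f = 0 ->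
  P [set w | f w = 0] = 1%E.
Proof.
move=> bf f0 Ef.
have intf := bmf_integrable P bf; have [mf _] := bf.
have mEf : measurable_fun setT (EFin \o f) by exact/measurable_EFinP.
have : (\int[P]_(x in setT) `|(EFin \o f) x| = 0)%E.
  under eq_integral => x _ do rewrite /= ger0_norm//.
  move: Ef; rewrite ErE /Rintegral => Ef.
  rewrite -[RHS]/(0%:E) -Ef fineK//; exact: integrable_fin_num.
move=> /(ae_eq_integral_abs P measurableT mEf) [N [mN PN sub]].
have mZ : measurable [set w | f w = 0].
  have := mf measurableT [set 0] (measurable_set1 0).
  by rewrite setTI.
have : P (~` [set w | f w = 0]) = 0%E.
  apply: (@subset_measure0 _ _ _ P _ N) => //; first exact: measurableC.
  move=> w nw; apply: sub => /= h; apply: nw.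
  by have := h I => -[].
rewrite probability_setC// => h.
have Pf : P [set w | f w = 0] \is a fin_num by exact: fin_num_measure.
move: h; rewrite -(fineK Pf) -EFinB => -[/eqP]; rewrite subr_eq0 => /eqP <-.
by [].
Qed.

(** Equality case of the previous bound: the inner product is at most 1 and has mean 1. *)
Lemma cf2_eq1 V th : trig_meas V -> cf2 V th = 1 ->
  P [set w | cosE V th * cos (dot th (V w)) + sinE V th * sin (dot th (V w)) = 1] = 1%E.
Proof.
move=> mV E; have [mc ms] := mV th; have := cf2_inner th mV.
set f := fun w : Omega => _ => Ef.
have bf : bmf f by apply: bmfD; exact: bmfZ.
have bg : bmf (fun w => 1 - f w).
  apply: bmfD; first exact: bmf_cst.
  by under eq_fun do rewrite -mulN1r; exact: bmfZ.
rewrite -(@Er_eq0 (fun w => 1 - f w) bg).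
- congr (P _); apply/seteqP; split=> w /=; first by rewrite /f => ->; rewrite subrr.
  by move/eqP; rewrite subr_eq0 eq_sym => /eqP.
- move=> w; rewrite subr_ge0; apply: (le_trans (ler_norm _)).
  rewrite -(@expr_le1 _ 2)// -normrX ger0_norm ?sqr_ge0//.
  by apply: (le_trans (sqr_cos_sin_le _ _ _)); rewrite -/(cf2 V th) E.
- by rewrite ErB ?Er_cst ?Ef ?E ?subrr//; exact: bmf_cst.
Qed.

(** A translation rotates the pair of means and preserves its norm; this is what removes every
    recentring. *)
Lemma cf2_shift V V' th c : trig_meas V ->
  (forall w, dot th (V' w) = dot th (V w) + c) -> cf2 V' th = cf2 V th.
Proof.
move=> /(_ th) [mc ms] E; rewrite /cf2 /cosE /sinE.
under eq_fun do rewrite E cosD.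
under [X in _ + Er P X ^+ 2]eq_fun do rewrite E sinD.
have -> : Er P (fun w => cos (dot th (V w)) * cos c - sin (dot th (V w)) * sin c) =
   cos c * Er P (fun w => cos (dot th (V w))) - sin c * Er P (fun w => sin (dot th (V w))).
  rewrite -!ErZ// -ErB; try exact: bmfZ.
  by congr Er; apply/funext => w; ring.
have -> : Er P (fun w => sin (dot th (V w)) * cos c + cos (dot th (V w)) * sin c) =
   cos c * Er P (fun w => sin (dot th (V w))) + sin c * Er P (fun w => cos (dot th (V w))).
  rewrite -!ErZ// -ErD; try exact: bmfZ.
  by congr Er; apply/funext => w; ring.
set A := Er _ _; set B := Er _ _.
transitivity ((A ^+ 2 + B ^+ 2) * (cos c ^+ 2 + sin c ^+ 2)); first ring.
by rewrite cos2Dsin2 mulr1.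
Qed.

End charfun.

Section walk_charfun.
Context {R : realType} {d : nat} {dO : measure_display} {Omega : measurableType dO}.
Variable P : probability Omega R.
Variable X : nat -> Omega -> 'rV[int]_d.
Hypothesis hX : iid discrete_sets P X.

Definition realv (z : 'rV[int]_d) : 'rV[R]_d := \row_i (z 0 i)%:~R.

Lemma realvD y z : realv (y + z) = realv y + realv z.
Proof. by apply/rowP => i; rewrite !mxE intrD. Qed.

Lemma trig_meas_walk n (g : 'rV[int]_d -> 'rV[R]_d) : trig_meas (fun w => g (walk X n w)).
Proof.
move=> th; split.
  apply: (discrete_bmf (F := fun z => cos (dot th (g z)))); first exact: walk_rv hX n.
  by exists 1 => z; exact: cos_max.
apply: (discrete_bmf (F := fun z => sin (dot th (g z)))); first exact: walk_rv hX n.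
by exists 1 => z; exact: sin_max.
Qed.

(** The pair ([C], [S]) follows complex multiplication, one factor per step, and the squared modulus
    is multiplicative. *)
Lemma Ex_trig (I : finType) (p : I -> 'rV[int]_d) (w : I -> R) n th :
  let C m := Ex p w m (fun y => cos (dot th (realv y))) in
  let S m := Ex p w m (fun y => sin (dot th (realv y))) in
  C n ^+ 2 + S n ^+ 2 = (C 1%N ^+ 2 + S 1%N ^+ 2) ^+ n.
Proof.
move=> C S.
have r0 : realv 0 = 0 by apply/rowP => i; rewrite !mxE.
elim: n => [|n IH].
  by rewrite /C /S /= r0 dot0 cos0 sin0 expr0; ring.
have C1 : C 1%N = \sum_e w e * cos (dot th (realv (p e))).
  by apply: eq_bigr => e _ /=; rewrite addr0.
have S1 : S 1%N = \sum_e w e * sin (dot th (realv (p e))).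
  by apply: eq_bigr => e _ /=; rewrite addr0.
have -> : C n.+1 = C 1%N * C n - S 1%N * S n.
  rewrite C1 S1 !mulr_suml -sumrB /C /S ExS; apply: eq_bigr => e _.
  under eq_fun do rewrite realvD dotDr cosD -mulNr.
  by rewrite ExD !ExZ; ring.
have -> : S n.+1 = S 1%N * C n + C 1%N * S n.
  rewrite C1 S1 !mulr_suml -big_split /C /S ExS; apply: eq_bigr => e _.
  under eq_fun do rewrite realvD dotDr sinD.
  by rewrite ExD !ExZ /=; ring.
by rewrite [RHS]exprS -IH; ring.
Qed.

Lemma cf2_walk n th :
  cf2 P (fun w => realv (walk X n w)) th = cf2 P (fun w => realv (walk X 1 w)) th ^+ n.
Proof.
pose C M m := Ex (@pt d M) (@boxw _ _ _ _ P X M) m (fun y => cos (dot th (realv y))).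
pose S M m := Ex (@pt d M) (@boxw _ _ _ _ P X M) m (fun y => sin (dot th (realv y))).
have cvC m : C M m @[M --> \oo] --> cosE P (fun w => realv (walk X m w)) th.
  by apply: (Ex_walk_cvg hX); exists 1 => z; exact: cos_max.
have cvS m : S M m @[M --> \oo] --> sinE P (fun w => realv (walk X m w)) th.
  by apply: (Ex_walk_cvg hX); exists 1 => z; exact: sin_max.
have cv m : C M m ^+ 2 + S M m ^+ 2 @[M --> \oo] --> cf2 P (fun w => realv (walk X m w)) th.
  by rewrite /cf2 !expr2; under eq_fun do rewrite !expr2; apply: cvgD; apply: cvgM.
have E : (fun M => C M n ^+ 2 + S M n ^+ 2) = (fun M => (C M 1%N ^+ 2 + S M 1%N ^+ 2) ^+ n).
  by apply/funext => M; exact: Ex_trig.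
apply: (cvg_unique _ (cv n)) => //; rewrite E.
exact: cvg_exprn.
Qed.

Lemma walk1 w : walk X 1 w = X 0%N w.
Proof. by rewrite /walk big_ord1. Qed.

Hypothesis haper : aperiodic (step_support P X).

(** With modulus 1 the phase th . z would be constant modulo 2 pi on the support, which would lie in
    a coset of the subgroup of the y with cos (th . y) = 1. By aperiodicity this subgroup is
    everything; it contains the basis vectors, and |th_j| <= pi leaves only th = 0. *)
Lemma cf2_lt1 (th : 'rV[R]_d) : (forall j, `|th 0 j| <= pi) -> th != 0 ->
  cf2 P (fun w => realv (walk X 1 w)) th < 1.
Proof.
move=> thpi th0.
have tm : trig_meas (fun w => realv (walk X 1 w)) by exact: trig_meas_walk.
rewrite lt_neqAle cf2_le1// andbT; apply/eqP => E.
have := cf2_eq1 tm E; set A := cosE _ _ _; set B := sinE _ _ _ => PE.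
have AB : A ^+ 2 + B ^+ 2 = 1 by [].
have supp z : step_support P X z -> A * cos (dot th (realv z)) + B * sin (dot th (realv z)) = 1.
  rewrite /step_support /= => Pz; apply: contrapT => nz.
  pose D := [set z' : 'rV[int]_d | A * cos (dot th (realv z')) + B * sin (dot th (realv z')) = 1].
  have mD : measurable (X 0%N @^-1` D) by exact: (step_rv hX).
  have PD : P (X 0%N @^-1` D) = 1%E.
    by rewrite -PE; congr (P _); apply/seteqP; split=> w /=; rewrite /D /= walk1.
  have : (P (X 0%N @^-1` [set z]) <= P (~` (X 0%N @^-1` D)))%E.
    apply: le_measure; rewrite ?inE; [exact: (step_rv hX)|exact: measurableC|].
    by move=> w /= ->.
  rewrite probability_setC// PD subee// => h.
  by have := lt_le_trans Pz h; rewrite ltxx.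
apply: haper.
have [v sv] : exists v, forall z, step_support P X z -> cos (dot th (realv z) - dot th (realv v)) = 1.
  have [[v vs]|no] := pselect (exists v, step_support P X v).
    by exists v => z zs; apply: unit_inner2 AB _ _; exact: supp.
  by exists 0 => z zs; exfalso; apply: no; exists z.
have dotB y z : dot th (realv (y - z)) = dot th (realv y) - dot th (realv z).
  by apply/eqP; rewrite eq_sym subr_eq -dotDr -realvD subrK.
have r0 : realv 0 = 0 by apply/rowP => i; rewrite !mxE.
exists [set y | cos (dot th (realv y)) = 1], v; split => /=.
- by rewrite r0 dot0 cos0.
- move=> x y hx hy; rewrite dotB cosB hx hy.
  have s0 t : cos t = 1 -> sin t = 0 :> R.
    by move=> ct; have := cos2Dsin2 t; rewrite ct expr1n => /eqP; rewrite addrC eq_sym -subr_eq subrr eq_sym sqrf_eq0 => /eqP.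
  by rewrite (s0 _ hx) (s0 _ hy); ring.
- move=> /seteqP[_ /(_ _ I)] h; move/eqP: th0; apply; apply/rowP => j; rewrite mxE.
  apply: cos_eq1; first exact: thpi.
  have := h (delta_mx 0 j); rewrite /= /dot (bigD1 j)//= !mxE !eqxx/= mulr1 big1 ?addr0//.
  by move=> k kj; rewrite !mxE (negbTE kj) andbF mulr0.
- by move=> z /sv hz; exists (z - v); rewrite /= ?dotB// addrC subrK.
Qed.

End walk_charfun.

(** * Convergence to the limit law *)

Section wiggle.
Context {R : realType} {d : nat}.

Lemma min_sum_continuous (eta : R) :
  continuous (fun z : 'rV[R]_d => Num.min 2 (eta * \sum_j `|z 0 j|)).
Proof.
apply: (@min_fun_continuous _ _ R (cst 2) (fun z : 'rV[R]_d => eta * \sum_j `|z 0 j|)).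
  exact: cst_continuous.
apply: cont_mul; first exact: cont_cst.
apply: cont_sum => j; apply: (@cont_comp _ _ (fun z : 'rV[R]_d => z 0 j)).
  exact: coord_continuous.
exact: norm_continuous.
Qed.

(** A bounded continuous majorant of the oscillation of cos (th . z) and sin (th . z) when each
    coordinate of [th] moves by at most [eta]. As a test function for convergence in law, it gives
    equicontinuity uniformly in n without an appeal to tightness. *)
Definition wiggle (eta : R) (z : 'rV[R]_d) : R := Num.min 2 (eta * \sum_j `|z 0 j|).

Lemma wiggle_ge0 eta z : 0 <= eta -> 0 <= wiggle eta z.
Proof. by move=> e0; rewrite le_min ler0n mulr_ge0// sumr_ge0. Qed.

Lemma wiggle_norm eta z : 0 <= eta -> `|wiggle eta z| <= 2.
Proof. by move=> e0; rewrite ger0_norm ?wiggle_ge0// ge_min lexx. Qed.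

End wiggle.

Section attraction.
Context {R : realType} {d : nat} {dZ : measure_display} {OmegaZ : measurableType dZ}.
Variables (Q : probability OmegaZ R) (Z : OmegaZ -> 'rV[R]_d).
Hypothesis hZ : forall (f : 'rV[R]_d -> R) (K : R), continuous f -> (forall z, `|f z| <= K) -> bmf (f \o Z).
Context {dO : measure_display} {Omega : measurableType dO}.
Variables (P : probability Omega R) (Y : nat -> Omega -> 'rV[R]_d).
Hypothesis hY : forall n (F : 'rV[R]_d -> R), (exists K : R, forall z, `|F z| <= K) ->
  bmf (F \o Y n).
Hypothesis hcvg : cvg_in_law P Y Q Z.

Lemma wiggle_cvg0 : Er Q (wiggle k.+1%:R^-1 \o Z) @[k --> \oo] --> (0 : R).
Proof.
have b k : bmf (wiggle k.+1%:R^-1 \o Z).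
  apply: (@hZ _ 2); first exact: min_sum_continuous.
  by move=> z; exact: wiggle_norm.
have : (\int[Q]_w (EFin \o (wiggle k.+1%:R^-1 \o Z)) w)%E @[k --> \oo] --> (\int[Q]_w (cst 0%E) w)%E.
  apply: (@dominated_cvg _ _ _ Q setT measurableT _ (cst 0%E) (cst 2%:E)) => //.
  - by move=> n; apply/measurable_EFinP; have [] := b n.
  - move=> w _ /=; apply: cvg_EFin; first by near=> k.
    apply: (@squeeze_cvgr _ _ _ _ (cst 0) (fun k => (\sum_j `|Z w 0 j|) * k.+1%:R^-1)).
    + by near=> k; rewrite /= wiggle_ge0//= mulrC ge_min lexx orbT.
    + exact: cvg_cst.
    + by apply: cvg_scale0; exact: cvg_harmonic.
  - by apply: (bmf_integrable Q (bmf_cst (2 : R))).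
  - by move=> n w _ /=; rewrite lee_fin wiggle_norm.
rewrite integral0 => h.
rewrite (_ : (fun _ => _) = fun k => fine (\int[Q]_w (EFin \o (wiggle k.+1%:R^-1 \o Z)) w)%E); last first.
  by apply/funext => k; rewrite ErE.
exact: (fine_cvg h).
Unshelve. all: by end_near.
Qed.

Lemma trig_meas_cont : trig_meas Z.
Proof.
move=> th; split.
  apply: (@hZ (fun z => cos (dot th z)) 1) => [|z]; last exact: cos_max.
  by apply: cont_comp; [exact: dot_continuous | exact: continuous_cos].
apply: (@hZ (fun z => sin (dot th z)) 1) => [|z]; last exact: sin_max.
by apply: cont_comp; [exact: dot_continuous | exact: continuous_sin].
Qed.

Lemma Er_cvg (f : 'rV[R]_d -> R) (K : R) : continuous f -> (forall z, `|f z| <= K) ->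
  Er P (f \o Y n) @[n --> \oo] --> Er Q (f \o Z).
Proof.
move=> cf fK.
have bf : bmf (f \o Z) by exact: hZ cf fK.
have h : ('E_P[f \o Y n])%E @[n --> \oo] --> ('E_Q[f \o Z])%E.
  apply: hcvg => //; exists K; split; first exact: num_real.
  by move=> x /ltW Kx z _; exact: le_trans (fK z) Kx.
apply: fine_cvg; rewrite /Er fineK//.
by rewrite unlock; apply: integrable_fin_num => //; exact: bmf_integrable.
Qed.

Lemma trig_meas_seq n : trig_meas (Y n).
Proof.
move=> th; split.
  have h := @hY n (fun z => cos (dot th z)); refine (h _).
  by exists 1 => z; exact: cos_max.
have h := @hY n (fun z => sin (dot th z)); refine (h _).
by exists 1 => z; exact: sin_max.
Qed.

Lemma dot_wiggle (h : R -> R) (th th' z : 'rV[R]_d) eta : (forall s t, `|h s - h t| <= `|s - t|) ->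
  (forall s, `|h s| <= 1) -> (forall j, `|th' 0 j - th 0 j| <= eta) ->
  `|h (dot th' z) - h (dot th z)| <= wiggle eta z.
Proof.
move=> hl h1 ee; rewrite le_min; apply/andP; split.
  by apply: (le_trans (ler_normB _ _)); have := h1 (dot th' z); have := h1 (dot th z); lra.
apply: (le_trans (hl _ _)); rewrite /dot -sumrB mulr_sumr.
apply: (le_trans (ler_norm_sum _ _ _)); apply: ler_sum => j _.
by rewrite -mulrBl normrM ler_wpM2r.
Qed.

(** Convergence in law controls the means at [th] and the mean oscillation around it, so one
    neighbourhood of [th] serves all large n. *)
Lemma cf2_near (th : 'rV[R]_d) : cf2 Q Z th < 1 -> exists eta k0, 0 < eta /\
  forall th' : 'rV[R]_d, (forall j, `|th' 0 j - th 0 j| <= eta) ->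
  forall n, (k0 <= n)%N -> cf2 P (Y n) th' <= 1 - (1 - cf2 Q Z th) / 2.
Proof.
move=> lt1; set rho := cf2 Q Z th in lt1 *.
(* The cosine and sine means move by at most [2 * e], their squares by at most [4 * e], and [8 * e]
   is half of the gap. *)
pose e := (1 - rho) / 16.
have e0 : 0 < e by rewrite /e; lra.
have [k _ hk] : \forall k \near \oo, Er Q (wiggle k.+1%:R^-1 \o Z) < e.
  have /cvgr0Pnorm_lt /(_ e e0) := wiggle_cvg0.
  by apply: filterS => k; apply: le_lt_trans; exact: ler_norm.
have {hk} := hk k (leqnn k); set eta := k.+1%:R^-1 => wZ.
have eta0 : 0 < eta by rewrite /eta invr_gt0.
have cw := Er_cvg (@min_sum_continuous R d eta) (fun z => @wiggle_norm R d eta z (ltW eta0)).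
have cc := @Er_cvg (fun z => cos (dot th z)) 1 (cont_comp (@dot_continuous R d th) (@continuous_cos R)) (fun z => cos_max _).
have cs := @Er_cvg (fun z => sin (dot th z)) 1 (cont_comp (@dot_continuous R d th) (@continuous_sin R)) (fun z => sin_max _).
have [k1 _ h1] : \forall n \near \oo, Er P (wiggle eta \o Y n) < e by exact: (cvgr_lt _ cw).
have [k2 _ h2] : \forall n \near \oo, `|cosE Q Z th - cosE P (Y n) th| < e.
  by move/cvgr_dist_lt: cc => /(_ e e0).
have [k3 _ h3] : \forall n \near \oo, `|sinE Q Z th - sinE P (Y n) th| < e.
  by move/cvgr_dist_lt: cs => /(_ e e0).
exists eta, (maxn k1 (maxn k2 k3)); split=> // th' hth' n.
rewrite !geq_max => /andP[n1 /andP[n2 n3]].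
have {}h1 := h1 n n1; have {}h2 := h2 n n2; have {}h3 := h3 n n3.
have bw : bmf (wiggle eta \o Y n).
  by apply: hY; exists 2 => z; apply: wiggle_norm; exact: ltW.
have [mc ms] := @trig_meas_seq n th; have [mc' ms'] := @trig_meas_seq n th'.
have aux (f f' : Omega -> R) : bmf f -> bmf f' -> (forall w, `|f' w - f w| <= wiggle eta (Y n w)) ->
  `|Er P f' - Er P f| <= e.
  move=> bf bf' ff'; rewrite -ErB//.
  have bB : bmf (fun w => f' w - f w).
    by apply: bmfD => //; under eq_fun do rewrite -mulN1r; exact: bmfZ.
  apply: (le_trans (Er_norm P bB)); apply: le_trans (ltW h1).
  by apply: le_Er => //; exact: bmf_norm.
have d1 : `|cosE P (Y n) th' - cosE P (Y n) th| <= e.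
  apply: aux => // w; apply: (@dot_wiggle cos) => // [s t|s]; [exact: cos_lip|exact: cos_max].
have d2 : `|sinE P (Y n) th' - sinE P (Y n) th| <= e.
  apply: aux => // w; apply: (@dot_wiggle sin) => // [s t|s]; [exact: sin_lip|exact: sin_max].
have cle (dd : measure_display) (W : measurableType dd) (p : probability W R) (V : W -> 'rV[R]_d) t :
  trig_meas V -> `|cosE p V t| <= 1 /\ `|sinE p V t| <= 1.
  move=> mV; have := @cf2_le1 R d dd W p V t mV; rewrite /cf2 => h.
  have := sqr_ge0 (cosE p V t); have := sqr_ge0 (sinE p V t) => h4 h5.
  by split; rewrite -(@expr_le1 _ 2)// -normrX ger0_norm ?sqr_ge0//; lra.
have [a1 a2] := cle _ _ P (Y n) th' (@trig_meas_seq n).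
have [a3 a4] := cle _ _ Q Z th trig_meas_cont.
rewrite /cf2 /rho /cf2 in e0 lt1 * .
rewrite /e /rho /cf2 in d1 d2 h2 h3 e0 |- *.
move: d1 d2 h2 h3 a1 a2 a3 a4.
set A' := cosE P (Y n) th'; set B' := sinE P (Y n) th'; set A := cosE P (Y n) th; set B := sinE P (Y n) th.
set A0 := cosE Q Z th in lt1 e0 *; set B0 := sinE Q Z th in lt1 e0 *.
set E := (1 - _) / 16 => d1 d2 h2 h3 a1 a2 a3 a4.
have e1 : `|A' - A0| <= 2 * E.
  rewrite -(subrKA A) (le_trans (ler_normD _ _))// (distrC A); lra.
have e2 : `|B' - B0| <= 2 * E.
  rewrite -(subrKA B) (le_trans (ler_normD _ _))// (distrC B); lra.
have f1 : A' ^+ 2 - A0 ^+ 2 <= 4 * E.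
  rewrite subr_sqr (le_trans (ler_norm _))// normrM.
  have : `|A' + A0| <= 2 by apply: (le_trans (ler_normD _ _)); lra.
  by have := normr_ge0 (A' - A0); have := normr_ge0 (A' + A0); nra.
have f2 : B' ^+ 2 - B0 ^+ 2 <= 4 * E.
  rewrite subr_sqr (le_trans (ler_norm _))// normrM.
  have : `|B' + B0| <= 2 by apply: (le_trans (ler_normD _ _)); lra.
  by have := normr_ge0 (B' - B0); have := normr_ge0 (B' + B0); nra.
by move: f1 f2; rewrite /E; lra.
Qed.

(** Compactness of the cube of frequencies, in the form of near coverings; around the frequency 0
    the lower bound [r1] leaves nothing to check. *)
Lemma annulus (r1 r2 : R) : 0 < r1 ->
  (forall th : 'rV[R]_d, (forall j, `|th 0 j| <= r2) -> th != 0 -> cf2 Q Z th < 1) ->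
  exists (rho : R) (n0 : nat), [/\ 0 < rho, rho < 1 &
  forall n (th : 'rV[R]_d), (n0 <= n)%N -> (forall j, `|th 0 j| <= r2) ->
   (exists j, r1 <= `|th 0 j|) -> cf2 P (Y n) th <= rho].
Proof.
move=> r10 hlt1.
pose K := [set v : 'rV[R]_d | forall i, `[- r2, r2]%classic (v ord0 i)].
have cK : compact K by apply: (@rV_compact R d (fun=> `[- r2, r2]%classic)) => i; exact: segment_compact.
(* A single index encodes both the threshold in time and the gap below 1, as the covering property
   has one parameter only. *)
pose Pr (k : nat) (th : 'rV[R]_d) := forall n, (k <= n)%N -> (exists j, r1 <= `|th 0 j|) ->
  cf2 P (Y n) th <= 1 - k.+2%:R^-1.
have [k0 _ hk0] : \forall k \near \oo, K `<=` Pr k.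
  apply: (compact_near_coveringP K).1 => // th thK.
  have [->|th0] := eqVneq th 0.
    exists ([set v : 'rV[R]_d | forall j, `|v 0 j| < r1], setT) => /=.
      split; last exact: filterT.
      exists (fun (i : 'I_1) (j : 'I_d) => ball ((0 : 'rV[R]_d) i j) r1) => [i j|v bv j].
        exact: nbhsx_ballx.
      by have := bv 0 j; rewrite -ball_normE /= mxE sub0r normrN.
    move=> [v k] /= [hv _] n _ [j]; rewrite leNgt; by rewrite (hv j).
  have lt1 : cf2 Q Z th < 1.
    by apply: hlt1 => // j; rewrite ler_norml; have := thK j; rewrite /= in_itv.
  have [eta [k1 [eta0 h1]]] := cf2_near lt1.
  exists ([set v : 'rV[R]_d | forall j, `|v 0 j - th 0 j| <= eta],
    [set k | (k1 <= k)%N /\ k.+2%:R^-1 <= (1 - cf2 Q Z th) / 2]) => /=.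
    split.
      exists (fun (i : 'I_1) (j : 'I_d) => ball (th i j) eta) => [i j|v bv j].
        exact: nbhsx_ballx.
      by have := bv 0 j; rewrite -ball_normE /= distrC => /ltW.
    apply: filterI; first exact: nbhs_infty_ge.
    exists (Num.bound ((1 - cf2 Q Z th) / 2)^-1) => // k /= kb.
    have g0 : 0 < (1 - cf2 Q Z th) / 2 by lra.
    rewrite invf_ple ?posrE ?ltr0n//.
    apply: (le_trans (ltW (archi_boundP _))); first by rewrite invr_ge0 ltW.
    by rewrite ler_nat (leq_trans kb)// -addn2 leq_addr.
  move=> [v k] /= [hv [k1k kg]] n kn _.
  by apply: (le_trans (h1 v hv n (leq_trans k1k kn))); rewrite lerD2l lerN2; exact: kg.
exists (1 - k0.+2%:R^-1), k0; split.
- by rewrite subr_gt0 invf_lt1 ?ltr0n// ltr1n.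
- by rewrite ltrBlDr ltrDl invr_gt0.
move=> n th kn hth; apply: (hk0 k0) => //= i.
by rewrite /= in_itv /= -ler_norml.
Qed.

End attraction.

(** * Characteristic function of a law with a density *)

Section density.
Context {R : realType}.

(** All solutions have the same phase modulo 2 pi; two of them with the same integer part of [b * t]
    have phases less than 1 apart, hence coincide. *)
Lemma trig_level_countable (A B a b : R) : A ^+ 2 + B ^+ 2 = 1 -> b != 0 ->
  countable [set t : R | A * cos (a + b * t) + B * sin (a + b * t) = 1].
Proof.
move=> AB b0; apply/countable_injP.
exists (fun t => pickle (Num.floor (b * t))) => s t.
rewrite !inE /= => hs ht /(pcan_inj pickleK) E.
have c1 := unit_inner2 AB hs ht.
have E' : a + b * s - (a + b * t) = b * (s - t) by ring.
rewrite E' in c1.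
have : b * (s - t) = 0.
  apply: cos_eq1 => //; apply: (@le_trans _ _ 1); last first.
    by have := @pi_ge2 R; lra.
  have h1 := floor_le_tmp (b * s); have h2 := floor_le_tmp (b * t).
  have h3 := @floorD1_gt R (b * s); have h4 := @floorD1_gt R (b * t).
  rewrite E in h1 h3; rewrite intrD in h3 h4.
  by rewrite ler_norml mulrBr; lra.
by move=> /eqP; rewrite mulf_eq0 (negbTE b0)/= subr_eq0 => /eqP.
Qed.

Lemma integral_countable0 (T : set R) (f : R -> \bar R) : countable T ->
  (forall t, ~ T t -> f t = 0%E) -> (\int[@lebesgue_measure R]_t f t = 0)%E.
Proof.
move=> cT f0.
have mS (S : set R) : S `<=` T -> measurable (S : set (measurableTypeR R)).
  by move=> ST; apply: countable_measurable => //; exact: sub_countable (subset_card_le ST) cT.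
have mf : measurable_fun [set: measurableTypeR R] f.
  move=> _ Y mY; rewrite setTI.
  have [Y0|nY0] := pselect (Y 0%E).
    rewrite -[X in measurable X]setCK; apply: measurableC; apply: mS => t nt.
    by apply: contrapT => /f0 ft; apply: nt; rewrite /= ft.
  by apply: mS => t /= Yt; apply: contrapT => /f0 ft; apply: nY0; rewrite -ft.
have T0 : @lebesgue_measure R T = 0%E by exact: countable_lebesgue_measure0.
have : ae_eq (@lebesgue_measure R) (setT : set (measurableTypeR R)) f (cst 0%E).
  exists T; split => //; first exact: mS.
  by move=> t /=; apply: contra_notP => nT _; exact: f0.
move=> /ae_eq_integral -> //; first exact: integral0.
Qed.

Lemma iterated_integral0 n (f : 'rV[R]_n -> \bar R) : (forall z, f z = 0%E) ->
  iterated_integral f = 0%E.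
Proof.
elim: n f => [|n IH] f f0 /=; first exact: f0.
by apply: integral0_eq => t _; apply: IH => v; exact: f0.
Qed.

(** The level set is a union of parallel hyperplanes. If the frequency has a non-zero coordinate
    besides the first, every section has integral 0 by induction; otherwise the first coordinate is
    confined to a countable set. *)
Lemma iterated_integral_level n (th : 'rV[R]_n) (A B c : R) (f : 'rV[R]_n -> \bar R) :
  A ^+ 2 + B ^+ 2 = 1 -> th != 0 ->
  (forall z, A * cos (c + dot th z) + B * sin (c + dot th z) <> 1 -> f z = 0%E) ->
  iterated_integral f = 0%E.
Proof.
move=> AB; elim: n th c f => [|n IH] th c f.
  by move=> /eqP th0; exfalso; apply: th0; apply/rowP => -[].
move: th => th; rewrite -(@hsubmxK _ 1 1 n th); set t1 := lsubmx _; set th' := rsubmx _ => th0 f0.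
have dotE (t : R) (v : 'rV[R]_n) : dot (row_mx t1 th') (row_mx (t%:M : 'rV[R]_1) v) =
    t1 0 0 * t + dot th' v.
  rewrite /dot (@big_split_ord _ _ _ 1 n) /= big_ord1 !row_mxEl; congr (_ + _).
    by rewrite [X in _ * X]mxE eqxx mulr1n.
  by apply: eq_bigr => j _; rewrite !row_mxEr.
rewrite /=; have [th'0|th'0] := eqVneq th' 0; last first.
  apply: integral0_eq => t _; apply: (IH th' (c + t1 0 0 * t)) => // v.
  by rewrite -addrA -dotE; exact: f0.
have t10 : t1 0 0 != 0.
  apply: contraNneq th0 => t10; rewrite th'0; apply/eqP/rowP => j.
  rewrite !mxE; case: splitP => k _; last by rewrite mxE.
  by rewrite ord1 t10.
apply: (@integral_countable0 [set t | A * cos (c + t1 0 0 * t) + B * sin (c + t1 0 0 * t) = 1]).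
  exact: trig_level_countable.
move=> t nt; apply: iterated_integral0 => v; apply: f0; rewrite dotE th'0.
rewrite (_ : dot 0 v = 0) ?addr0//.
by rewrite /dot big1// => j _; rewrite mxE mul0r.
Qed.

Context {d : nat} {dZ : measure_display} {OmegaZ : measurableType dZ}.
Variables (Q : probability OmegaZ R) (Z : OmegaZ -> 'rV[R]_d) (g : 'rV[R]_d -> R).
Hypothesis hZ : random_element borel_sets Z.
Hypothesis hg : has_density Q Z g.

Lemma open_borel (U : set 'rV[R]_d) : open U -> borel_sets U.
Proof. by move=> oU; apply: sub_sigma_algebra. Qed.

Lemma continuous_bmf (f : 'rV[R]_d -> R) (K : R) : continuous f -> (forall z, `|f z| <= K) ->
  bmf (f \o Z).
Proof.
move=> cf fK; split; last by exists K => w; exact: fK.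
apply: (measurability _ (RGenOInfty.measurableE R)) => _ [_ [x ->] <-].
rewrite setTI comp_preimage; apply: hZ; apply: open_borel.
by move/continuousP: cf; apply; rewrite set_itvE; exact: open_gt.
Qed.

(** A modulus equal to 1 would put all the mass of [Z] on a Lebesgue-null union of hyperplanes. *)
Lemma cf2_density_lt1 th : th != 0 -> cf2 Q Z th < 1.
Proof.
move=> th0; have tm := trig_meas_cont (@continuous_bmf).
rewrite lt_neqAle cf2_le1 ?andbT//.
apply/eqP => E; have := cf2_eq1 tm E.
set A := cosE _ _ _; set B := sinE _ _ _ => PE.
pose D := [set z : 'rV[R]_d | A * cos (dot th z) + B * sin (dot th z) = 1].
have bD : borel_sets D.
  pose f (z : 'rV[R]_d) := A * cos (dot th z) + B * sin (dot th z).
  have cf : continuous f.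
    apply: cont_add; apply: cont_mul; try exact: cont_cst.
      by apply: cont_comp; [exact: dot_continuous | exact: continuous_cos].
    by apply: cont_comp; [exact: dot_continuous | exact: continuous_sin].
  have -> : D = setT `\` (~` D) by rewrite setTD setCK.
  apply: sigma_algebraCD; apply: open_borel; apply: closed_openC.
  have -> : D = f @^-1` [set 1] by [].
  by apply: preimage_closed => //; exact: closed1.
have [g0 _ hd] := hg; have := hd D bD.
rewrite (iterated_integral_level (c := 0) (A := A) (B := B) (th := th))//.
  by move=> h; move: PE; rewrite [X in X = _]h => -[] /eqP; rewrite eq_sym oner_eq0.
move=> z nz; rewrite indicE memNset ?mulr0// => hz; apply: nz.
by rewrite add0r.
Qed.

End density.

Lemma periodicz (R : realType) (f : R -> R) (T : R) : periodic f T ->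
  forall (c : R) (m : int), f (c + m%:~R * T) = f c.
Proof.
move=> pf c [m|m]; first by rewrite -pmulrn mulr_natl (periodicn pf).
rewrite NegzE -(periodicn pf m.+1) -mulr_natl mulrNz mulNr -pmulrn.
by rewrite subrK.
Qed.

(** * Divergence of the scaling sequences *)

Section scaling_diverges.
Context {R : realType} {d : nat} {dZ : measure_display} {OmegaZ : measurableType dZ}.
Variables (Q : probability OmegaZ R) (Z : OmegaZ -> 'rV[R]_d) (g : 'rV[R]_d -> R).
Hypothesis hZ : random_element borel_sets Z.
Hypothesis hg : has_density Q Z g.
Context {dO : measure_display} {Omega : measurableType dO}.
Variables (P : probability Omega R) (X : nat -> Omega -> 'rV[int]_d).
Hypothesis hX : iid discrete_sets P X.
Variables (a b : nat -> 'I_d -> R).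
Hypothesis a_gt0 : forall n i, (0 < n)%N -> 0 < a n i.
Hypothesis hcvg : cvg_in_law P (normalized_walk X a b) Q Z.

Lemma normalized_walk_bmf n (F : 'rV[R]_d -> R) : (exists K : R, forall z, `|F z| <= K) ->
  bmf (F \o normalized_walk X a b n).
Proof.
move=> [K hK].
apply: (@discrete_bmf _ _ _ _ (walk X n) (fun z => F (\row_i (((z 0 i)%:~R - b n i) / a n i)))).
  exact: walk_rv hX n.
by exists K => z; exact: hK.
Qed.

Lemma cf2_normalized n (th : 'rV[R]_d) : 
  cf2 P (normalized_walk X a b n) th =
  cf2 P (fun w => realv (walk X 1 w)) (\row_i (th 0 i / a n i)) ^+ n.
Proof.
rewrite -(cf2_walk hX) {2}/cf2 /cosE /sinE.
have E w : dot (\row_i (th 0 i / a n i)) (realv (walk X n w)) =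
   dot th (\row_i ((walk X n w 0 i)%:~R / a n i)).
  by rewrite /dot; apply: eq_bigr => j _; rewrite !mxE; ring.
under eq_fun do rewrite E.
under [X in _ = _ + Er P X ^+ 2]eq_fun do rewrite E.
apply: (@cf2_shift _ _ _ _ P (fun w => \row_i ((walk X n w 0 i)%:~R / a n i)) _ _
   (dot th (\row_i (- (b n i / a n i))))).
  exact: (@trig_meas_walk _ _ _ _ _ _ hX n (fun z => \row_i ((z 0 i)%:~R / a n i))).
move=> w; rewrite -dotDr; congr (dot _ _); apply/rowP => j; rewrite !mxE; ring.
Qed.

(* The [i]-th coordinate of the normalized walk lives on a lattice of mesh
   [1 / a n i], which would stay bounded away from 0. *)
Lemma scaling_cvgy i : (fun n => a n i) @ \oo --> +oo.
Proof.
apply/cvgryPgt => A; apply: contrapT => nA.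
have [A' [A'0 AA']] : exists A', 0 < A' /\ A <= A'.
  by exists (`|A| + 1); split; have := ler_norm A; have := normr_ge0 A; lra.
have pi0 : 0 < pi :> R by exact: pi_gt0.
have [||rho [n1 [_ rho1 hrho]]] := @annulus _ _ _ _ Q Z (continuous_bmf hZ) _ _ P _ normalized_walk_bmf hcvg (2 * pi * A') (4 * pi * A').
- by rewrite !mulr_gt0.
- by move=> th _; exact: cf2_density_lt1 hZ hg th.
have [n [n1n n0' nle]] : exists n, [/\ (n1 <= n)%N, (0 < n)%N & a n i <= A].
  apply: contrapT => no; apply: nA; exists (maxn n1 1) => // n /=.
  rewrite geq_max => /andP[h1 h2]; rewrite ltNge; apply/negP => h3.
  by apply: no; exists n.
have an0 := a_gt0 i n0'.
(* [k] places [k * a n i] between [A'] and [2 * A']. The frequency 2 pi k a_n is dual to the lattice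
   of the normalized walk, so the modulus there is 1, but it lies in the annulus where the modulus
   is at most [rho]. *)
pose k := (Num.truncn (A' / a n i)).+1.
have k1 : A' <= k%:R * a n i.
  by rewrite -ler_pdivrMr// ltW// truncnS_gt.
have k2 : k%:R * a n i <= 2 * A'.
  rewrite /k -natr1 mulrDl mul1r.
  have : (Num.truncn (A' / a n i))%:R * a n i <= A'.
    by rewrite -ler_pdivlMr// truncn_le// divr_ge0// ltW.
  by lra.
pose th : 'rV[R]_d := \row_j (if j == i then 2 * pi * (k%:R * a n i) else 0).
have := hrho n th n1n.
have -> : cf2 P (normalized_walk X a b n) th = 1.
  rewrite /cf2 /cosE /sinE.
  have E w : dot th (normalized_walk X a b n w) =
     2 * pi * (k%:R * (- b n i)) + (k%:Z * walk X n w 0 i)%:~R * (pi *+ 2).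
    rewrite /dot (bigD1 i)//= big1 ?addr0; last first.
      by move=> j ji; rewrite !mxE (negbTE ji) mul0r.
    rewrite !mxE eqxx intrM -pmulrn -mulr_natr.
    by field; exact: lt0r_neq0.
  under eq_fun do rewrite E (periodicz (@cosD2pi R)).
  under [X in _ + Er P X ^+ 2]eq_fun do rewrite E (periodicz (@sinD2pi R)).
  by rewrite !Er_cst cos2Dsin2.
have n3 : 0 <= 2 * pi * (k%:R * a n i) by rewrite !mulr_ge0// ltW.
move=> H; have : (1 : R) <= rho.
  apply: H.
    move=> j; rewrite mxE; case: eqP => _; last by rewrite normr0 !mulr_ge0// ltW.
    rewrite ger0_norm//.
    have -> : 4 * pi * A' = 2 * pi * (2 * A') by ring.
    by rewrite ler_pM2l// mulr_gt0.
  by exists i; rewrite mxE eqxx ger0_norm// ler_pM2l// mulr_gt0.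
by rewrite leNgt rho1.
Qed.

End scaling_diverges.

(** * Local limit bound *)

Lemma sum_symm_le (R : realType) (g : nat -> R) M : (forall v, 0 <= g v) ->
  \sum_(k < M.*2.+1) g `|(k : nat)%:Z - M%:Z|%N <= 2 * \sum_(0 <= v < M.+1) g v.
Proof.
move=> g0; rewrite -(big_mkord xpredT (fun k => g `|k%:Z - M%:Z|%N)).
rewrite (big_cat_nat (n := M)) //=; last by rewrite -addnn; lia.
rewrite mulr_natl mulr2n lerD//.
  rewrite big_nat_rev /= add0n [leRHS]big_nat_recl//= -[leLHS]add0r lerD//.
  rewrite le_eqVlt; apply/orP; left; apply/eqP; apply: eq_big_nat => k /andP[_ kM].
  by congr g; lia.
rewrite -{1}[M]add0n big_addn -addnn.
have -> : ((M + M).+1 - M = M.+1)%N by lia.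
rewrite le_eqVlt; apply/orP; left; apply/eqP; apply: eq_bigr => k _.
by congr g; lia.
Qed.

(** Telescoping: for v >= 1 each term is at most the last decrement of 1 / (e (1 + v e)). *)
Lemma sum_inv_sqr_le (R : realType) (e : R) M : 0 < e ->
  \sum_(0 <= v < M.+1) (1 + v%:R * e) ^- 2 <= 1 + e^-1.
Proof.
move=> e0.
suff H : \sum_(0 <= v < M.+1) (1 + v%:R * e) ^- 2 <= 1 + e^-1 - (e * (1 + M%:R * e))^-1.
  apply: (le_trans H); rewrite lerBlDr lerDl invr_ge0 mulr_ge0// ?(ltW e0)//.
  by rewrite addr_ge0// mulr_ge0// ltW.
elim: M => [|M IH]; first by rewrite big_nat1 mul0r addr0 mulr1 expr1n invr1 addrK.
rewrite big_nat_recr//=; apply: (le_trans (lerD IH (lexx _))).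
set u := M%:R * e; have u0 : 0 <= u by rewrite mulr_ge0// ltW.
have -> : 1 + M.+1%:R * e = 1 + u + e by rewrite -natr1 /u; ring.
rewrite -addrA lerD2l -subr_ge0.
have -> : - (e * (1 + u + e))^-1 - (- (e * (1 + u))^-1 + (1 + u + e) ^- 2) =
   e / ((1 + u) * (1 + u + e) ^+ 2).
  by field; do ?[apply/andP; split]; apply: lt0r_neq0; lra.
by rewrite divr_ge0 ?mulr_ge0 ?sqr_ge0//; lra.
Qed.

(** * A discrete Fourier kernel *)

Section kernel.
Context {R : realType}.
Local Open Scope complex_scope.

Definition cis (x : R) : R[i] := cos x +i* sin x.

Lemma cisD x y : cis (x + y) = cis x * cis y.
Proof. by apply/eqP; rewrite eq_complex /= cosD sinD addrC eqxx /= addrC eqxx. Qed.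

Lemma cis0 : cis 0 = 1.
Proof. by rewrite /cis cos0 sin0. Qed.

Lemma cis_sum (I : Type) (s : seq I) (F : I -> R) : cis (\sum_(i <- s) F i) = \prod_(i <- s) cis (F i).
Proof. exact: (big_morph _ cisD cis0). Qed.

Lemma cisMn x n : cis (x *+ n) = cis x ^+ n.
Proof. by elim: n => [|n IH]; rewrite ?mulr0n ?cis0 // mulrS cisD IH exprS. Qed.

Lemma cis_norm x : cis x * cis (- x) = 1.
Proof. by rewrite -cisD subrr cis0. Qed.

Lemma Re_sum (I : Type) (s : seq I) (F : I -> R[i]) : complex.Re (\sum_(i <- s) F i) = \sum_(i <- s) complex.Re (F i).
Proof. by apply: (big_morph (@complex.Re R)) => // -[a b] [c e]. Qed.

(** A geometric sum whose ratio is a root of unity of order dividing [2 * M + 1]. *)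
Lemma cis_box_sum M (t : int) :
  \sum_(k < M.*2.+1) cis (2 * pi * ((k : nat)%:Z - M%:Z)%:~R / (M.*2.+1)%:R * t%:~R) =
  (if cis (2 * pi / (M.*2.+1)%:R * t%:~R) == 1 then (M.*2.+1)%:R else 0) :> R[i].
Proof.
set s := 2 * pi / (M.*2.+1)%:R * t%:~R.
have E (k : nat) : cis (2 * pi * (k%:Z - M%:Z)%:~R / (M.*2.+1)%:R * t%:~R) = cis (- (s *+ M)) * cis s ^+ k.
  rewrite -cisMn -cisD; congr cis; rewrite /s intrB -!pmulrn -(mulr_natl _ M) -(mulr_natl _ k) ?mulr1.
  rewrite -[2 * pi / _ * _ *+ k]mulr_natl.
  by move: (M.*2.+1%:R^-1) (t%:~R) (M%:R) (k%:R) => u v y z; ring.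
under eq_bigr do rewrite E.
rewrite -mulr_sumr; case: eqP => s1.
  rewrite (eq_bigr (fun=> 1)); last by move=> k _; rewrite s1 expr1n.
  rewrite sumr_const card_ord.
  have -> : cis (- (s *+ M)) = 1.
    by have := cis_norm (s *+ M); rewrite cisMn s1 expr1n mul1r.
  by rewrite mul1r.
have : (cis s - 1) * \sum_(k < M.*2.+1) cis s ^+ k = 0.
  rewrite -subrX1 -cisMn.
  have -> : s *+ M.*2.+1 = 0 + t%:~R * (pi *+ 2).
    rewrite /s -mulr_natl -[pi *+ 2]mulr_natl; field.
    by rewrite nat1r pnatr_eq0.
  by rewrite /cis (periodicz (@cosD2pi R)) (periodicz (@sinD2pi R)) -/(cis 0) cis0 subrr.
move/eqP; rewrite mulf_eq0 subr_eq0 => /orP[/eqP//|/eqP ->].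
by rewrite mulr0.
Qed.

Context {d : nat}.

Definition agree (A : {set 'I_d}) (y v : 'rV[int]_d) : bool :=
  [forall j in A, y 0 j == v 0 j].

(** The coordinates outside [A] get the frequency 0, so that averaging over the whole cube tests the
    coordinates in [A] only. *)
Definition freq M (A : {set 'I_d}) (f : box d M) : 'rV[R]_d :=
  \row_j (if j \in A then 2 * pi * (pt f 0 j)%:~R / (M.*2.+1)%:R else 0).

Lemma freq_le_pi M A (f : box d M) j : `|freq A f 0 j| <= pi.
Proof.
rewrite mxE; case: ifP => _; last by rewrite normr0 pi_ge0.
rewrite normrM normfV [`|_%:R|]ger0_norm// ler_pdivrMr ?ltr0n//.
rewrite normrM ger0_norm ?mulr_ge0 ?pi_ge0//.
rewrite [2 * pi]mulrC -mulrA ler_wpM2l ?pi_ge0//.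
have /forallP/(_ j) h := inbox_pt f.
rewrite -intr_norm -[`|_|]abszE -pmulrn -natrM ler_nat.
by apply: (leq_trans (leq_mul (leqnn 2) h)); rewrite mul2n.
Qed.

(** The average over frequencies factorizes over coordinates into the indicator that [2 * M + 1]
    divides every t_j with j in [A], which majorizes the indicator that these t_j vanish. This
    replaces Fourier inversion by a finite sum. *)
Lemma agree_le_kernel M A (t : 'rV[int]_d) :
  (agree A t 0)%:R <= (M.*2.+1)%:R ^- d * \sum_(f : box d M) cos (dot (freq A f) (realv t)) :> R.
Proof.
pose x (j : 'I_d) (k : 'I_(M.*2.+1)) : R :=
  (if j \in A then 2 * pi * ((k : nat)%:Z - M%:Z)%:~R / (M.*2.+1)%:R else 0) * (t 0 j)%:~R.
have E1 (f : box d M) : cos (dot (freq A f) (realv t)) = complex.Re (\prod_j cis (x j (f j))).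
  rewrite -cis_sum /=; congr cos; apply: eq_bigr => j _.
  by rewrite /x !mxE.
under eq_bigr do rewrite E1.
rewrite -Re_sum -(bigA_distr_bigA (fun j k => cis (x j k))).
pose c j : R := if (j \in A) && (cis (2 * pi / (M.*2.+1)%:R * (t 0 j)%:~R) != 1) then 0 else (M.*2.+1)%:R.
have E2 j : \sum_k cis (x j k) = (c j)%:C.
  rewrite /c /x; have [jA|jA] := boolP (j \in A) => /=.
    by rewrite cis_box_sum; case: eqP => _ /=; rewrite ?rmorph_nat ?rmorph0.
  under eq_bigr do rewrite mul0r cis0.
  by rewrite sumr_const card_ord rmorph_nat.
under eq_bigr do rewrite E2.
rewrite -rmorph_prod /=.
have c0 j : 0 <= c j by rewrite /c; case: ifP.
have [/forallP ag|_] := boolP (agree A t 0); last first.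
  by rewrite mulr_ge0 ?prodr_ge0// invr_ge0 exprn_ge0.
rewrite (eq_bigr (fun=> (M.*2.+1)%:R)).
  by rewrite prodr_const card_ord mulVf// expf_neq0// pnatr_eq0.
move=> j _; rewrite /c; have := ag j; rewrite implybE.
by case: (j \in A) => //= /eqP ->; rewrite mxE mulr0 cis0 eqxx.
Qed.

End kernel.

(** Induction on [N]: writing rho = s^2, one factor s^t absorbs one power of t. *)
Lemma geometric_poly (R : realType) (rho : R) (N : nat) : 0 < rho -> rho < 1 ->
  exists C, 0 < C /\ forall t : nat, rho ^+ t * t%:R ^+ N <= C.
Proof.
move=> rho0 rho1.
have [C [C0 hC]] : exists C, 0 < C /\ forall t : nat, rho ^+ t * t.+1%:R ^+ N <= C.
  elim: N rho rho0 rho1 => [|N IH] rho rho0 rho1.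
    by exists 1; split=> // t; rewrite mulr1 exprn_ile1// ltW.
  pose s := Num.sqrt rho.
  have s0 : 0 < s by rewrite sqrtr_gt0.
  have ss : s * s = rho by rewrite -expr2 sqr_sqrtr// ltW.
  have s1 : s < 1 by nra.
  have [C [C0 hC]] := IH s s0 s1.
  have h t : s ^+ t * t.+1%:R <= (1 - s)^-1.
    rewrite -[leRHS]mul1r ler_pdivlMr ?subr_gt0//.
    have : s ^+ t * t.+1%:R * (1 - s) <= 1 - s ^+ t.+1.
      have -> : 1 - s ^+ t.+1 = (\sum_(i < t.+1) s ^+ i) * (1 - s).
        by rewrite -opprB subrX1 -mulNr opprB mulrC.
      rewrite ler_pM2r ?subr_gt0// -[X in _ * X%:R]card_ord -sumr_const mulr_sumr.
      apply: ler_sum => i _; rewrite mulr1 ler_wiXn2l ?ltW//.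
      by rewrite -ltnS.
    by have := exprn_ge0 t.+1 (ltW s0); lra.
  exists (C * (1 - s)^-1); split; first by rewrite mulr_gt0// invr_gt0 subr_gt0.
  move=> t; rewrite -ss exprMn exprSr mulrACA; apply: ler_pM => //.
  - by rewrite mulr_ge0// ?exprn_ge0// ltW.
  - by rewrite mulr_ge0// ?exprn_ge0// ltW.
exists C; split=> // t; apply: le_trans (hC t).
rewrite ler_wpM2l ?(exprn_ge0 _ (ltW rho0))//.
by apply: lerXn2r; rewrite ?nnegrE// ler_nat.
Qed.

(** * From the characteristic function to a uniform local bound *)

Section llt.
Context {R : realType} {d : nat} {dO : measure_display} {Omega : measurableType dO}.
Variables (P : probability Omega R) (X : nat -> Omega -> 'rV[int]_d).
Hypothesis hX : iid discrete_sets P X.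

Let psi (th : 'rV[R]_d) : R := cf2 P (fun w => realv (walk X 1 w)) th.

Lemma agree_shift (A : {set 'I_d}) (y v : 'rV[int]_d) : agree A y v = agree A (y - v) 0.
Proof.
by apply: eq_forallb => j; rewrite !mxE subr_eq0.
Qed.

Lemma discrete_bool_bmf n (B : pred 'rV[int]_d) : bmf (fun w => (B (walk X n w))%:R : R).
Proof.
apply: (@discrete_bmf _ _ _ _ (walk X n) (fun z => (B z)%:R)); first exact: walk_rv hX n.
by exists 1 => z; case: (B z); rewrite ?normr1 ?normr0.
Qed.

(** [M] is here the size of a cube of frequencies, unrelated to the cube of the steps; the square
    root appears because [psi] is a squared modulus. *)
Lemma Er_agree_le M (A : {set 'I_d}) m y :
  Er P (fun w => (agree A (walk X m w) y)%:R) <=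
  (M.*2.+1)%:R ^- d * \sum_(f : box d M) Num.sqrt (psi (freq A f) ^+ m).
Proof.
have bc (f : box d M) : bmf (fun w => cos (dot (freq A f) (realv (walk X m w - y))) : R).
  by have [] := trig_meas_walk hX m (fun z => realv (z - y)) (freq A f).
apply: (@le_trans _ _ (Er P (fun w => (M.*2.+1)%:R ^- d * \sum_(f : box d M) cos (dot (freq A f) (realv (walk X m w - y)))))).
  apply: le_Er; first exact: (discrete_bool_bmf m (fun z => agree A z y)).
    by apply: bmfZ; exact: bmf_sum.
  by move=> w; rewrite agree_shift; exact: agree_le_kernel.
rewrite ErZ; last exact: bmf_sum.
rewrite ler_wpM2l ?invr_ge0 ?exprn_ge0// Er_sum//.
apply: ler_sum => f _; apply: (le_trans (ler_norm _)).
rewrite -sqrtr_sqr ler_wsqrtr// /psi -(cf2_walk hX).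
rewrite -(@cf2_shift _ _ _ _ P (fun w => realv (walk X m w)) (fun w => realv (walk X m w - y)) _ (dot (freq A f) (realv (- y)))).
- by rewrite lerDl sqr_ge0.
- exact: trig_meas_walk hX m _.
- by move=> w; rewrite realvD dotDr.
Qed.

Variable a : nat -> 'I_d -> R.
Hypothesis a1 : forall n i, 1 <= a n i.
Variables (Cg : R) (kap n1 : nat).
Hypothesis n10 : (0 < n1)%N.
Hypothesis Cg1 : 1 <= Cg.
Hypothesis growth : forall m n i, (n1 <= m <= n)%N -> a n i <= Cg * (n%:R / m%:R) ^+ kap * a m i.
Hypothesis ring_bound : forall r1 r2 : R, 0 < r1 -> exists (rho : R) (n0 : nat), [/\ 0 < rho, rho < 1 &
  forall n (th : 'rV[R]_d), (n0 <= n)%N -> (forall j, `|th 0 j| * a n j <= r2) ->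
   (exists j, r1 <= `|th 0 j| * a n j) -> psi th ^+ n <= rho].
Hypothesis far_bound : forall r1 : R, 0 < r1 -> exists rho : R, [/\ 0 < rho, rho < 1 &
  forall th : 'rV[R]_d, (forall j, `|th 0 j| <= pi) ->
   (exists j, r1 <= `|th 0 j|) -> psi th <= rho].

(** Size of the frequency on the scale of time [n], in which the decay is measured. *)
Let f n (th : 'rV[R]_d) : R := \sum_j `|th 0 j| * a n j.

Let a0 n i : 0 < a n i. Proof. exact: lt_le_trans (a1 n i). Qed.

Let f_ge0 n th : 0 <= f n th.
Proof. by apply: sumr_ge0 => j _; rewrite mulr_ge0// ltW. Qed.

Lemma psi_ge0 th : 0 <= psi th. Proof. exact: cf2_ge0. Qed.

Lemma psi_le1 th : psi th <= 1.
Proof. apply: cf2_le1; exact: (trig_meas_walk hX 1 (fun z => realv z)). Qed.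

Let f_growth m n th : (n1 <= m <= n)%N -> f n th <= Cg * (n%:R / m%:R) ^+ kap * f m th.
Proof.
move=> mn; rewrite /f mulr_sumr; apply: ler_sum => j _.
by rewrite mulrCA ler_wpM2l// growth.
Qed.

Let f_big n th c : 0 < c -> c <= f n th -> exists j, c / (d.+1)%:R <= `|th 0 j| * a n j.
Proof.
move=> c0 cf; apply: contrapT => no.
suff : f n th <= \sum_(j < d) c / (d.+1)%:R.
  rewrite sumr_const card_ord -[X in _ <= X]mulr_natl => h.
  have : d%:R * (c / d.+1%:R) < c.
    rewrite mulrCA gtr_pMr// ltr_pdivrMr ?ltr0n// mul1r ltr_nat//.
  by move=> h2; have := le_lt_trans (le_trans cf h) h2; rewrite ltxx.
apply: ler_sum => j _; apply: ltW; rewrite ltNge; apply/negP => h.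
by apply: no; exists j.
Qed.

(** If f n th is large, let m be a time with f m th <= 1 < f (m + 1) th. Then psi^m <= rho, hence
    psi^n <= rho^t with t the integer part of n / m, while f n th is at most polynomial in t;
    geometric decay beats any power. Frequencies already large at the fixed time [n2] use the bound
    away from 0. *)
Lemma cf2_decay (K : nat) : exists2 C, 0 < C & forall n (th : 'rV[R]_d), (0 < n)%N ->
  (forall j, `|th 0 j| <= pi) -> psi th ^+ n * (1 + f n th) ^+ K <= C.
Proof.
have Cg0 : 0 < Cg by exact: lt_le_trans Cg1.
(* Between the times m and m + 1 the size grows at most by the factor [Cg * 2 ^+ kap], so f m th >=
   c0 at the chosen time m. *)
pose c0 := (Cg * 2 ^+ kap)^-1.
have c00 : 0 < c0 by rewrite invr_gt0 mulr_gt0// exprn_gt0.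
have [|rho1 [n0 [r10 r11 hr1]]] := @ring_bound (c0 / d.+1%:R) 1.
  by rewrite divr_gt0.
pose n2 := maxn n1 n0.
pose B := 1 + \sum_j a n2 j.
have aB j : a n2 j <= B.
  rewrite /B (bigD1 j)//= addrCA lerDl addr_ge0// sumr_ge0// => i _.
  exact: ltW.
have B1 : 1 <= B by rewrite lerDl sumr_ge0// => j _; exact: ltW.
have [|rho2 [r20 r21 hr2]] := far_bound (r1 := (d.+1%:R * B)^-1).
  by rewrite invr_gt0 mulr_gt0//; lra.
pose rho := Num.max rho1 rho2.
have rho0 : 0 < rho by rewrite lt_max r10.
have rho1' : rho < 1 by rewrite gt_max r11.
have [C1 [C10 hC1]] := geometric_poly (kap * K) rho0 rho1'.
have pi0 : 0 < pi :> R by exact: pi_gt0.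
have key n th t D : 0 <= D -> psi th ^+ n <= rho ^+ t -> 1 + f n th <= D * t%:R ^+ kap ->
  psi th ^+ n * (1 + f n th) ^+ K <= D ^+ K * C1.
  move=> D0 h1 h2.
  apply: (@le_trans _ _ (rho ^+ t * (D * t%:R ^+ kap) ^+ K)).
    apply: ler_pM => //; first by rewrite exprn_ge0// psi_ge0.
      by rewrite exprn_ge0// addr_ge0.
    by apply: lerXn2r; rewrite ?nnegrE// ?addr_ge0// mulr_ge0// exprn_ge0.
  by rewrite exprMn mulrCA -exprM ler_wpM2l// exprn_ge0.
have psin_le1 n th : psi th ^+ n <= 1.
  by rewrite exprn_ile1// ?psi_ge0// psi_le1.
pose D1 := 1 + Cg * 2 ^+ kap; pose D2 := 1 + Cg * (pi * (d%:R * B)).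
pose D3 := 1 + pi * \sum_(n < n2) \sum_j a n j.
have S0 : 0 <= \sum_(n < n2) \sum_j a n j.
  by apply: sumr_ge0 => n _; apply: sumr_ge0 => j _; exact: ltW.
have D10 : 0 <= D1 by rewrite addr_ge0// mulr_ge0// ?exprn_ge0// ltW.
have D20 : 0 <= D2 by rewrite addr_ge0// !mulr_ge0//; lra.
have D30 : 0 <= D3 by rewrite addr_ge0// !mulr_ge0//; lra.
have p1 : 0 <= D1 ^+ K * C1 by rewrite mulr_ge0 ?exprn_ge0//; lra.
have p2 : 0 <= D2 ^+ K * C1 by rewrite mulr_ge0 ?exprn_ge0//; lra.
have p3 : 0 <= D3 ^+ K by rewrite exprn_ge0.
have p4 : 0 < 2 ^+ K :> R by rewrite exprn_gt0.
exists (D1 ^+ K * C1 + D2 ^+ K * C1 + D3 ^+ K + 2 ^+ K); first by lra.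
move=> n th n0' hth.
have [nn2|nn2] := ltnP n n2.
  suff : psi th ^+ n * (1 + f n th) ^+ K <= D3 ^+ K by lra.
  rewrite -[leRHS]mul1r; apply: ler_pM => //.
  - by rewrite exprn_ge0// psi_ge0.
  - by rewrite exprn_ge0// addr_ge0.
  apply: lerXn2r; rewrite ?nnegrE// ?addr_ge0//.
  rewrite lerD2l; apply: (@le_trans _ _ (pi * \sum_j a n j)).
    rewrite mulr_sumr; apply: ler_sum => j _.
    by rewrite ler_wpM2r// ltW.
  rewrite ler_wpM2l ?(ltW pi0)// (bigD1 (Ordinal nn2))//= lerDl.
  by apply: sumr_ge0 => k _; apply: sumr_ge0 => j _; exact: ltW.
have [fn1|fn1] := leP (f n th) 1.
  suff : psi th ^+ n * (1 + f n th) ^+ K <= 2 ^+ K by lra.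
  rewrite -[leRHS]mul1r; apply: ler_pM => //.
  - by rewrite exprn_ge0// psi_ge0.
  - by rewrite exprn_ge0// addr_ge0.
  by apply: lerXn2r; rewrite ?nnegrE// ?addr_ge0//; lra.
have n12 : (n1 <= n2)%N by exact: leq_maxl.
have n20 : (0 < n2)%N by exact: leq_trans n12.
have [f2|f2] := ltP 1 (f n2 th).
  suff : psi th ^+ n * (1 + f n th) ^+ K <= D2 ^+ K * C1 by lra.
  apply: (key _ _ n) => //.
    apply: lerXn2r; rewrite ?nnegrE ?psi_ge0 ?(ltW rho0)//.
    rewrite le_max; apply/orP; right; apply: hr2 => //.
    have [j hj] := f_big ltr01 (ltW f2).
    exists j; rewrite invfM -[leLHS]mulrC ler_pdivrMl; last lra.
    rewrite mulrC; rewrite mul1r in hj; apply: (le_trans hj).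
    by rewrite ler_wpM2l.
  have h1 : 1 <= n%:R ^+ kap :> R by rewrite exprn_ege1// ler1n.
  have h2 : f n2 th <= pi * (d%:R * B).
    apply: (@le_trans _ _ (\sum_(j < d) pi * B)).
      by apply: ler_sum => j _; apply: ler_pM => //; exact: ltW.
    by rewrite sumr_const card_ord -(mulr_natl (pi * B)) mulrCA.
  have h3 : f n th <= Cg * n%:R ^+ kap * (pi * (d%:R * B)).
    apply: (le_trans (f_growth th (_ : (n1 <= n2 <= n)%N))); first by rewrite n12.
    apply: ler_pM => //; first by rewrite mulr_ge0 ?exprn_ge0 ?divr_ge0// ltW.
    rewrite ler_wpM2l ?(ltW Cg0)//; apply: lerXn2r; rewrite ?nnegrE ?divr_ge0//.
    by rewrite ler_pdivrMr ?ltr0n// ler_peMr// ler1n.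
  rewrite /D2 mulrDl mul1r; apply: lerD => //.
  by apply: (le_trans h3); rewrite mulrAC.
have [m [m1 mn fm fm1]] : exists m, [/\ (n2 <= m)%N, (m < n)%N, f m th <= 1 & 1 < f m.+1 th].
  have ex : exists k, (n2 <= k <= n)%N && (f k th <= 1) by exists n2; rewrite leqnn nn2 f2.
  have ub k : (n2 <= k <= n)%N && (f k th <= 1) -> (k <= n)%N by case/andP => /andP[].
  case: (ex_maxnP ex ub) => m /andP[/andP[m1 m2] m3] hm.
  have mn : (m < n)%N.
    by rewrite ltn_neqAle m2 andbT; apply/eqP => E; move: fn1; rewrite -E ltNge m3.
  exists m; split=> //; rewrite ltNge; apply/negP => h.
  have := hm m.+1; rewrite (leq_trans m1 (leqnSn m)) mn h => /(_ isT).
  by rewrite ltnn.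
have m0 : (0 < m)%N by exact: leq_trans m1.
pose t := (n %/ m)%N.
have t1 : (1 <= t)%N by rewrite divn_gt0// ltnW.
suff : psi th ^+ n * (1 + f n th) ^+ K <= D1 ^+ K * C1 by lra.
have n1m : (n1 <= m)%N by exact: leq_trans m1.
apply: (key _ _ t) => //.
  apply: (@le_trans _ _ ((psi th ^+ m) ^+ t)).
    by rewrite -exprM ler_wiXn2l ?psi_ge0 ?psi_le1// mulnC leq_trunc_div.
  apply: lerXn2r; rewrite ?nnegrE ?exprn_ge0 ?psi_ge0 ?(ltW rho0)//.
  rewrite le_max; apply/orP; left; apply: hr1.
  - by apply: leq_trans m1; exact: leq_maxr.
  - move=> j; apply: le_trans fm; rewrite /f (bigD1 j)//= lerDl sumr_ge0// => i _.
    by rewrite mulr_ge0// ltW.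
  apply: f_big => //; rewrite /c0 -[leLHS]mulr1 ler_pdivrMl; last by rewrite mulr_gt0// exprn_gt0.
  apply: (le_trans (ltW fm1)); apply: (le_trans (f_growth th (_ : (n1 <= m <= m.+1)%N))).
    by rewrite n1m leqnSn.
  rewrite ler_wpM2r// ler_wpM2l ?(ltW Cg0)//; apply: lerXn2r; rewrite ?nnegrE ?divr_ge0//.
  by rewrite ler_pdivrMr ?ltr0n// -natrM ler_nat mul2n -addnn -addn1 leq_add2l.
have h1 : 1 <= t%:R ^+ kap :> R by rewrite exprn_ege1// ler1n.
rewrite /D1 mulrDl mul1r; apply: lerD => //.
apply: (le_trans (f_growth th (_ : (n1 <= m <= n)%N))); first by rewrite n1m ltnW.
rewrite -[leRHS](mulrA Cg) -(exprMn kap 2) -[leRHS]mulr1; apply: ler_pM => //.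
  by rewrite mulr_ge0 ?exprn_ge0 ?divr_ge0// ltW.
rewrite ler_wpM2l ?(ltW Cg0)//; apply: lerXn2r; rewrite ?nnegrE ?divr_ge0 ?mulr_ge0//.
rewrite ler_pdivrMr ?ltr0n// -!natrM ler_nat.
have := ltn_ceil n m0; rewrite -/t => h; apply: (leq_trans (ltnW h)).
by rewrite leq_mul2r mul2n -addnn -addn1 leq_add2l t1 orbT.
Qed.

(** The decay bounds psi^(m/2) by a product over coordinates of (1 + |th_j| a_n j)^(-2), so the sum
    over frequencies factorizes into one-dimensional sums, each of order 1 / a_n j after
    normalization. The slack in n <= 2 m + d + 1 leaves room for half paths and for missing
    steps. *)
Lemma local_limit_bound : exists2 C, 0 < C & forall (A : {set 'I_d}) n m y,
  (0 < n)%N -> (n <= 2 * m + d + 1)%N ->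
  Er P (fun w => (agree A (walk X m w) y)%:R) * \prod_(j in A) a n j <= C.
Proof.
(* For m >= 1 one has n <= q m, so the power 2 q of psi^(m/2) is at most psi^n; the exponent 2 d (2
   q) then leaves two powers of 1 + f n th for each coordinate. *)
pose q := (d + 3)%N.
have [C C0 hC] := cf2_decay (2 * d * (2 * q)).
pose C' := Num.max 1 C.
have C'1 : 1 <= C' by rewrite le_max lexx.
pose S := \sum_(n < d.+2) \prod_j a n j.
have pr0 n : 0 < \prod_j a n j by apply: prodr_gt0.
have S0 : 0 <= S by apply: sumr_ge0 => n _; exact: ltW.
have prle (A : {set 'I_d}) n : \prod_(j in A) a n j <= \prod_j a n j.
  rewrite [leRHS](bigID (mem A))/= ler_peMr//.
    by apply: prodr_ge0 => j _; exact: ltW.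
  by apply: (big_ind (fun x => 1 <= x)) => // x y hx hy; exact: mulr_ege1.
have EA0 (A : {set 'I_d}) m y : 0 <= Er P (fun w => (agree A (walk X m w) y)%:R) by exact: Er_ge0.
have EA1 (A : {set 'I_d}) m y : Er P (fun w => (agree A (walk X m w) y)%:R) <= 1.
  rewrite -[leRHS](Er_cst P); apply: le_Er; [exact: (discrete_bool_bmf m (fun z => agree A z y)) | exact: bmf_cst|].
  by move=> w; case: agree.
exists (S + C' * 3 ^+ d + 1); first by rewrite ltr_wpDl ?addr_ge0 ?mulr_ge0 ?exprn_ge0//; lra.
move=> A n m y n0 nm.
have p3 : 0 <= C' * 3 ^+ d by rewrite mulr_ge0 ?exprn_ge0//; lra.
have [m0|m0] := posnP m.
  have nd : (n < d.+2)%N by rewrite m0 in nm; lia.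
  suff : Er P (fun w => (agree A (walk X m w) y)%:R) * \prod_(j in A) a n j <= S by lra.
  apply: (@le_trans _ _ (1 * \prod_j a n j)).
    by apply: ler_pM => //; apply: prodr_ge0 => j _; exact: ltW.
  rewrite mul1r /S (bigD1 (Ordinal nd))//= lerDl sumr_ge0// => k _.
  exact: ltW.
suff : Er P (fun w => (agree A (walk X m w) y)%:R) * \prod_(j in A) a n j <= C' * 3 ^+ d by lra.
rewrite -ler_pdivlMr; last by apply: prodr_gt0.
(* This makes [2 * M + 1] at least every [a n j], so that the term 2 / (2 M + 1) of the
   one-dimensional sums is at most 2 / a_n j. *)
pose M := Num.truncn (\sum_j a n j).
have aM j : a n j <= (M.*2.+1)%:R.
  apply: (@le_trans _ _ (\sum_j a n j)).
    by rewrite (bigD1 j)//= lerDl sumr_ge0// => i _; exact: ltW.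
  apply: ltW; apply: (lt_le_trans (truncnS_gt _)).
  by rewrite ler_nat -/M ltnS -addnn leq_addr.
apply: (le_trans (Er_agree_le M A m y)).
pose N : R := (M.*2.+1)%:R.
have N0 : 0 < N by rewrite ltr0n.
pose gj (j : 'I_d) (k : 'I_(M.*2.+1)) : R :=
  (1 + (if j \in A then 2 * pi * `|(k : nat)%:Z - M%:Z|%:~R / N * a n j else 0)) ^- 2.
have pi0 : 0 < pi :> R by exact: pi_gt0.
have step (f' : box d M) : Num.sqrt (psi (freq A f') ^+ m) <= C' * \prod_j gj j (f' j).
  set th := freq A f'.
  have hth j : `|th 0 j| <= pi by exact: freq_le_pi.
  have F0 : 0 < 1 + f n th by rewrite ltr_pwDl.
  have H1 : Num.sqrt (psi th ^+ m) * (1 + f n th) ^+ (2 * d) <= C'.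
    have q0 : (0 < 2 * q)%N by rewrite /q; lia.
    rewrite -(ler_pXn2r q0) ?nnegrE; last 2 first.
    - by rewrite mulr_ge0 ?exprn_ge0// ltW.
    - by lra.
    rewrite exprMn -exprM exprM sqr_sqrtr ?exprn_ge0 ?psi_ge0// -exprM.
    apply: (@le_trans _ _ (psi th ^+ n * (1 + f n th) ^+ (2 * d * (2 * q)))).
      rewrite ler_wpM2r ?exprn_ge0 ?(ltW F0)//.
      by rewrite ler_wiXn2l ?psi_ge0 ?psi_le1// /q; nia.
    apply: (le_trans (hC n th n0 hth)).
    apply: (@le_trans _ _ C'); first by rewrite /C' le_max lexx orbT.
    by rewrite ler_eXnr//; rewrite /q; lia.
  have P0 : 0 < \prod_j gj j (f' j).
    apply: prodr_gt0 => j _; rewrite invr_gt0 exprn_gt0// ltr_pwDl//.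
    by case: ifP => // _; rewrite !mulr_ge0 ?invr_ge0// ?ltW.
  rewrite -ler_pdivrMr//; apply: le_trans H1; rewrite ler_wpM2l//.
  rewrite -prodfV.
  rewrite (_ : (2 * d)%N = (\sum_(j < d) 2)%N); last by rewrite sum_nat_const card_ord mulnC.
  rewrite expr_sum; apply: ler_prod => j _.
  have E : (if j \in A then 2 * pi * `|((f' j : nat)%:Z - M%:Z)|%:~R / N * a n j else 0) = `|th 0 j| * a n j.
    rewrite /th mxE; case: ifP => _; last by rewrite normr0 mul0r.
    rewrite mxE !normrM normfV intr_norm [`|2|]ger0_norm// [`|pi|]ger0_norm ?(ltW pi0)//.
    by rewrite [`|_%:R|]ger0_norm.
  rewrite invrK E; apply/andP; split; first by rewrite exprn_ge0// addr_ge0// mulr_ge0// ltW.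
  apply: lerXn2r; rewrite ?nnegrE ?addr_ge0 ?mulr_ge0 ?(ltW (a0 _ _))//.
  by rewrite lerD2l /f (bigD1 j)//= lerDl sumr_ge0// => i _; rewrite mulr_ge0// ltW.
apply: (@le_trans _ _ (N ^- d * \sum_(f' : box d M) C' * \prod_j gj j (f' j))).
  by rewrite ler_wpM2l ?invr_ge0 ?exprn_ge0//; apply: ler_sum => f' _; exact: step.
rewrite -mulr_sumr -(bigA_distr_bigA gj) mulrCA -mulrA ler_pM2l; last by lra.
have -> : N ^- d = \prod_(j < d) N^-1 by rewrite prodr_const card_ord exprVn.
rewrite -big_split /=.
have -> : 3 ^+ d / \prod_(j in A) a n j = \prod_(j < d) (3 * (if j \in A then (a n j)^-1 else 1)).
  rewrite big_split /= prodr_const card_ord; congr (_ * _).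
  by rewrite -prodfV big_mkcond.
apply: ler_prod => j _; rewrite mulr_ge0 ?invr_ge0 ?(ltW N0)//=; last first.
  apply: sumr_ge0 => k _; rewrite invr_ge0 exprn_ge0// addr_ge0//.
  by case: ifP => // _; rewrite !mulr_ge0 ?invr_ge0// ?ltW.
rewrite /gj; case: ifP => jA; last first.
  under eq_bigr do rewrite addr0 expr1n invr1.
  rewrite sumr_const card_ord -/N mulVf ?lt0r_neq0// mulr1; lra.
pose e := 2 * pi * a n j / N.
have e0 : 0 < e by rewrite !mulr_gt0 ?invr_gt0.
apply: (@le_trans _ _ (N^-1 * (2 * (1 + e^-1)))).
  rewrite ler_wpM2l ?invr_ge0 ?(ltW N0)//.
  have S1 := sum_inv_sqr_le M e0.
  apply: (@le_trans _ _ (2 * \sum_(0 <= v < M.+1) (1 + v%:R * e) ^- 2)); last by rewrite ler_wpM2l.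
  apply: le_trans; last by apply: sum_symm_le => v; rewrite invr_ge0 exprn_ge0// addr_ge0// mulr_ge0// ltW.
  rewrite le_eqVlt; apply/orP; left; apply/eqP; apply: eq_bigr => k _.
  congr ((1 + _) ^- 2); rewrite -abszE -pmulrn /e; ring.
have pi1 : 1 <= pi :> R by have := @pi_ge2 R; lra.
have -> : N^-1 * (2 * (1 + e^-1)) = 2 / N + (a n j)^-1 / pi.
  have fieldE (u v p : R) : 0 < u -> 0 < v -> 0 < p ->
      u^-1 * (2 * (1 + (2 * p * v / u)^-1)) = 2 / u + v^-1 / p.
    by move=> u0 v0 p0; field; do ?[apply/andP; split]; exact: lt0r_neq0.
  exact: fieldE.
have h1 : N^-1 <= (a n j)^-1 by rewrite lef_pV2 ?posrE.
have h2 : (a n j)^-1 / pi <= (a n j)^-1.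
  by rewrite ler_piMr ?invr_ge0 ?(ltW (a0 _ _))// invf_le1//; lra.
have -> : 3 / a n j = 2 / a n j + (a n j)^-1 by ring.
by apply: lerD => //; rewrite ler_pM2l.
Qed.

End llt.

(** * Fuk-Nagaev inequality *)

(** Obtained from exp(-u/2) >= 1 - u/2 by squaring and inverting. *)
Lemma expR_le_quad (R : realType) (u : R) : `|u| <= 1 -> expR u <= 1 + u + 2 * u ^+ 2.
Proof.
rewrite ler_norml => /andP[um1 u1].
have E : expR u * (expR (- (u / 2)) ^+ 2) = 1.
  rewrite -expRM_natl -expRD; have -> : u + 2%:R * - (u / 2) = 0 by field.
  by rewrite expR0.
have h : 1 - u / 2 <= expR (- (u / 2)).
  by have := expR_ge1Dx (- (u / 2)).
have p1 : 0 < 1 - u / 2 by lra.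
have h2 : (1 - u / 2) ^+ 2 <= expR (- (u / 2)) ^+ 2.
  by apply: lerXn2r; rewrite ?nnegrE ?expR_ge0//; lra.
have h3 : expR u * (1 - u / 2) ^+ 2 <= 1 by apply: (le_trans (ler_wpM2l (expR_ge0 u) h2)); rewrite E.
have h4 : 1 <= (1 + u + 2 * u ^+ 2) * (1 - u / 2) ^+ 2.
  have -> : (1 + u + 2 * u ^+ 2) * (1 - u / 2) ^+ 2 = 1 + u ^+ 2 * ((1 - u) * (5 / 4 - u / 2)) by field.
  have q1 : 0 <= 1 - u by lra.
  have q2 : 0 <= 5 / 4 - u / 2 by lra.
  by rewrite lerDl mulr_ge0 ?sqr_ge0// mulr_ge0.
by rewrite -(@ler_pM2r _ ((1 - u / 2) ^+ 2)) ?exprn_gt0//; exact: le_trans h3 h4.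
Qed.

Lemma expR_poly (R : realType) (s : nat) : exists2 C : R, 0 < C &
  forall v, 0 <= v -> (2 * v) ^+ s * expR (v / 2) <= C * expR v.
Proof.
case: s => [|s].
  exists 1 => // v v0; rewrite expr0 !mul1r ler_expR; lra.
exists ((4 * s.+1%:R) ^+ s.+1); first by rewrite exprn_gt0// mulr_gt0.
move=> v v0.
have -> : expR v = expR (v / 2) * expR (v / 2) by rewrite -expRD; congr expR; field.
rewrite mulrA ler_wpM2r ?expR_ge0//.
have -> : expR (v / 2) = expR (v / (2 * s.+1%:R)) ^+ s.+1.
  by rewrite -expRM_natl; congr expR; field; rewrite nat1r pnatr_eq0.
rewrite -exprMn; apply: lerXn2r; rewrite ?nnegrE ?mulr_ge0 ?expR_ge0//.
have : v / (2 * s.+1%:R) <= expR (v / (2 * s.+1%:R)).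
  by apply: le_trans (expR_ge1Dx _); rewrite lerDr.
move=> h; have -> : 2 * v = 4 * s.+1%:R * (v / (2 * s.+1%:R)).
  by field; rewrite nat1r pnatr_eq0.
by rewrite ler_wpM2l// mulr_ge0.
Qed.

(** * Deviations of one coordinate of the truncated walk *)

Section one_step.
Context {R : realType} {d : nat} {dO : measure_display} {Omega : measurableType dO}.
Variables (P : probability Omega R) (X : nat -> Omega -> 'rV[int]_d).
Hypothesis hX : iid discrete_sets P X.
Variable i : 'I_d.

Definition bdd (F : int -> R) : Prop := exists K : R, forall k, `|F k| <= K.

Definition step_exp (F : int -> R) : R := Er P (fun w => F (X 0%N w 0 i)).

Lemma bdd_bmf F : bdd F -> bmf (fun w => F (X 0%N w 0 i)).
Proof.
move=> [K hK]; apply: (@discrete_bmf _ _ _ _ (X 0%N) (fun z => F (z 0 i))).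
  exact: (step_rv hX).
by exists K => z; exact: hK.
Qed.

Lemma bdd_trunc (f : int -> R) (y : nat) : bdd (fun k => f k * (`|k| <= y)%N%:R).
Proof.
exists (\sum_(j < y.+1) (`|f j%:Z| + `|f (- j%:Z)|)) => k.
have [ky|ky] := leqP `|k| y; last by rewrite mulr0 normr0 sumr_ge0.
rewrite mulr1 (bigD1 (Ordinal (ky : (`|k| < y.+1)%N)))//=.
rewrite -[leLHS]addr0 lerD ?sumr_ge0//.
by case: (intP k) => [|n|n]; rewrite ?oppr0 /= ?abszN /= ?lerDl ?lerDr.
Qed.

Lemma bddD F H : bdd F -> bdd H -> bdd (fun k => F k + H k).
Proof.
move=> [K hK] [K' hK']; exists (K + K') => k.
exact: le_trans (ler_normD _ _) (lerD (hK k) (hK' k)).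
Qed.

Lemma bddZ c F : bdd F -> bdd (fun k => c * F k).
Proof. by move=> [K hK]; exists (`|c| * K) => k; rewrite normrM ler_wpM2l. Qed.

Lemma bdd_bool (B : pred int) : bdd (fun k => (B k)%:R).
Proof. by exists 1 => k; case: (B k); rewrite ?normr1 ?normr0. Qed.

Lemma bdd_cst c : bdd (fun=> c).
Proof. by exists `|c|. Qed.

Lemma EXD F H : bdd F -> bdd H -> step_exp (fun k => F k + H k) = step_exp F + step_exp H.
Proof. by move=> bF bH; rewrite /step_exp ErD//; exact: bdd_bmf. Qed.

Lemma EXZ c F : bdd F -> step_exp (fun k => c * F k) = c * step_exp F.
Proof. by move=> bF; rewrite /step_exp ErZ//; exact: bdd_bmf. Qed.

Lemma EX_cst c : step_exp (fun=> c) = c.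
Proof. exact: Er_cst. Qed.

Lemma le_EX F H : bdd F -> bdd H -> (forall k, F k <= H k) -> step_exp F <= step_exp H.
Proof. by move=> bF bH FH; apply: le_Er => //; exact: bdd_bmf. Qed.

Lemma EX_ge0 F : (forall k, 0 <= F k) -> 0 <= step_exp F.
Proof. by move=> F0; apply: Er_ge0. Qed.

Lemma box_sum_le M F : bdd F -> (forall k, 0 <= F k) ->
  \sum_(e : box d M) boxw P X e * F (pt e 0 i) <= step_exp F.
Proof.
move=> [K hK] F0.
have := @Ex_le_Er _ _ _ _ P X hX M 1 (fun z => F (z 0 i)) (fun z => F0 _) (ex_intro _ K (fun z => hK _)).
rewrite /= => h; apply: le_trans (le_trans h _).
  by apply: ler_sum => e _; rewrite addr0.
by rewrite le_eqVlt; apply/orP; left; apply/eqP; congr Er; apply/funext => w /=; rewrite walk1.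
Qed.

Definition tail (k : nat) : R := step_exp (fun j => (k < `|j|)%N%:R).
Definition mom2 (k : nat) : R := step_exp (fun j => j%:~R ^+ 2 * (`|j| <= k)%N%:R).
Definition mom1 (k : nat) : R := step_exp (fun j => j%:~R * (`|j| <= k)%N%:R).

Lemma tail_ge0 k : 0 <= tail k.
Proof. by apply: EX_ge0 => j. Qed.

Lemma mom2_ge0 k : 0 <= mom2 k.
Proof. by apply: EX_ge0 => j; rewrite mulr_ge0 ?sqr_ge0. Qed.

(** Three ranges: up to [k], where lam |j| <= 1, the exponential is expanded to second order; from
    [k] to [y / 2] it is at most exp(lam y / 2); beyond, exp(lam y). The middle range is separate
    because the tail at [k] may be much heavier than at [y], and half of the exponent is left to pay
    for it. The linear term is kept up to [y] to make the truncated mean at [y] appear. *)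
Lemma EX_exp_le (sg lam : R) (k y : nat) : `|sg| = 1 -> 0 < lam -> (k <= y)%N ->
  k%:R * lam <= 1 ->
  step_exp (fun j => expR (sg * lam * j%:~R) * (`|j| <= y)%N%:R) <=
  1 + sg * lam * mom1 y + (2 * lam ^+ 2 * mom2 k + expR (lam * y%:R / 2) * tail k
    + expR (lam * y%:R) * tail (y %/ 2)).
Proof.
move=> sg1 lam0 ky klam.
have b1 := bdd_trunc (fun j => expR (sg * lam * j%:~R)) y.
have b2 := bddZ (sg * lam) (bdd_trunc (fun j => j%:~R) y).
have b3 := bddZ (2 * lam ^+ 2) (bdd_trunc (fun j => j%:~R ^+ 2) k).
have b4 := bddZ (expR (lam * y%:R / 2)) (bdd_bool (fun j => (k < `|j|)%N)).
have b5 := bddZ (expR (lam * y%:R)) (bdd_bool (fun j => (y %/ 2 < `|j|)%N)).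
rewrite -!EXZ ?bdd_bool//; try exact: bdd_trunc; try exact: bdd_bool.
rewrite -[X in _ <= X + _ + _](EX_cst 1) -!EXD//; try (do ?[exact: bdd_cst | apply: bddD => //]).
apply: le_EX => //; first by do ?[exact: bdd_cst | apply: bddD => //].
move=> j.
have [jy|jy] := leqP `|j| y; last first.
  rewrite !mulr0 addr0.
  have kj : (k < `|j|)%N by exact: leq_ltn_trans ky jy.
  have yj : (y %/ 2 < `|j|)%N by exact: leq_ltn_trans (leq_div _ _) jy.
  rewrite kj yj (leqNgt `|j| k) kj /= !mulr0 !mulr1 add0r.
  by rewrite !addr_ge0 ?expR_ge0.
rewrite !mulr1.
set u := sg * lam * j%:~R.
have nu : `|u| = lam * `|j|%N%:R.
  by rewrite /u !normrM sg1 mul1r gtr0_norm// -intr_norm -abszE -pmulrn.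
have [jk|jk] := leqP `|j| k.
  rewrite /= mulr1 mulr0 addr0.
  have u1 : `|u| <= 1.
    rewrite nu mulrC; apply: le_trans klam; rewrite ler_pM2r// ler_nat//.
  have := expR_le_quad u1.
  have -> : u ^+ 2 = lam ^+ 2 * j%:~R ^+ 2.
    have sg2 : sg ^+ 2 = 1 by rewrite -(real_normK (num_real sg)) sg1 expr1n.
    by rewrite /u !exprMn sg2 mul1r.
  have : 0 <= expR (lam * y%:R) * (y %/ 2 < `|j|)%N%:R by rewrite mulr_ge0 ?expR_ge0.
  by rewrite -mulrA; lra.
rewrite /= !mulr0 mulr1 add0r.
have hu : expR u <= 1 + u + expR `|u|.
  have [u0|u0] := leP 0 u; first by rewrite ger0_norm//; lra.
  rewrite ltr0_norm//.
  have : expR u <= 1 by rewrite expR_le1 ltW.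
  by have := expR_ge1Dx (- u); lra.
have e1 := expR_ge0 (lam * y%:R / 2); have e2 := expR_ge0 (lam * y%:R).
have [jy2|jy2] := leqP `|j| (y %/ 2).
  rewrite mulr0.
  have : expR `|u| <= expR (lam * y%:R / 2).
    rewrite ler_expR nu -mulrA ler_pM2l// ler_pdivlMr// -natrM ler_nat.
    by apply: leq_trans (leq_trunc_div y 2); rewrite leq_mul2r jy2.
  by lra.
have : expR `|u| <= expR (lam * y%:R) by rewrite ler_expR nu ler_pM2l// ler_nat.
by rewrite mulr1; lra.
Qed.

Definition smallw M (y : nat) (e : box d M) : R := boxw P X e * (`|pt e 0%R i| <= y)%N%:R.

Lemma smallw_ge0 M y e : 0 <= @smallw M y e.
Proof. by rewrite mulr_ge0// step_pmf_ge0. Qed.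

Lemma small_walk_bound M (lam be x : R) (k y m n : nat) : 0 < lam -> (k <= y)%N ->
  k%:R * lam <= 1 -> (m <= n)%N ->
  Ex (@pt d M) (@smallw M y) m (fun z => (x <= `|(z 0 i)%:~R - m%:R * be|)%R%:R) <=
  2 * expR (- lam * x + lam * (n%:R * `|mom1 y - be|) + n%:R *
   (2 * lam ^+ 2 * mom2 k + expR (lam * y%:R / 2) * tail k + expR (lam * y%:R) * tail (y %/ 2))).
Proof.
move=> lam0 ky klam mn.
set rest := 2 * lam ^+ 2 * mom2 k + _ + _.
have rest0 : 0 <= rest.
  apply: addr_ge0; first apply: addr_ge0; apply: mulr_ge0.
  - by rewrite mulr_ge0// sqr_ge0.
  - exact: mom2_ge0.
  - exact: expR_ge0.
  - exact: tail_ge0.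
  - exact: expR_ge0.
  - exact: tail_ge0.
have key sg : `|sg| = 1 ->
  Ex (@pt d M) (@smallw M y) m (fun z => expR (- (lam * x) - sg * lam * (m%:R * be) + sg * lam * (z 0 i)%:~R)) <=
  expR (- lam * x + lam * (n%:R * `|mom1 y - be|) + n%:R * rest).
  move=> sg1; rewrite Ex_expR.
  have h : \sum_e smallw y e * expR (sg * lam * (@pt d M e 0 i)%:~R) <= expR (sg * lam * mom1 y + rest).
    apply: (@le_trans _ _ (step_exp (fun j => expR (sg * lam * j%:~R) * (`|j| <= y)%N%:R))).
      rewrite (eq_bigr (fun e : box d M => boxw P X e * (fun j => expR (sg * lam * j%:~R) * (`|j| <= y)%N%:R) (pt e 0 i))).
        by apply: box_sum_le => [|j]; [exact: bdd_trunc | rewrite mulr_ge0 ?expR_ge0].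
      by move=> e _; rewrite /smallw mulrAC mulrA.
    apply: (le_trans (EX_exp_le sg1 lam0 ky klam)); rewrite -/rest.
    by have := expR_ge1Dx (sg * lam * mom1 y + rest); rewrite addrA.
  have h0 : 0 <= \sum_e smallw y e * expR (sg * lam * (@pt d M e 0 i)%:~R).
    by apply: sumr_ge0 => e _; rewrite mulr_ge0 ?expR_ge0 ?smallw_ge0.
  apply: (le_trans (ler_wpM2l (expR_ge0 _) (lerXn2r m h0 (expR_ge0 _) h))).
  rewrite -expRM_natl -expRD ler_expR.
  have -> : - (lam * x) - sg * lam * (m%:R * be) + m%:R * (sg * lam * mom1 y + rest) =
     - lam * x + (sg * lam * (m%:R * (mom1 y - be)) + m%:R * rest) by ring.
  rewrite -addrA lerD2l lerD//; last by rewrite ler_wpM2r// ler_nat.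
  apply: (le_trans (ler_norm _)); rewrite !normrM sg1 mul1r gtr0_norm// normr_nat.
  by rewrite ler_wpM2l ?(ltW lam0)// ler_wpM2r// ler_nat.
apply: (@le_trans _ _ (Ex (@pt d M) (@smallw M y) m (fun z =>
   expR (- (lam * x) - 1 * lam * (m%:R * be) + 1 * lam * (z 0 i)%:~R) +
   expR (- (lam * x) - (-1) * lam * (m%:R * be) + (-1) * lam * (z 0 i)%:~R)))).
  apply: le_Ex => [e|z]; first exact: smallw_ge0.
  case: (boolP (x <= `|(z 0 i)%:~R - m%:R * be|)%R) => [xz|_]; last by rewrite /= addr_ge0 ?expR_ge0.
  set t := (z 0 i)%:~R - m%:R * be in xz *.
  have -> : - (lam * x) - 1 * lam * (m%:R * be) + 1 * lam * (z 0 i)%:~R = lam * (t - x) by rewrite /t; ring.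
  have -> : - (lam * x) - (-1) * lam * (m%:R * be) + (-1) * lam * (z 0 i)%:~R = lam * (- t - x) by rewrite /t; ring.
  have e1 := expR_ge0 (lam * (t - x)); have e2 := expR_ge0 (lam * (- t - x)).
  have [t0|t0] := leP 0 t.
    rewrite ger0_norm// in xz.
    have : 1 <= expR (lam * (t - x)) by rewrite -expR0 ler_expR mulr_ge0 ?(ltW lam0)//; lra.
    by rewrite /=; lra.
  rewrite ltr0_norm// in xz.
  have : 1 <= expR (lam * (- t - x)) by rewrite -expR0 ler_expR mulr_ge0 ?(ltW lam0)//; lra.
  by rewrite /=; lra.
rewrite ExD; set e := expR (_ + _ + _ * rest) in key *; have -> : 2 * e = e + e by ring.
apply: lerD; apply: key; rewrite ?normrN normr1//.
Qed.

(* [T] bounds the tail, [g] tells whether the Gaussian regime may occur. *)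
Variables (T : nat -> R) (a : nat -> R) (be : nat -> R) (g : bool).
Hypothesis T_gt0 : forall k, 0 < T k.
Hypothesis a_ge1 : forall n, 1 <= a n.
Variables (CG C3 C4 C5 : R) (s P0 : nat).
Hypothesis tail_le : forall k, tail k <= CG * T k.
Hypothesis T_poly : forall k y, (k <= y)%N -> T k * k.+1%:R ^+ s <= C3 * T y * y.+1%:R ^+ s.
Hypothesis P0_gt0 : (0 < P0)%N.
Hypothesis nT_le : forall n x, (0 < n)%N -> a n <= x%:R -> (n%:R * T x) ^+ P0 * x%:R <= C4 * a n.
Hypothesis mom2_le : ~~ g -> forall k, mom2 k <= C5 * k%:R ^+ 2 * T k.
Hypothesis mom2_gauss : g -> forall n k, (0 < n)%N -> n%:R * mom2 k <= C5 * (k%:R ^+ 2 + a n ^+ 2).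
Hypothesis mom1_le : forall e : R, 0 < e -> exists C0, forall n y, (0 < n)%N -> C0 * a n <= y%:R ->
  n%:R * `|mom1 y - be n| <= e * y%:R.

Let a_gt0 n : 0 < a n. Proof. exact: lt_le_trans (a_ge1 n). Qed.

Let C3_ge0 : 0 <= C3.
Proof.
have := T_poly (leqnn 0); rewrite expr1n !mulr1 => h.
by have := T_gt0 0; nra.
Qed.

Let CG_ge0 : 0 <= CG.
Proof. by have := tail_ge0 0; have := tail_le 0; have := T_gt0 0; nra. Qed.

Let C5_ge0 : 0 <= C5.
Proof.
have [gt|ng] := boolP g.
  have := mom2_gauss gt 0 (ltn0Sn 0); rewrite mul1r expr0n add0r => h.
  have := mom2_ge0 0; have := a_gt0 1; have := sqr_ge0 (a 1) => h1 h2 h3.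
  have : 0 < a 1 ^+ 2 by rewrite exprn_gt0.
  by nra.
have := mom2_le ng 1; rewrite expr1n mulr1 => h.
by have := mom2_ge0 1; have := T_gt0 1; nra.
Qed.

(** With lam of order 1 / k, [T_poly] gives T k <= C (lam y)^s T y, and this power is absorbed by
    the half exponent left over by the middle range. In the Gaussian regime the second moment is not
    controlled by [T], hence the extra term. *)
Lemma error_term_bound : exists2 C, 0 <= C & forall (lam : R) (k y n : nat), 0 < lam -> (k <= y)%N ->
  k%:R * lam <= 1 -> 1 <= k.+1%:R * lam -> 1 <= lam * y%:R -> (0 < n)%N ->
  n%:R * (2 * lam ^+ 2 * mom2 k + expR (lam * y%:R / 2) * tail k + expR (lam * y%:R) * tail (y %/ 2)) <=
  C * (n%:R * T y * expR (lam * y%:R)) + g%:R * (C * (1 + lam ^+ 2 * a n ^+ 2)).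
Proof.
have [Ce Ce0 hCe] := expR_poly R s.
pose D := Num.max (2 * C5) ((2 * C5 + CG) * C3 * Ce + CG * C3 * 2 ^+ s).
have D0 : 0 <= D by rewrite le_max mulr_ge0.
exists D => // lam k y n lam0 ky kl kl1 ly n0.
set v := lam * y%:R in ly *.
have v0 : 0 <= v by lra.
have y0 : (0 < y)%N.
  by case: (posnP y) => // y0; move: ly; rewrite /v y0 mulr0 ler10.
have Tk : T k <= C3 * (2 * v) ^+ s * T y.
  have kp : 0 < k.+1%:R ^+ s :> R by rewrite exprn_gt0.
  rewrite -(ler_pM2r kp); apply: (le_trans (T_poly ky)).
  have -> : C3 * (2 * v) ^+ s * T y * k.+1%:R ^+ s = C3 * T y * (2 * v * k.+1%:R) ^+ s.
    by rewrite !exprMn; ring.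
  rewrite ler_wpM2l ?mulr_ge0 ?(ltW (T_gt0 _))//.
  apply: lerXn2r; rewrite ?nnegrE ?mulr_ge0 ?(ltW lam0)//.
  have : y.+1%:R <= 2 * y%:R :> R by rewrite -natrM ler_nat mul2n -addnn -addn1 leq_add2l.
  move=> h; apply: (le_trans h).
  have -> : 2 * v * k.+1%:R = 2 * y%:R * (k.+1%:R * lam) by rewrite /v; ring.
  by rewrite ler_peMr// mulr_ge0.
have Ty2 : T (y %/ 2) <= C3 * 2 ^+ s * T y.
  have kp : 0 < (y %/ 2).+1%:R ^+ s :> R by rewrite exprn_gt0.
  rewrite -(ler_pM2r kp); apply: (le_trans (T_poly (leq_div y 2))).
  have -> : C3 * 2 ^+ s * T y * (y %/ 2).+1%:R ^+ s = C3 * T y * (2 * (y %/ 2).+1%:R) ^+ s.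
    by rewrite !exprMn; ring.
  rewrite ler_wpM2l ?mulr_ge0 ?(ltW (T_gt0 _))//.
  apply: lerXn2r; rewrite ?nnegrE ?mulr_ge0//.
  by rewrite -natrM ler_nat mulnC; exact: ltn_ceil.
have ev0 := expR_ge0 v; have ev20 := expR_ge0 (v / 2).
have Ty := T_gt0 y.
have nn : 0 < n%:R :> R by rewrite ltr0n.
have hv := hCe v v0.
have h2 : expR (v / 2) * tail k <= CG * C3 * Ce * (T y * expR v).
  apply: (@le_trans _ _ (expR (v / 2) * (CG * (C3 * (2 * v) ^+ s * T y)))).
    by rewrite ler_wpM2l//; apply: (le_trans (tail_le k)); rewrite ler_wpM2l.
  have -> : expR (v / 2) * (CG * (C3 * (2 * v) ^+ s * T y)) = CG * C3 * T y * ((2 * v) ^+ s * expR (v / 2)) by ring.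
  have -> : CG * C3 * Ce * (T y * expR v) = CG * C3 * T y * (Ce * expR v) by ring.
  by rewrite ler_wpM2l// !mulr_ge0// ltW.
have h3 : expR v * tail (y %/ 2) <= CG * C3 * 2 ^+ s * (T y * expR v).
  apply: (@le_trans _ _ (expR v * (CG * (C3 * 2 ^+ s * T y)))).
    by rewrite ler_wpM2l//; apply: (le_trans (tail_le _)); rewrite ler_wpM2l.
  by rewrite le_eqVlt; apply/orP; left; apply/eqP; ring.
have TyE : 0 <= T y * expR v by rewrite mulr_ge0// ltW.
rewrite -[n%:R * T y * _]mulrA; have [gt|ng] := boolP g.
  rewrite mul1r.
  have h1 : n%:R * (2 * lam ^+ 2 * mom2 k) <= D * (1 + lam ^+ 2 * a n ^+ 2).
    have := mom2_gauss gt k n0 => h.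
    apply: (@le_trans _ _ (2 * lam ^+ 2 * (C5 * (k%:R ^+ 2 + a n ^+ 2)))).
      by rewrite mulrCA ler_wpM2l// mulr_ge0// sqr_ge0.
    have -> : 2 * lam ^+ 2 * (C5 * (k%:R ^+ 2 + a n ^+ 2)) = 2 * C5 * ((k%:R * lam) ^+ 2 + lam ^+ 2 * a n ^+ 2).
      by rewrite exprMn; ring.
    apply: ler_pM.
    - by rewrite mulr_ge0.
    - by rewrite addr_ge0 ?sqr_ge0// mulr_ge0 ?sqr_ge0.
    - by rewrite le_max lexx.
    - by rewrite lerD2r exprn_ile1// mulr_ge0// ltW.
  have h4 : expR (v / 2) * tail k + expR v * tail (y %/ 2) <= D * (T y * expR v).
    apply: (@le_trans _ _ ((CG * C3 * Ce + CG * C3 * 2 ^+ s) * (T y * expR v))).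
      by rewrite mulrDl; exact: lerD.
    rewrite ler_wpM2r// le_max; apply/orP; right.
    have : 0 <= C5 * C3 * Ce by rewrite !mulr_ge0 ?(ltW Ce0).
    by lra.
  rewrite -addrA mulrDr [leRHS]addrC; apply: lerD => //.
  by rewrite [leRHS]mulrCA ler_wpM2l// ltW.
rewrite mul0r addr0 [leRHS]mulrCA ler_wpM2l ?(ltW nn)//.
have h1 : 2 * lam ^+ 2 * mom2 k <= 2 * C5 * C3 * Ce * (T y * expR v).
  have hm := mom2_le ng k.
  apply: (@le_trans _ _ (2 * lam ^+ 2 * (C5 * k%:R ^+ 2 * T k))).
    by rewrite ler_wpM2l// mulr_ge0// sqr_ge0.
  have -> : 2 * lam ^+ 2 * (C5 * k%:R ^+ 2 * T k) = 2 * C5 * (T k * (k%:R * lam) ^+ 2).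
    by rewrite exprMn; ring.
  apply: (@le_trans _ _ (2 * C5 * T k)).
    rewrite ler_wpM2l ?mulr_ge0// ler_piMr ?(ltW (T_gt0 _))//.
    by rewrite exprn_ile1// mulr_ge0// ltW.
  rewrite -!(mulrA (2 * C5)) ler_wpM2l ?mulr_ge0//; apply: (le_trans Tk).
  have -> : C3 * (2 * v) ^+ s * T y = C3 * T y * (2 * v) ^+ s by ring.
  rewrite (_ : C3 * Ce * (T y * expR v) = C3 * T y * (Ce * expR v)); last ring.
  rewrite ler_wpM2l ?mulr_ge0 ?(ltW Ty)//; apply: le_trans hv.
  have e1 : 1 <= expR (v / 2) by rewrite -[leLHS]expR0 ler_expR; lra.
  by rewrite ler_peMr// exprn_ge0// mulr_ge0.
apply: (le_trans (lerD (lerD h1 h2) h3)).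
rewrite -!mulrDl ler_wpM2r// le_max; apply/orP; right.
by rewrite le_eqVlt; apply/orP; left; apply/eqP; ring.
Qed.

(** The exponent is [lam1], which makes n T(y) exp(lam y) equal to 1 and yields the power of n T, or
    in the Gaussian regime the smaller of [lam1] and [lam2], the latter being of the order of the
    optimal Gaussian exponent x / a_n^2. The freedom [q <= q'] lets all coordinates share one
    truncation ratio. *)
Lemma fuk_nagaev (p : nat) : (0 < p)%N -> exists (q : nat) (C0 C c : R), [/\ (0 < q)%N, 0 < C, 0 < c &
  forall M n m (x : nat) q', (0 < n)%N -> (m <= n)%N -> C0 * a n <= x%:R -> (q <= q')%N ->
  Ex (@pt d M) (@smallw M (x %/ q')) m (fun z => (x%:R / 4 <= `|(z 0 i)%:~R - m%:R * be n|)%R%:R) <=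
  C * ((n%:R * T x) ^+ p + expR (- c * (x%:R / a n) ^+ 2) * g%:R)].
Proof.
move=> p0.
have [C C_0 hC] := error_term_bound.
(* Of the deviation x / 4 the drift takes x / 8 and the error term x / 16; the exponent keeps x /
   16. *)
have [|C01 h1] := mom1_le (e := 1 / 8); first by lra.
(* exp(-lam1 x / 16) is tau^(x / (16 y)) and x >= q y, so this [q] produces the power [p]. *)
pose q := (16 * p)%N.
have q0 : (0 < q)%N by rewrite muln_gt0.
have qR : 0 < q%:R :> R by rewrite ltr0n.
(* For lam <= lam2 this gives C lam^2 a_n^2 <= lam x / 16. *)
pose c1 : R := (16 * (C + 1))^-1.
have c10 : 0 < c1 by rewrite invr_gt0; lra.
have Cc1 : C * c1 <= 1 / 16.
  by rewrite /c1 ler_pdivrMr; lra.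
(* The threshold ensures y >= K a_n, which forces tau <= 1/e, that is lam1 y >= 1, and also lam2 y
   >= 1. *)
pose K := 1 + `|C01| + `|C4| * expR P0%:R + c1^-1.
have t1 : 0 <= `|C4| * expR P0%:R by rewrite mulr_ge0 ?expR_ge0.
have t2 : 0 <= c1^-1 by rewrite invr_ge0 ltW.
have t3 := normr_ge0 C01.
have K1 : 1 <= K by rewrite /K; lra.
have KC01 : C01 <= K by have := ler_norm C01; rewrite /K; lra.
have KC4 : `|C4| * expR P0%:R <= K by rewrite /K; lra.
have Kc1 : c1^-1 <= K by rewrite /K; lra.
pose B := C3 * q%:R ^+ s.
have B0 : 0 <= B by rewrite mulr_ge0 ?exprn_ge0.
exists q, (2 * q%:R * K), (2 * expR (2 * C) * (B ^+ p + 1)), (c1 / 16); split => //.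
- by rewrite !mulr_gt0 ?expR_gt0// ltr_wpDl// exprn_ge0.
- by rewrite divr_gt0.
move=> M n m x q' n0 mn xa qq'.
pose y := (x %/ q)%N.
have an := a_gt0 n; have an1 := a_ge1 n.
have xq : (q <= x)%N.
  rewrite -(ler_nat R); apply: le_trans xa.
  have -> : 2 * q%:R * K * a n = q%:R * (2 * (K * a n)) by ring.
  have K2 : 1 <= K * a n by rewrite mulr_ege1.
  by rewrite ler_peMr//; lra.
have y1 : (1 <= y)%N by rewrite divn_gt0.
have yR : 0 < y%:R :> R by rewrite ltr0n.
have yx : (y <= x)%N by exact: leq_div.
have xy2 : x%:R <= 2 * q%:R * y%:R :> R.
  rewrite -!natrM ler_nat; apply: (leq_trans (ltnW (ltn_ceil x q0))).
  rewrite -/y (mulnC 2) -mulnA mulnC leq_mul2l mul2n -addnn -addn1 leq_add2l y1 orbT//.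
have xyq : q%:R * y%:R <= x%:R :> R by rewrite -natrM ler_nat mulnC leq_trunc_div.
have ya : K * a n <= y%:R.
  have : 2 * q%:R * (K * a n) <= 2 * q%:R * y%:R by apply: le_trans xy2; rewrite mulrA.
  by rewrite ler_pM2l// mulr_gt0.
have aley : a n <= y%:R by apply: le_trans ya; rewrite ler_peMl// ltW.
pose tau := n%:R * T y.
have tau0 : 0 < tau by rewrite mulr_gt0 ?ltr0n.
have tau1 : tau <= expR (-1).
  have h := nT_le n0 aley; rewrite -/tau in h.
  rewrite -(@ler_pXn2r _ P0) ?nnegrE ?expR_ge0 ?(ltW tau0)//.
  rewrite -expRM_natl mulrN1 expRN -[leRHS]mul1r ler_pdivlMr ?expR_gt0//.
  rewrite -(ler_pM2r yR) mul1r mulrAC.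
  apply: (@le_trans _ _ (`|C4| * a n * expR P0%:R)).
    rewrite ler_wpM2r ?expR_ge0//; apply: (le_trans h).
    by rewrite ler_wpM2r ?(ltW an)// ler_norm.
  apply: le_trans ya; rewrite mulrAC ler_wpM2r// ltW//.
have lntau : ln tau <= -1.
  by rewrite -ler_expR lnK// posrE.
have tauTx : tau <= B * (n%:R * T x).
  rewrite /tau /B mulrCA ler_wpM2l//.
  have kp : 0 < y.+1%:R ^+ s :> R by rewrite exprn_gt0.
  rewrite -(ler_pM2r kp); apply: (le_trans (T_poly yx)).
  have -> : C3 * q%:R ^+ s * T x * y.+1%:R ^+ s = C3 * T x * (q%:R * y.+1%:R) ^+ s.
    by rewrite exprMn; ring.
  rewrite ler_wpM2l ?mulr_ge0 ?(ltW (T_gt0 _))//.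
  apply: lerXn2r; rewrite ?nnegrE ?mulr_ge0//.
  by rewrite -natrM ler_nat mulnC; exact: ltn_ceil.
pose lam1 := - ln tau / y%:R.
have lam10 : 0 < lam1 by rewrite divr_gt0//; lra.
pose lam2 := c1 * x%:R / a n ^+ 2.
have lam2y : 1 <= lam2 * y%:R.
  have x0 : 0 < x%:R :> R by rewrite ltr0n; exact: leq_trans yx.
  rewrite /lam2 mulrAC ler_pdivlMr ?exprn_gt0// mul1r expr2.
  apply: ler_pM => //; try exact: ltW.
  rewrite -ler_pdivrMl//; apply: (@le_trans _ _ (K * a n)).
    by rewrite ler_wpM2r// ltW.
  by apply: (le_trans ya); rewrite ler_nat.
have lam20 : 0 < lam2.
  by rewrite -(pmulr_lgt0 _ yR); lra.
pose lam := if g then Num.min lam1 lam2 else lam1.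
have lamle1 : lam <= lam1 by rewrite /lam; case: ifP => // _; rewrite ge_min lexx.
have lam0 : 0 < lam by rewrite /lam; case: ifP => // _; rewrite lt_min lam10.
have lam1y : lam1 * y%:R = - ln tau by rewrite /lam1 divfK// lt0r_neq0.
have lamy : 1 <= lam * y%:R.
  rewrite /lam; case: ifP => _; last by rewrite lam1y; lra.
  by case: (leP lam1 lam2) => _; [rewrite lam1y; lra | exact: lam2y].
pose k := Num.truncn (lam^-1).
have li0 : 0 <= lam^-1 by rewrite invr_ge0 ltW.
have k1 : k%:R <= lam^-1 by rewrite truncn_le.
have kl : k%:R * lam <= 1 by rewrite -ler_pdivlMr// mul1r.
have kl1 : 1 <= k.+1%:R * lam by rewrite -ler_pdivrMr// mul1r ltW// truncnS_gt.
have ky : (k <= y)%N.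
  rewrite -(ler_nat R); apply: (le_trans k1).
  by rewrite -[leLHS]mulr1 ler_pdivrMl.
have step1 := small_walk_bound M (be n) (x%:R / 4) lam0 ky kl mn.
have := hC lam k y n lam0 ky kl kl1 lamy n0.
set E := n%:R * (_ + _ + _) in step1 * => hE.
have etau : n%:R * T y * expR (lam * y%:R) <= 1.
  rewrite -/tau -[tau]lnK ?posrE// -expRD -[leRHS]expR0 ler_expR.
  by have : lam * y%:R <= lam1 * y%:R by [rewrite ler_pM2r]; rewrite lam1y; lra.
have hm1 : n%:R * `|mom1 y - be n| <= 1 / 8 * x%:R.
  apply: (le_trans (h1 n y n0 _)).
    by apply: le_trans ya; rewrite ler_wpM2r// ltW.
  by rewrite ler_pM2l ?ler_nat//; lra.
have x0 : 0 <= x%:R :> R by [].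
have hE2 : E <= 2 * C + lam * x%:R / 16.
  apply: (le_trans hE).
  have p1 : C * (n%:R * T y * expR (lam * y%:R)) <= C by rewrite ler_piMr.
  have lx0 : 0 <= lam * x%:R by rewrite mulr_ge0// ltW.
  suff : g%:R * (C * (1 + lam ^+ 2 * a n ^+ 2)) <= C + lam * x%:R / 16 by lra.
  rewrite /lam in lx0 *; case: (g) lx0 => lx0; last by rewrite mul0r addr_ge0// divr_ge0.
  rewrite mul1r mulrDr mulr1 lerD2l.
  set l := Num.min _ _ in lx0 *.
  have l0 : 0 < l by rewrite lt_min lam10.
  have : l * a n ^+ 2 <= c1 * x%:R.
    by rewrite -ler_pdivlMr ?exprn_gt0// ge_min lexx orbT.
  move=> hl; apply: (@le_trans _ _ (C * (l * (c1 * x%:R)))).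
    by rewrite ler_wpM2l// expr2 -mulrA ler_wpM2l// ltW.
  have -> : C * (l * (c1 * x%:R)) = (C * c1) * (l * x%:R) by ring.
  by have := ler_wpM2r lx0 Cc1; lra.
have expo : - lam * (x%:R / 4) + lam * (n%:R * `|mom1 y - be n|) + E <= 2 * C - lam * x%:R / 16.
  have : lam * (n%:R * `|mom1 y - be n|) <= lam * (1 / 8 * x%:R) by rewrite ler_pM2l.
  by lra.
have final : expR (- (lam * x%:R / 16)) <= tau ^+ p + expR (- (c1 / 16) * (x%:R / a n) ^+ 2) * g%:R.
  have f1 : expR (- (lam1 * x%:R / 16)) <= tau ^+ p.
    rewrite -[tau]lnK ?posrE// -expRM_natl ler_expR.
    have -> : - (lam1 * x%:R / 16) = ln tau * (x%:R / (16 * y%:R)).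
      by rewrite /lam1; field; exact: lt0r_neq0.
    rewrite [leRHS]mulrC ler_nM2l; last lra.
    rewrite ler_pdivlMr ?mulr_gt0//; apply: le_trans xyq.
    by rewrite /q natrM mulrCA mulrA.
  rewrite /lam; case: (g); last by rewrite mulr0 addr0.
  case: (leP lam1 lam2) => _; rewrite mulr1.
    by apply: (le_trans f1); rewrite lerDl expR_ge0.
  have -> : - (c1 / 16) * (x%:R / a n) ^+ 2 = - (lam2 * x%:R / 16).
    by rewrite /lam2; field; exact: lt0r_neq0.
  by rewrite lerDr exprn_ge0// ltW.
have w1 : Ex (@pt d M) (@smallw M (x %/ q')) m (fun z => (x%:R / 4 <= `|(z 0 i)%:~R - m%:R * be n|)%R%:R) <=
  Ex (@pt d M) (@smallw M y) m (fun z => (x%:R / 4 <= `|(z 0 i)%:~R - m%:R * be n|)%R%:R).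
  apply: le_Ex_weight => [e|//]; rewrite smallw_ge0 /= ler_wpM2l ?step_pmf_ge0//.
  have yy : (x %/ q' <= y)%N by exact: leq_div2l.
  case: (leqP _ (x %/ q')) => // h; by rewrite (leq_trans h yy).
apply: (le_trans w1); apply: (le_trans step1).
apply: (@le_trans _ _ (2 * (expR (2 * C) * (tau ^+ p + expR (- (c1 / 16) * (x%:R / a n) ^+ 2) * g%:R)))).
  rewrite ler_pM2l//; apply: (@le_trans _ _ (expR (2 * C - lam * x%:R / 16))).
    by rewrite ler_expR.
  by rewrite expRD ler_pM2l// expR_gt0.
rewrite -!mulrA ler_pM2l// ler_pM2l ?expR_gt0//.
have g0 : 0 <= expR (- (c1 / 16) * (x%:R / a n) ^+ 2) * g%:R by rewrite mulr_ge0 ?expR_ge0.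
have nT0 : 0 <= n%:R * T x by rewrite mulr_ge0// ltW.
rewrite mulrDl mul1r; apply: (@le_trans _ _ (B ^+ p * (n%:R * T x) ^+ p + expR (- (c1 / 16) * (x%:R / a n) ^+ 2) * g%:R)).
  rewrite lerD2r -exprMn; apply: lerXn2r; rewrite ?nnegrE ?mulr_ge0// ?ltW//.
rewrite mulrDr -addrA lerD2l.
have := exprn_ge0 p B0; have := exprn_ge0 p nT0 => u1 u2.
have : 0 <= B ^+ p * (expR (- (c1 / 16) * (x%:R / a n) ^+ 2) * g%:R) by rewrite mulr_ge0.
by lra.
Qed.

End one_step.

(** * Induction on the set of prescribed coordinates *)

Section pinning.
Context {R : realType} {d : nat}.

Lemma agreeU (A B : {set 'I_d}) y v : agree (A :|: B) y v = agree A y v && agree B y v.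
Proof.
apply/forallP/andP => [h|[/forallP hA /forallP hB] j].
  split; apply/forallP => j; apply/implyP => jA.
    by have /implyP := h j; apply; rewrite inE jA.
  by have /implyP := h j; apply; rewrite inE jA orbT.
by apply/implyP; rewrite inE => /orP[jA|jB]; [have := hA j; rewrite jA|have := hB j; rewrite jB].
Qed.

Lemma agree_addl (A : {set 'I_d}) z y v : agree A (z + y) v = agree A y (v - z).
Proof. by rewrite agree_shift [RHS]agree_shift opprB addrA (addrC z). Qed.

(** A canonical representative of the steps that share their coordinates outside [B]; the index
    [inord M] is the coordinate 0 under [pt]. *)
Definition zero_out M (B : {set 'I_d}) (e : box d M) : box d M :=
  [ffun j => if j \in B then inord M else e j].

Lemma pt_zero_out M (B : {set 'I_d}) (e : box d M) j : j \notin B -> pt (zero_out B e) 0 j = pt e 0 j.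
Proof. by move=> jB; rewrite !mxE ffunE (negbTE jB). Qed.

Lemma zero_outK M (B : {set 'I_d}) (e : box d M) : zero_out B (zero_out B e) = zero_out B e.
Proof. by apply/ffunP => j; rewrite !ffunE; case: (j \in B). Qed.

(* Once the coordinates in B of the step are pinned by the rest of the path,
   the remaining coordinates range over a product set. *)
Lemma pinned_sum M (w : box d M -> R) m (A B D : {set 'I_d}) (lim : 'I_d -> nat)
    (g : 'I_d -> nat -> R) (bound : R) (v : 'rV[int]_d) :
  (forall e, 0 <= w e) -> (forall l k, 0 <= g l k) -> 0 <= bound ->
  (forall j, j \in A -> j \notin B) -> (forall j, j \in D -> j \notin B) ->
  (forall z : 'rV[int]_d, [forall j in D, (`|z 0%R j| <= lim j)%N] ->
    Ex (@pt d M) w m (fun y => (agree A y (v - z))%:R) <= bound) ->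
  \sum_(e : box d M) [forall j in D, (`|pt e 0%R j| <= lim j)%N]%:R *
    \prod_(l | l \notin B) g l `|pt e 0%R l|%N *
    Ex (@pt d M) w m (fun y => (agree (A :|: B) (pt e + y) v)%:R)
  <= bound * \prod_(l | l \notin B) \sum_(k < M.*2.+1) g l `|k%:Z - M%:Z|%N.
Proof.
move=> w0 g0 b0 AB DB IH.
pose ok (e : box d M) := [forall j in D, (`|pt e 0%R j| <= lim j)%N].
pose G (e : box d M) := \prod_(l | l \notin B) g l `|pt e 0%R l|%N.
have G0 e : 0 <= G e by apply: prodr_ge0.
have okz e : ok (zero_out B e) = ok e.
  apply: eq_forallb => j; case: (boolP (j \in D)) => //= jD.
  by rewrite pt_zero_out// DB.
have Gz e : G (zero_out B e) = G e.
  by apply: eq_bigr => j jB; rewrite pt_zero_out.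
have agz e y : agree A y (v - pt (zero_out B e)) = agree A y (v - pt e).
  apply: eq_forallb => j; case: (boolP (j \in A)) => //= jA.
  by rewrite !mxE ffunE (negbTE (AB _ jA)).
pose F (e : box d M) y : R := (ok e)%:R * G e * (agree A y (v - pt e))%:R.
have F0 e y : 0 <= F e y by rewrite !mulr_ge0.
have -> : \sum_e (ok e)%:R * G e * Ex (@pt d M) w m (fun y => (agree (A :|: B) (pt e + y) v)%:R) =
  Ex (@pt d M) w m (fun y => \sum_e F e y * (agree B (pt e) (v - y))%:R).
  rewrite Ex_sum; apply: eq_bigr => e _; rewrite -ExZ; congr Ex; apply/funext => y.
  by rewrite /F agreeU agree_addl (addrC (pt e) y) agree_addl -mulnb natrM mulrA.
apply: (@le_trans _ _ (Ex (@pt d M) w m (fun y => \sum_(e | zero_out B e == e) F e y))).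
  apply: le_Ex => // y.
  (* For a given remaining path [y], each fibre of [zero_out] contains at most one step with the
     required coordinates in [B]. *)
  rewrite (partition_big (zero_out B) (fun e => zero_out B e == e)) /=; last first.
    by move=> e _; rewrite zero_outK.
  apply: ler_sum => e' e'z.
  rewrite (eq_bigr (fun e => F e' y * (agree B (pt e) (v - y))%:R)); last first.
    by move=> e /eqP <-; rewrite /F okz Gz agz.
  rewrite -mulr_sumr ler_piMr//.
  have [[e0 /andP[/eqP e0z e0a]]|none] := pselect (exists e, (zero_out B e == e') && agree B (pt e) (v - y)).
    rewrite (bigD1 e0) ?e0z//= big1 ?addr0 ?lern1 ?leq_b1// => e /andP[/eqP ez ne].
    suff /negbTE -> : ~~ agree B (pt e) (v - y) by [].
    apply: contra ne => /forallP ea; apply/eqP/ffunP => j.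
    have [jB|jB] := boolP (j \in B).
      have := ea j; move/forallP: e0a => /(_ j); rewrite jB /= => /eqP <- /eqP.
      by rewrite !mxE => /addIr[] /val_inj.
    by move: ez; rewrite -e0z => /ffunP/(_ j); rewrite !ffunE (negbTE jB).
  rewrite big1// => e ez; case: (boolP (agree B _ _)) => // ea.
  by exfalso; apply: none; exists e; rewrite ez.
rewrite Ex_sum.
apply: (@le_trans _ _ (\sum_(e : box d M | zero_out B e == e) G e * bound)).
  apply: ler_sum => e _; rewrite /F ExZ.
  case: (boolP (ok e)) => oke; last by rewrite !mul0r mulr_ge0.
  by rewrite mul1r ler_wpM2l//; exact: IH.
rewrite -mulr_suml mulrC ler_wpM2l//.
(* The representatives form a product set, with a single value in each coordinate of [B]; the sum
   over it becomes a product of sums. *)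
pose H l (k : 'I_(M.*2.+1)) : R := if l \in B then (k == inord M)%:R else g l `|(k : nat)%:Z - M%:Z|%N.
have H0 l k : 0 <= H l k by rewrite /H; case: ifP.
rewrite [leRHS](_ : _ = \prod_l \sum_k H l k); last first.
  rewrite [RHS](bigID (mem B)) /= [X in _ = X * _]big1 ?mul1r; last first.
    move=> l lB; rewrite (bigD1 (inord M))//= /H lB eqxx big1 ?addr0// => k /negbTE ->.
    by [].
  by apply: eq_bigr => l /negbTE lB; apply: eq_bigr => k _; rewrite /H lB.
rewrite bigA_distr_bigA /= big_mkcond /=; apply: ler_sum => e _.
case: eqP => [ez|_]; last exact: prodr_ge0.
rewrite [leRHS](bigID (mem B)) /= [X in _ <= X * _]big1 ?mul1r; last first.
  by move=> l lB; rewrite /H lB -ez ffunE lB eqxx.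
rewrite le_eqVlt; apply/orP; left; apply/eqP; apply: eq_bigr => l lB.
by rewrite /H (negbTE lB) mxE.
Qed.

End pinning.

(** * Local deviations from one-coordinate estimates *)

Section core.
Context {R : realType} {d : nat} {dO : measure_display} {Omega : measurableType dO}.
Variables (P : probability Omega R) (X : nat -> Omega -> 'rV[int]_d).
Variables (T : 'I_d -> nat -> R) (a be : nat -> 'I_d -> R) (gs : 'I_d -> bool).
Variables (h : 'I_d -> nat -> nat -> R).
Variables (P0 : nat) (CT C4 KB CL CH Hs Kh K : R).
Hypothesis a_ge1 : forall n i, 1 <= a n i.
Hypothesis T_gt0 : forall i k, 0 < T i k.
Hypothesis T_dec : forall i u v, (u <= v)%N -> T i v <= CT * T i u.
Hypothesis T_div : forall q : nat, (0 < q)%N -> exists C : R, forall i x, T i (x %/ q) <= C * T i x.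
Hypothesis P0_gt0 : (0 < P0)%N.
Hypothesis nT_le : forall i n x, (0 < n)%N -> a n i <= x%:R -> (n%:R * T i x) ^+ P0 * x%:R <= C4 * a n i.
Hypothesis nT_low : forall K : R, exists2 c : R, 0 < c & forall i n x, ~~ gs i -> (0 < n)%N ->
  x%:R <= K * a n i -> c <= n%:R * T i x.
Hypothesis be_le : forall n i, (0 < n)%N -> `|be n i| <= KB * a n i.
Hypothesis llt : forall M (A : {set 'I_d}) n m y, (0 < n)%N -> (n <= 2 * m + d + 1)%N ->
  Ex (@pt d M) (@boxw _ _ _ _ P X M) m (fun z => (agree A z y)%:R) * \prod_(j in A) a n j <= CL.
Hypothesis fuk : forall p, (0 < p)%N -> forall i, exists (q : nat) (C0 C c : R), [/\ (0 < q)%N, 0 < C, 0 < c &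
  forall M n m (x : nat) q', (0 < n)%N -> (m <= n)%N -> C0 * a n i <= x%:R -> (q <= q')%N ->
  Ex (@pt d M) (@smallw _ _ _ _ P X i M (x %/ q')) m (fun z => (x%:R / 4 <= `|(z 0 i)%:~R - m%:R * be n i|)%R%:R) <=
  C * ((n%:R * T i x) ^+ p + expR (- c * (x%:R / a n i) ^+ 2) * (gs i)%:R)].
Hypothesis local : forall i z, step_pmf P X z <= CH * T i `|z 0%R i|%N *
  \prod_j (1 + `|z 0%R j|%N%:R)^-1 * \prod_(j | j != i) h i `|z 0%R i|%N `|z 0%R j|%N.
Hypothesis h01 : forall i u v, 0 <= h i u v <= 1.
Hypothesis h_sum : forall i u M, \sum_(0 <= v < M) h i u v / (1 + v%:R) <= Hs.
Hypothesis h_dbl : forall i u u' v, (u <= u' <= 2 * u)%N -> h i u' v <= Kh * h i u v.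
Hypothesis K_ge0 : 0 <= K.

Local Notation wt M := (@boxw _ _ _ _ P X M).

Let ax (x : 'rV[int]_d) j : R := `|x 0%R j|%N%:R.

Let Dn n (A : {set 'I_d}) (x : 'rV[int]_d) : R := \prod_(j in A) (Num.max (ax x j) (a n j))^-1.

(** [Some i] claims the tail gain of coordinate [i]. [None] claims nothing, and serves when the
    removed step has already supplied the gain. *)
Let W (c : R) n (o : option 'I_d) (x : 'rV[int]_d) : R :=
  if o is Some i then n%:R * T i `|x 0%R i|%N + expR (- c * (ax x i / a n i) ^+ 2) * (gs i)%:R else 1.

Let a_gt0 n i : 0 < a n i. Proof. exact: lt_le_trans (a_ge1 n i). Qed.

Let ax_ge0 x j : 0 <= ax x j. Proof. exact: ler0n. Qed.

Let mx_gt0 n x j : 0 < Num.max (ax x j) (a n j). Proof. by rewrite lt_max a_gt0 orbT. Qed.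

Let Dn_gt0 n A x : 0 < Dn n A x. Proof. by apply: prodr_gt0 => j _; rewrite invr_gt0. Qed.

Let wt_ge0 M (e : box d M) : 0 <= wt M e. Proof. exact: step_pmf_ge0. Qed.

Let W_ge0 c n o x : 0 <= W c n o x.
Proof. by case: o => [i|] //=; rewrite addr_ge0// mulr_ge0// ?expR_ge0// ltW. Qed.

Let W_mono c c' n o x : c' <= c -> W c n o x <= W c' n o x.
Proof.
case: o => [i|] //= cc; rewrite lerD2l ler_wpM2r// ler_expR ler_wpM2r ?sqr_ge0// lerN2 //.
Qed.

Lemma nT_bounded : exists2 C : R, 1 <= C & forall i n x, (0 < n)%N -> a n i <= x%:R -> n%:R * T i x <= C.
Proof.
exists (Num.max 1 C4) => [|i n x n0 ax1]; first by rewrite le_max lexx.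
have nT0 : 0 <= n%:R * T i x by rewrite mulr_ge0// ltW.
have [h1|/ltW h1] := leP (n%:R * T i x) 1; first by rewrite le_max h1.
rewrite le_max; apply/orP; right.
have x0 : 0 < x%:R :> R by exact: lt_le_trans ax1.
have h2 : (n%:R * T i x) ^+ P0 <= C4.
  have h3 := nT_le n0 ax1.
  have C40 : 0 <= C4.
    rewrite -(pmulr_lge0 _ (a_gt0 n i)); apply: le_trans h3.
    by rewrite mulr_ge0 ?exprn_ge0// ltW.
  rewrite -(ler_pM2r x0); apply: (le_trans h3); by rewrite ler_wpM2l.
apply: le_trans h2; rewrite -[leLHS]expr1.
by apply: ler_weXn2l.
Qed.

(** When |x_i| is at most of order a_n there is nothing to gain. If [gs i] holds, n T may be
    negligible there, and the Gaussian term supplies the lower bound. *)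
Lemma W_low (Kr c : R) : 0 <= c -> exists2 c0, 0 < c0 & forall n i x, (0 < n)%N ->
  ax x i <= Kr * a n i -> c0 <= W c n (Some i) x.
Proof.
move=> c0; have [c1 c1_0 hc1] := nT_low Kr.
exists (Num.min c1 (expR (- c * Kr ^+ 2))) => [|n i x n0 xK]; first by rewrite lt_min c1_0 expR_gt0.
have nT0 : 0 <= n%:R * T i `|x 0%R i|%N by rewrite mulr_ge0// ltW.
rewrite /= ge_min; have [gi|ngi] := boolP (gs i); apply/orP; [right|left].
  rewrite mulr1 -[leLHS]add0r lerD// ler_expR !mulNr lerN2 ler_wpM2l//.
  have Kr0 : 0 <= Kr by rewrite -(pmulr_lge0 _ (a_gt0 n i)); exact: le_trans xK.
  by apply: lerXn2r; rewrite ?nnegrE ?divr_ge0 ?(ltW (a_gt0 _ _))// ler_pdivrMr.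
by rewrite mulr0 addr0; apply: hc1.
Qed.

Lemma W_up : exists2 C, 1 <= C & forall c n i x, 0 <= c -> (0 < n)%N ->
  a n i <= ax x i -> W c n (Some i) x <= C.
Proof.
have [C C1 hC] := nT_bounded; exists (C + 1) => [|c n i x c0 n0 xa]; first lra.
rewrite /= lerD//; first exact: hC.
rewrite mulr_ile1 ?expR_ge0//; last by rewrite lern1 leq_b1.
by rewrite -[leRHS]expR0 ler_expR mulNr oppr_le0 mulr_ge0// sqr_ge0.
Qed.

Lemma T_half : exists2 C, 1 <= C & forall i (x y : nat), (x <= 2 * y + 1)%N -> T i y <= C * T i x.
Proof.
have [C1 hC1] := T_div (isT : (0 < 2)%N).
exists (Num.max 1 (`|CT| * `|C1|)); first by rewrite le_max lexx.
move=> i x y xy; have T0 := T_gt0 i.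
apply: (@le_trans _ _ (`|CT| * `|C1| * T i x)); last by rewrite ler_wpM2r ?(ltW (T0 _))// le_max lexx orbT.
have h1 : (x %/ 2 <= y)%N by lia.
apply: (le_trans (T_dec i h1)).
apply: (@le_trans _ _ (`|CT| * T i (x %/ 2))); first by rewrite ler_wpM2r ?(ltW (T0 _))// ler_norm.
rewrite -mulrA ler_wpM2l//; apply: (le_trans (hC1 i x)).
by rewrite ler_wpM2r ?(ltW (T0 _))// ler_norm.
Qed.

(** The removed step at most halves the coordinate, which divides the Gaussian exponent by at most
    4. *)
Lemma W_half : exists2 C, 1 <= C & forall c n o (x z : 'rV[int]_d), 0 <= c ->
  (forall i, o = Some i -> (2 * `|z 0%R i| <= `|x 0%R i|)%N) ->
  W c n o (x - z) <= C * W (c / 4) n o x.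
Proof.
have [C C1 hC] := T_half; exists C => // c n [i|] x z c0 xz; last by rewrite /= mulr1.
rewrite /= mulrDr; have {}xz := xz i erefl.
have hx : (`|x 0%R i| <= 2 * `|(x - z)%R 0%R i|)%N.
    by move: xz; rewrite !mxE; move: (x 0 i) (z 0 i) => u v; lia.
apply: lerD.
  by rewrite mulrCA ler_wpM2l//; apply: hC; rewrite (leq_trans hx)// leq_addr.
rewrite [leRHS]mulrA ler_wpM2r//; apply: (@le_trans _ _ (1 * expR (- (c / 4) * (ax x i / a n i) ^+ 2))); last first.
  by rewrite ler_wpM2r ?expR_ge0.
rewrite mul1r ler_expR !mulNr lerN2 -mulrA ler_wpM2l//.
have : (ax x i / a n i) ^+ 2 <= (2 * (ax (x - z) i / a n i)) ^+ 2.
  apply: lerXn2r; rewrite ?nnegrE ?mulr_ge0 ?invr_ge0 ?(ltW (a_gt0 _ _))//.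
  by rewrite mulrA ler_wpM2r ?invr_ge0 ?(ltW (a_gt0 _ _))// -natrM ler_nat.
rewrite exprMn => h1; lra.
Qed.

Lemma expR_sqr_pow (c : R) (k : nat) : 0 < c -> exists2 C, 0 < C & forall r : R, 0 <= r ->
  expR (- c * r ^+ 2) * (r ^+ k) ^+ 2 <= C.
Proof.
move=> c0; exists ((k.+1%:R / c) ^+ k); first by rewrite exprn_gt0// divr_gt0.
move=> r r0; rewrite exprAC.
have h1 : c * r ^+ 2 / k.+1%:R <= expR (c * r ^+ 2 / k.+1%:R) by apply: le_trans (expR_ge1Dx _); rewrite lerDr.
have u0 : 0 <= c * r ^+ 2 by rewrite mulr_ge0 ?sqr_ge0// ltW.
have h2 : (c * r ^+ 2 / k.+1%:R) ^+ k <= expR (c * r ^+ 2).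
  apply: (@le_trans _ _ (expR (c * r ^+ 2 / k.+1%:R) ^+ k)).
    by apply: lerXn2r; rewrite ?nnegrE ?expR_ge0// divr_ge0.
  rewrite -expRM_natl ler_expR mulrCA ler_piMr//.
  by rewrite ler_pdivrMr// mul1r ler_nat.
have -> : (r ^+ 2) ^+ k = (k.+1%:R / c) ^+ k * (c * r ^+ 2 / k.+1%:R) ^+ k.
  by rewrite -exprMn; congr (_ ^+ _); field; rewrite (gt_eqF c0) nat1r pnatr_eq0.
rewrite mulrCA ler_piMr ?exprn_ge0 ?divr_ge0 ?(ltW c0)//.
rewrite mulNr expRN mulrC ler_pdivrMr ?expR_gt0//; rewrite mul1r; exact: h2.
Qed.

(** Since (n T)^P0 <= C4 a / x, this power of n T is at most a constant times (a / x)^(2 (d +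
    1)). *)
Let pw := (2 * P0 * d.+1)%N.

(** The right-hand side of the Fuk-Nagaev inequality at the power [pw]. *)
Let E (c : R) n j (x : 'rV[int]_d) : R := (n%:R * T j `|x 0%R j|%N) ^+ pw + expR (- c * (ax x j / a n j) ^+ 2) * (gs j)%:R.

Let E_ge0 c n j x : 0 <= E c n j x.
Proof. by rewrite addr_ge0 ?mulr_ge0 ?expR_ge0// exprn_ge0// mulr_ge0// ltW. Qed.

Lemma E_small (c : R) : 0 < c -> exists2 C, 0 < C & forall n j x, (0 < n)%N -> a n j <= ax x j ->
  E c n j x * ((ax x j / a n j) ^+ d.+1) ^+ 2 <= C.
Proof.
move=> c0; have [Ce Ce0 hCe] := expR_sqr_pow d.+1 c0.
exists ((`|C4| ^+ d.+1) ^+ 2 + Ce) => [|n j x n0 xa]; first by rewrite ltr_wpDl// exprn_ge0// exprn_ge0.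
have nT0 : 0 <= n%:R * T j `|x 0%R j|%N by rewrite mulr_ge0// ltW.
rewrite mulrDl; apply: lerD.
  rewrite /pw (_ : (2 * P0 * d.+1)%N = (P0 * d.+1 * 2)%N); last lia.
  rewrite !exprM -!exprMn; apply: lerXn2r; rewrite ?nnegrE ?exprn_ge0// ?mulr_ge0 ?exprn_ge0 ?invr_ge0 ?(ltW (a_gt0 _ _))//.
  apply: lerXn2r; rewrite ?nnegrE ?mulr_ge0 ?exprn_ge0 ?invr_ge0 ?(ltW (a_gt0 _ _))//.
  rewrite mulrA ler_pdivrMr//; apply: (le_trans (nT_le n0 xa)).
  by rewrite ler_wpM2r ?(ltW (a_gt0 _ _))// ler_norm.
apply: le_trans (hCe (ax x j / a n j) _); last by rewrite divr_ge0// ltW.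
rewrite ler_wpM2r ?exprn_ge0// ?exprn_ge0// ?divr_ge0 ?(ltW (a_gt0 _ _))//.
by rewrite ler_piMr ?expR_ge0// lern1 leq_b1.
Qed.

Lemma E_W (c : R) : 0 < c -> exists2 C, 0 < C & forall n j x, (0 < n)%N -> a n j <= ax x j ->
  E c n j x <= C * W (c / 2) n (Some j) x ^+ 2.
Proof.
move=> c0; have [CN CN1 hCN] := nT_bounded.
have CN0 : 0 <= CN by exact: le_trans CN1.
exists (CN ^+ pw) => [|n j x n0 xa]; first by rewrite exprn_gt0// (lt_le_trans _ CN1).
have pw2 : (2 <= pw)%N by rewrite /pw; nia.
have nT0 : 0 <= n%:R * T j `|x 0%R j|%N by rewrite mulr_ge0// ltW.
have CNp : 1 <= CN ^+ pw by rewrite exprn_ege1.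
set u := n%:R * T j `|x 0%R j|%N.
have hu : u ^+ pw <= CN ^+ pw * u ^+ 2.
  rewrite -(subnK pw2) exprD; apply: ler_wpM2r; first exact: sqr_ge0.
  apply: (@le_trans _ _ (CN ^+ (pw - 2))); last by rewrite ler_weXn2l// leq_addr.
  by apply: lerXn2r; rewrite ?nnegrE//; exact: hCN.
rewrite /E /= -/u; set v := expR _; set v' := expR _.
have hv : v = v' ^+ 2.
  by rewrite /v' -expRM_natl; congr expR; field; rewrite gt_eqF.
apply: (le_trans (lerD hu (lexx _))).
rewrite sqrrD !mulrDr; have v'0 : 0 <= v' by exact: expR_ge0.
have -> : (v' * (gs j)%:R) ^+ 2 = v * (gs j)%:R by rewrite hv exprMn; case: (gs j); rewrite ?expr1n ?expr0n.
have h3 : v * (gs j)%:R <= CN ^+ pw * (v * (gs j)%:R) by rewrite ler_peMl// mulr_ge0// expR_ge0.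
have h4 : 0 <= CN ^+ pw * (u * (v' * (gs j)%:R) *+ 2) by rewrite mulr_ge0 ?exprn_ge0// mulrn_wge0// mulr_ge0// mulr_ge0.
lra.
Qed.

Lemma fuk_unif : exists (q : nat) (C0 C c : R), [/\ (2 <= q)%N, 1 <= C0, 0 < C, 0 < c &
  forall M n m (x : nat) i, (0 < n)%N -> (m <= n)%N -> C0 * a n i <= x%:R ->
  Ex (@pt d M) (@smallw _ _ _ _ P X i M (x %/ q)) m (fun z => (x%:R / 4 <= `|(z 0 i)%:~R - m%:R * be n i|)%R%:R) <=
  C * ((n%:R * T i x) ^+ pw + expR (- c * (x%:R / a n i) ^+ 2) * (gs i)%:R)].
Proof.
have pw0 : (0 < pw)%N by rewrite /pw; nia.
have /choice[q /choice[C0 /choice[C /choice[c hF]]]] := fuk pw0.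
have C_gt0 i : 0 < C i by have [] := hF i.
have c_gt0 i : 0 < c i by have [] := hF i.
exists (maxn 2 (\max_i q i)), (1 + \sum_i `|C0 i|), (1 + \sum_i C i), (1 + \sum_i (c i)^-1)^-1.
have s0 : 0 <= \sum_i (c i)^-1 by rewrite sumr_ge0// => i _; rewrite invr_ge0 ltW.
have sC0 : 0 <= \sum_i C i by rewrite sumr_ge0// => i _; rewrite ltW.
split; first by rewrite leq_maxl.
- by rewrite lerDl sumr_ge0.
- by rewrite ltr_wpDr.
- by rewrite invr_gt0 ltr_wpDr.
move=> M n m x i n0 mn xa.
have [q0 _ _ h1] := hF i.
apply: (le_trans (h1 M n m x (maxn 2 (\max_j q j)) n0 mn _ _)).
- apply: le_trans xa; rewrite ler_wpM2r ?(ltW (a_gt0 _ _))// (bigD1 i)//=.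
  have := ler_norm (C0 i); have : 0 <= \sum_(j | j != i) `|C0 j| by rewrite sumr_ge0.
  lra.
- by rewrite leq_max leq_bigmax orbT.
have e0 t : 0 <= (n%:R * T i x) ^+ pw + expR t * (gs i)%:R.
  by rewrite addr_ge0 ?exprn_ge0 ?mulr_ge0 ?expR_ge0 ?(ltW (T_gt0 _ _)).
apply: ler_pM => //; first exact: ltW.
  rewrite (bigD1 i)//=; have : 0 <= \sum_(j | j != i) C j by rewrite sumr_ge0// => j _; rewrite ltW.
  lra.
rewrite lerD2l ler_wpM2r// ler_expR !mulNr lerN2 ler_wpM2r ?sqr_ge0//.
rewrite -[leRHS]invrK lef_pV2 ?posrE ?invr_gt0 ?ltr_wpDr//.
rewrite (bigD1 i)//=; have : 0 <= \sum_(j | j != i) (c j)^-1 by rewrite sumr_ge0// => j _; rewrite invr_ge0 ltW.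
lra.
Qed.

Let CL_ge0 : 0 <= CL.
Proof.
have h1 : (1 <= 2 * 0 + d + 1)%N by rewrite addn1.
have := @llt 0 (@finset.set0 _) 1 0 0 isT h1; apply: le_trans.
by rewrite mulr_ge0 ?prodr_ge0//= => j _; rewrite ltW.
Qed.

(** The tolerance, of the order of the scale, absorbs integer parts and changes of the centring
    constants. *)
Definition centred n (b : 'rV[int]_d) : Prop :=
  forall j, `|(b 0 j)%:~R - n%:R * be n j| <= K * a n j.

Let J C0 n (A : {set 'I_d}) x := [set j in A | C0 * a n j < ax x j].

Let small q (B : {set 'I_d}) (x z : 'rV[int]_d) := [forall j in B, (`|z 0%R j| <= `|x 0%R j| %/ q)%N].

(** x_j is the sum of the two deviations up to the centring error and the drift of at most d missing
    steps; the choice of [C0] keeps these errors below |x_j| / 2. *)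
Lemma split_deviation (C0 : R) n m m1 m2 j (b x y1 y2 : 'rV[int]_d) : 2 * (K + d%:R * `|KB|) <= C0 ->
  (0 < n)%N -> (m1 + m2 = m)%N -> (m <= n <= m + d)%N -> centred n b -> C0 * a n j < ax x j ->
  (y1 + y2) 0 j = (x + b) 0 j ->
  (ax x j / 4 <= `|(y1 0 j)%:~R - m1%:R * be n j|) || (ax x j / 4 <= `|(y2 0 j)%:~R - m2%:R * be n j|).
Proof.
move=> hC0 n0 mE /andP[mn nm] /(_ j) hb xj; rewrite !mxE => yE.
case: leP => //= h1; case: leP => // h2; exfalso.
have E1 : (y1 0 j)%:~R + (y2 0 j)%:~R = (x 0 j)%:~R + (b 0 j)%:~R :> R by rewrite -!intrD yE.
have hx : ax x j = `|(x 0 j)%:~R|.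
  by rewrite -intr_norm -[`|_|]abszE -pmulrn.
have hd : n%:R - m%:R <= d%:R :> R by rewrite lerBlDl -natrD ler_nat.
have hnm : 0 <= n%:R - m%:R :> R by rewrite subr_ge0 ler_nat.
have hbe := be_le j n0.
have h3 : `|(n%:R - m%:R) * be n j| <= d%:R * `|KB| * a n j.
  rewrite normrM ger0_norm// -mulrA; apply: ler_pM => //.
  by apply: (le_trans hbe); rewrite ler_wpM2r ?(ltW (a_gt0 _ _))// ler_norm.
have h4 : ax x j <= `|(y1 0 j)%:~R - m1%:R * be n j| + `|(y2 0 j)%:~R - m2%:R * be n j|
   + `|(b 0 j)%:~R - n%:R * be n j| + `|(n%:R - m%:R) * be n j|.
  rewrite hx (_ : (x 0 j)%:~R = ((y1 0 j)%:~R - m1%:R * be n j) + ((y2 0 j)%:~R - m2%:R * be n j)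
   - ((b 0 j)%:~R - n%:R * be n j) - ((n%:R - m%:R) * be n j) :> R); last first.
    have -> : (x 0 j)%:~R = (y1 0 j)%:~R + (y2 0 j)%:~R - (b 0 j)%:~R :> R by rewrite E1 addrK.
    by rewrite -mE natrD; ring.
  apply: (le_trans (ler_normB _ _)); rewrite lerD2r.
  apply: (le_trans (ler_normB _ _)); rewrite lerD2r.
  exact: ler_normD.
have h5 : 2 * (K + d%:R * `|KB|) * a n j <= C0 * a n j by rewrite ler_wpM2r// ltW.
lra.
Qed.

(* Let Q be the probability to bound times the product of the a_n.  Splitting the path in two halves gives
   Q <= B E_j for every large coordinate j, hence Q^2 <= B^2 E_i E_l where l has the largest ratio r_l = |x_l| / a_l:
   the factor E_l = O(r_l^(-2(d+1))) pays for the product of the ratios, and E_i = O(W_i^2). *)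
Lemma small_part : exists (q : nat) (C0 C c : R), [/\ (2 <= q)%N, 1 <= C0, 0 < C, 0 < c &
  forall M (A : {set 'I_d}) i n m b x, i \in A -> (0 < n)%N -> (m <= n <= m + d)%N -> centred n b ->
  C0 * a n i < ax x i ->
  Ex (@pt d M) (fun e => wt M e * (small q (J C0 n A x) x (pt e))%:R) m (fun y => (agree A y (x + b))%:R) <=
  C * Dn n A x * W c n (Some i) x].
Proof.
have [q [C1 [C [c [q2 C11 C_0 c0 hfuk]]]]] := fuk_unif.
pose C0 := Num.max C1 (2 * (K + d%:R * `|KB|)).
have C01 : 1 <= C0 by rewrite le_max C11.
have C00 : 0 <= C0 by exact: le_trans C01.
have [Ce Ce0 hCe] := E_small c0.
have [Cw Cw0 hCw] := E_W c0.
pose B := 2 * C * CL.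
have B0 : 0 <= B by rewrite !mulr_ge0// ltW.
pose C' := (1 + B * Num.sqrt (Ce * Cw)) * C0 ^+ d.
exists q, C0, C', (c / 2); split=> //.
- by rewrite mulr_gt0 ?exprn_gt0 ?(lt_le_trans _ C01)// ltr_wpDr// mulr_ge0// sqrtr_ge0.
- by rewrite divr_gt0.
move=> M A i n m b x iA n0 /andP[mn nm] hb xi.
set w' := fun e => _; set v := x + b.
have w'0 e : 0 <= w' e <= wt M e by rewrite mulr_ge0//= ler_piMr// lern1 leq_b1.
have w'1 e : 0 <= w' e by case/andP: (w'0 e).
pose pa := \prod_(j in A) a n j.
have pa0 : 0 < pa by apply: prodr_gt0.
have pick_j j : j \in J C0 n A x ->
  Ex (@pt d M) w' m (fun y => (agree A y v)%:R) * pa <= B * E c n j x.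
  rewrite inE => /andP[jA xj].
  pose dev m' (y : 'rV[int]_d) := (ax x j / 4 <= `|(y 0 j)%:~R - m'%:R * be n j|).
  have hD m' : (m' <= n)%N -> Ex (@pt d M) w' m' (fun y => (dev m' y)%:R) <= C * E c n j x.
    move=> mn'; apply: le_trans (hfuk M n m' `|x 0%R j|%N j n0 mn' _); last first.
      by apply: le_trans (ltW xj); rewrite ler_wpM2r ?(ltW (a_gt0 _ _))// le_max lexx.
    apply: le_Ex_weight => [e|y]; last by [].
    rewrite w'1 /w' /smallw ler_wpM2l// ler_nat.
    case: (boolP (small _ _ _ _)) => // /forallP/(_ j).
    by rewrite inE jA xj /= => ->.
  have hL m' u : (n <= 2 * m' + d + 1)%N -> Ex (@pt d M) w' m' (fun y => (agree A y u)%:R) <= CL / pa.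
    move=> nm'; rewrite ler_pdivlMr//; apply: le_trans (llt M A u n0 nm').
    by rewrite ler_wpM2r ?(ltW pa0)// le_Ex_weight.
  (* Both halves m' satisfy n <= 2 m' + d + 1, as the local bound at the scale of time n
     requires. *)
  pose m1 := m./2; pose m2 := uphalf m.
  have mE : (m1 + m2 = m)%N by rewrite /m1 /m2 uphalf_half addnCA addnn odd_double_half.
  have nm1 : (n <= 2 * m1 + d + 1)%N.
    rewrite (leq_trans nm)// addnAC leq_add2r /m1 mul2n -{1}(odd_double_half m) addnC leq_add2l.
    by case: (odd m).
  have nm2 : (n <= 2 * m2 + d + 1)%N.
    rewrite (leq_trans nm)// -addnA leq_add ?leq_addr//.
    by rewrite -{1}mE mul2n -addnn leq_add2r /m2 uphalf_half leq_addl.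
  rewrite -mE Ex_add.
  apply: (@le_trans _ _ ((Ex (@pt d M) w' m1 (fun y1 => (dev m1 y1)%:R * (CL / pa)) +
     Ex (@pt d M) w' m2 (fun y2 => (dev m2 y2)%:R * (CL / pa))) * pa)).
    rewrite ler_wpM2r ?(ltW pa0)//.
    apply: (@le_trans _ _ (Ex (@pt d M) w' m1 (fun y1 => (dev m1 y1)%:R * Ex (@pt d M) w' m2 (fun y2 => (agree A (y1 + y2) v)%:R)) +
      Ex (@pt d M) w' m1 (fun y1 => Ex (@pt d M) w' m2 (fun y2 => (dev m2 y2)%:R * (agree A (y1 + y2) v)%:R)))).
      rewrite -ExD; apply: le_Ex => // y1; rewrite -ExZ -ExD; apply: le_Ex => // y2.
      case: (boolP (agree A _ _)) => [ag|_]; last by rewrite !mulr0 addr0.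
      rewrite !mulr1; have yE : (y1 + y2) 0 j = (x + b) 0 j.
        by have /forallP/(_ j) := ag; rewrite jA => /eqP.
      have mn' : (m <= n <= m + d)%N by rewrite mn nm.
      have := @split_deviation C0 n m m1 m2 j b x y1 y2 _ n0 mE mn' hb xj yE.
      rewrite -/(dev m1 y1) -/(dev m2 y2) le_max lexx orbT => /(_ isT).
      by case: (dev m1 y1) => /=; [rewrite lerDl|move=> ->; rewrite lerDr].
    apply: lerD.
      apply: le_Ex => // y1; apply: ler_wpM2l => //.
      under eq_fun do rewrite agree_addl; exact: hL.
    (* The deviating half is moved outside, so that the local bound applies to the other half with
       its target fixed. *)
    rewrite Ex_swap; apply: le_Ex => // y2; rewrite ExZ; apply: ler_wpM2l => //.
    by under eq_fun do rewrite addrC agree_addl; exact: hL.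
  under eq_fun do rewrite mulrC.
  under [in X in _ + X]eq_fun do rewrite mulrC.
  rewrite !ExZ -mulrDr mulrAC divfK ?gt_eqF// /B.
  have mm1 : (m1 <= n)%N by rewrite (leq_trans _ mn)// -mE leq_addr.
  have mm2 : (m2 <= n)%N by rewrite (leq_trans _ mn)// -mE leq_addl.
  have := lerD (hD m1 mm1) (hD m2 mm2).
  move=> /(ler_wpM2l CL_ge0) /le_trans; apply; rewrite le_eqVlt; apply/orP; left; apply/eqP; ring.
set Q := Ex _ _ _ _ in pick_j *.
have Q0 : 0 <= Q by apply: Ex_ge0.
have iJ : i \in J C0 n A x by rewrite inE iA.
have rr j : j \in J C0 n A x -> a n j <= ax x j.
  by rewrite inE => /andP[_ /ltW]; apply: le_trans; rewrite ler_peMl// ltW.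
have Wi0 := W_ge0 (c / 2) n (Some i) x.
have hj j : j \in J C0 n A x -> Q * pa * (ax x j / a n j) ^+ d.+1 <= B * Num.sqrt (Ce * Cw) * W (c / 2) n (Some i) x.
  move=> jJ; have h1 := pick_j j jJ; have h2 := pick_j i iJ.
  have r0 : 0 <= ax x j / a n j by rewrite divr_ge0// ltW.
  rewrite -(@ler_pXn2r _ 2%N) ?nnegrE ?mulr_ge0 ?exprn_ge0 ?(ltW pa0) ?(ltW C_0) ?sqrtr_ge0//.
  rewrite exprMn [leRHS]exprMn [in leRHS]exprMn sqr_sqrtr ?mulr_ge0 ?(ltW Ce0) ?(ltW Cw0)//.
  have h3 : (Q * pa) ^+ 2 <= B ^+ 2 * (E c n i x * E c n j x).
    rewrite expr2; apply: (@le_trans _ _ ((B * E c n i x) * (B * E c n j x))).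
      by apply: ler_pM => //; rewrite mulr_ge0// ltW.
    by rewrite le_eqVlt; apply/orP; left; apply/eqP; ring.
  apply: (le_trans (ler_wpM2r _ h3)); first by rewrite exprn_ge0// exprn_ge0.
  rewrite -(mulrA (B ^+ 2)) -[leRHS](mulrA (B ^+ 2)); apply: ler_wpM2l; first exact: sqr_ge0.
  have h4 := hCe n j x n0 (rr j jJ); have h5 := hCw n i x n0 (rr i iJ).
  rewrite [leLHS]mulrAC [leLHS]mulrC -[leRHS]mulrA; set u := _ ^+ 2.
  have -> : E c n j x * (E c n i x * u) = E c n j x * u * E c n i x by ring.
  apply: ler_pM => //; by rewrite mulr_ge0// exprn_ge0// exprn_ge0.
have [l lJ hl] : exists2 l, l \in J C0 n A x & forall j, j \in J C0 n A x -> ax x j / a n j <= ax x l / a n l.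
  case: (@arg_maxP _ R _ i (mem (J C0 n A x)) (fun j => ax x j / a n j) iJ) => l lJ hl.
  by exists l.
have rl1 : 1 <= ax x l / a n l by rewrite ler_pdivlMr// mul1r rr.
(* Every ratio max(|x_j|, a_j) / a_j is at most [C0] times the largest one, so d powers of r_l pay
   for the whole product. *)
have hprod : pa^-1 * (C0 ^+ d * (ax x l / a n l) ^+ d)^-1 <= Dn n A x.
  rewrite -invfM /Dn prodfV lef_pV2 ?posrE; last 2 first.
  - by rewrite !mulr_gt0 ?exprn_gt0 ?(lt_le_trans _ C01) ?(lt_le_trans _ rl1).
  - by apply: prodr_gt0.
  have -> : \prod_(j in A) Num.max (ax x j) (a n j) = pa * \prod_(j in A) (Num.max (ax x j) (a n j) / a n j).
    rewrite -big_split /=; apply: eq_bigr => k _; by rewrite mulrCA divff ?mulr1 ?gt_eqF.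
  rewrite ler_wpM2l ?(ltW pa0)// -exprMn.
  apply: (@le_trans _ _ (\prod_(j in A) (C0 * (ax x l / a n l)))).
    apply: ler_prod => j jA; rewrite divr_ge0 ?(ltW (mx_gt0 _ _ _)) ?(ltW (a_gt0 _ _))//=.
    rewrite ler_pdivrMr// ge_max; apply/andP; split; last first.
      by rewrite ler_peMl ?(ltW (a_gt0 _ _))// mulr_ege1.
    have [jJ|jJ] := boolP (j \in J C0 n A x).
      have := hl j jJ; rewrite ler_pdivrMr// => /le_trans; apply.
      by rewrite ler_wpM2r ?(ltW (a_gt0 _ _))// ler_peMl// (le_trans _ rl1).
    move: jJ; rewrite inE jA /= -leNgt => /le_trans; apply.
    by rewrite ler_wpM2r ?(ltW (a_gt0 _ _))// ler_peMr.
  rewrite prodr_const; apply: ler_weXn2l; first by rewrite mulr_ege1.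
  by rewrite -[leqRHS]card_ord; exact: max_card.
have h6 := hj l lJ.
have rl0 : 0 < ax x l / a n l by exact: lt_le_trans rl1.
have h7 : Q * pa * (ax x l / a n l) ^+ d <= (1 + B * Num.sqrt (Ce * Cw)) * W (c / 2) n (Some i) x.
  apply: (@le_trans _ _ (Q * pa * (ax x l / a n l) ^+ d.+1)).
    by rewrite ler_wpM2l ?mulr_ge0 ?(ltW pa0)// ler_weXn2l.
  by apply: (le_trans h6); rewrite ler_wpM2r// lerDr.
apply: (@le_trans _ _ ((1 + B * Num.sqrt (Ce * Cw)) * W (c / 2) n (Some i) x * C0 ^+ d *
   (pa^-1 * (C0 ^+ d * (ax x l / a n l) ^+ d)^-1))).
  have -> : Q = (Q * pa * (ax x l / a n l) ^+ d) * C0 ^+ d * (pa^-1 * (C0 ^+ d * (ax x l / a n l) ^+ d)^-1).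
    rewrite invfM; set u := _ ^+ d; set u' := C0 ^+ d.
    have u0 : u != 0 by rewrite gt_eqF// exprn_gt0.
    have u'0 : u' != 0 by rewrite gt_eqF// exprn_gt0// (lt_le_trans _ C01).
    by field; rewrite u0 u'0 (gt_eqF pa0).
  rewrite ler_wpM2r ?mulr_ge0 ?invr_ge0 ?mulr_ge0 ?exprn_ge0 ?(ltW pa0) ?(ltW rl0)//.
  by rewrite ler_wpM2r ?exprn_ge0.
rewrite [leRHS]mulrAC [C' * _]mulrAC ler_wpM2l//.
apply: mulr_ge0; last exact: exprn_ge0.
by apply: mulr_ge0 => //; rewrite addr_ge0// mulr_ge0// sqrtr_ge0.
Qed.

(** The path has [m] steps but all scales are those of time [n]: the lag d - |A| counts the steps
    that may have been removed, each removal freeing at least one coordinate. *)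
Let prescribed (k : nat) : Prop := exists (C c : R), [/\ 0 < C, 0 < c &
  forall M (A : {set 'I_d}) o n m b x, (#|A| <= k)%N -> (forall i, o = Some i -> i \in A) ->
  (0 < n)%N -> (m <= n <= m + (d - #|A|))%N -> centred n b ->
  Ex (@pt d M) (wt M) m (fun y => (agree A y (x + b))%:R) <= C * Dn n A x * W c n o x].

(** In the coordinates of [D] the shift at most halves |x_j|; in the others max(|x_j|, a_j) is a_j
    up to the factor [C0], wherever the shift leads. *)
Lemma Dn_near (C0 : R) q n (A D : {set 'I_d}) (x z : 'rV[int]_d) : 1 <= C0 -> (2 <= q)%N ->
  (forall j, j \in A -> C0 * a n j < ax x j -> j \in D) -> small q D x z ->
  Dn n A (x - z) <= (2 * C0) ^+ d * Dn n A x.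
Proof.
move=> C01 q2 hD /forallP sm.
have C00 : 0 < C0 by exact: lt_le_trans C01.
apply: (@le_trans _ _ (\prod_(j in A) (2 * C0 * (Num.max (ax x j) (a n j))^-1))).
  apply: ler_prod => j jA; rewrite invr_ge0 (ltW (mx_gt0 _ _ _))/=.
  rewrite -[leRHS]invrK lef_pV2 ?posrE ?invr_gt0 ?mulr_gt0 ?invr_gt0//.
  rewrite invfM invrK ler_pdivrMl ?mulr_gt0// ge_max; apply/andP; split; last first.
    rewrite -[leLHS]mul1r; apply: ler_pM => //; rewrite ?(ltW (a_gt0 _ _)) ?le_max ?lexx ?orbT//; lra.
  have [xj|xj] := leP (ax x j) (C0 * a n j).
    apply: (le_trans xj); apply: ler_pM; rewrite ?(ltW (a_gt0 _ _)) ?(ltW C00) ?le_max ?lexx ?orbT//; lra.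
  have := sm j; rewrite (hD _ jA xj) /= => zj.
  apply: (@le_trans _ _ (2 * ax (x - z) j)); last first.
    by apply: ler_pM => //; [lra|rewrite le_max lexx].
  rewrite -natrM ler_nat !mxE.
  have : (`|x 0%R j| %/ q <= `|x 0%R j| %/ 2)%N by apply: leq_div2l.
  by move: zj; move: (x 0 j) (z 0 j) => u v; lia.
rewrite big_split /= prodr_const ler_wpM2r ?(ltW (Dn_gt0 _ _ _))// ler_weXn2l//; first lra.
by rewrite -[leqRHS]card_ord; exact: max_card.
Qed.

(** The large steps are classified by this set, the J' of the overview. *)
Let Bof q C0 n A (x z : 'rV[int]_d) := [set j in J C0 n A x | (`|x 0%R j| %/ q < `|z 0%R j|)%N].

(** The maximum with 1 lets a power with at most d factors be replaced by the power d. *)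
Lemma h_sum_le i u M : \sum_(k < M.*2.+1) (h i u `|(k : nat)%:Z - M%:Z|%N / (1 + `|(k : nat)%:Z - M%:Z|%N%:R))
   <= Num.max 1 (2 * Hs).
Proof.
rewrite le_max; apply/orP; right.
have h0 v : 0 <= h i u v / (1 + v%:R) by rewrite divr_ge0//; case/andP: (h01 i u v).
apply: (le_trans (@sum_symm_le _ (fun v => h i u v / (1 + v%:R)) M h0)).
by rewrite ler_wpM2l.
Qed.

(** (H) is used with the coordinate [t] of [B]. As |z_t| >= |x_t| / q, the tail T_t(z_t) is at most
    a constant times T_t(x_t). On the dyadic scale s of z_t the factor 1 / (1 + |z_t|) is of order
    2^(-s) / |x_t|, and 2^(-s) makes the sum over scales converge. By condition (iii), h may be
    evaluated at the bottom of the scale: the weight no longer depends on z_t, and the remaining sum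
    is of product form. *)
Lemma step_weight (q : nat) : (2 <= q)%N -> exists2 C, 0 < C &
  forall (C0 : R) M (e : box d M) n (A B : {set 'I_d}) (t : 'I_d) x, 1 <= C0 ->
  Bof q C0 n A x (pt e) = B -> t \in B -> exists2 s, (s < M.+1)%N &
  wt M e <= C * T t `|x 0%R t|%N * (2 ^+ s)^-1 * (\prod_(j in B) (Num.max (ax x j) (a n j))^-1) *
    \prod_(j | j \notin B) (h t (2 ^ s * (`|x 0%R t| %/ q).+1)%N `|pt e 0%R j|%N / (1 + `|pt e 0%R j|%N%:R)).
Proof.
move=> q2; have q0 : (0 < q)%N by lia.
have [Cq hCq] := T_div q0.
pose Kh' := Num.max 1 Kh; have Kh'1 : 1 <= Kh' by rewrite le_max lexx.
have Kh'0 : 0 <= Kh' by exact: le_trans Kh'1.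
exists ((1 + `|CH|) * (`|CT| * `|Cq|) * q%:R ^+ d * Kh' ^+ d + 1) => [|C0 M e n A B t x C01 eB tB].
  by rewrite ltr_wpDl// !mulr_ge0 ?exprn_ge0// addr_ge0.
have C00 : 0 < C0 by exact: lt_le_trans C01.
have inB j : j \in B -> C0 * a n j < ax x j /\ (`|x 0%R j| %/ q < `|pt e 0%R j|)%N.
  by rewrite -eB !inE => /andP[/andP[_ ->] ->].
pose u0 := (`|x 0%R t| %/ q).+1.
have et : (u0 <= `|pt e 0%R t|)%N by case: (inB t tB).
(* Dyadic scale: 2^s u0 <= |z_t| <= 2 (2^s u0), the range in which condition (iii) compares the
   values of h. *)
pose s := trunc_log 2 (`|pt e 0%R t| %/ u0).
have e0 : (0 < `|pt e 0%R t| %/ u0)%N by rewrite divn_gt0.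
have sl : (2 ^ s * u0 <= `|pt e 0%R t|)%N.
  by rewrite -leq_divRL//; exact: trunc_logP.
have su : (`|pt e 0%R t| <= 2 * (2 ^ s * u0))%N.
  rewrite mulnA -expnS ltnW// -ltn_divLR//; exact: trunc_log_ltn.
have eM : (`|pt e 0%R t| <= M)%N by have /forallP := inbox_pt e; apply.
exists s; first by rewrite ltnS (leq_trans _ eM)// (leq_trans _ sl)// (leq_trans (ltnW (ltn_expl s (isT : 1 < 2)%N)))// leq_pmulr.
have x_gt0 j : j \in B -> 0 < ax x j.
  by case/inB => xj _; apply: le_lt_trans xj; rewrite mulr_ge0 ?ltW.
have mxE' j : j \in B -> Num.max (ax x j) (a n j) = ax x j.
  case/inB => xj _; apply/max_idPl; apply: le_trans (ltW xj); rewrite ler_peMl// ltW//.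
have hq j u : j \in B -> (`|x 0%R j| %/ q < u)%N -> ax x j <= q%:R * u%:R.
  by move=> jB hu; rewrite -natrM ler_nat mulnC ltnW// -ltn_divLR.
apply: (le_trans (local t (pt e))).
have prod1 : \prod_j (1 + `|pt e 0%R j|%N%:R)^-1 <= (q%:R ^+ d * (2 ^+ s)^-1 *
   \prod_(j in B) (Num.max (ax x j) (a n j))^-1) * \prod_(j | j \notin B) (1 + `|pt e 0%R j|%N%:R : R)^-1.
  rewrite (bigID (mem B)) /=; apply: ler_wpM2r; first by apply: prodr_ge0 => j _; rewrite invr_ge0 addr_ge0.
  rewrite (bigD1 t)//= [X in _ <= _ * X](bigD1 t)//=.
  apply: (@le_trans _ _ ((q%:R * (2 ^+ s)^-1 * (ax x t)^-1) * \prod_(j in B | j != t) (q%:R * (Num.max (ax x j) (a n j))^-1))).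
    apply: ler_pM; rewrite ?prodr_ge0 ?invr_ge0 ?addr_ge0//.
    - rewrite -mulrA -invfM -[leRHS]invrK lef_pV2 ?posrE ?invr_gt0 ?divr_gt0 ?mulr_gt0 ?x_gt0 ?exprn_gt0 ?ltr0n ?ltr_wpDr//.
      rewrite invf_div ler_pdivrMr ?ltr0n// [leRHS]mulrC.
      apply: (@le_trans _ _ (2 ^+ s * (q%:R * u0%:R))); first by rewrite ler_wpM2l ?exprn_ge0// hq.
      rewrite mulrCA ler_wpM2l// -natrX -natrM.
      by rewrite (@le_trans _ _ (`|pt e 0%R t|%N%:R))// ?ler_nat// lerDr.
    apply: ler_prod => j /andP[jB _]; rewrite invr_ge0 addr_ge0//= mxE'//.
    rewrite -[leRHS]invrK lef_pV2 ?posrE ?invr_gt0 ?mulr_gt0 ?invr_gt0 ?x_gt0 ?ltr0n ?ltr_wpDr//.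
    rewrite invf_div ler_pdivrMr ?ltr0n// [leRHS]mulrC.
    have [_ ej] := inB j jB; apply: (le_trans (hq _ _ jB ej)).
    by rewrite ler_wpM2l// lerDr.
  rewrite big_split /= prodr_const mxE'//.
  set c1 := #|_|; have c1d : (c1.+1 <= d)%N.
    rewrite /c1 -[leqRHS](card_ord d).
    rewrite (leq_trans _ (max_card (mem B)))// (cardsD1 t) tB add1n ltnS.
    by rewrite (eq_card (B := mem (B :\ t))) // => j; rewrite !inE unfold_in andbC.
  set X1 := \prod_(_ in B | _) _.
  have X10 : 0 <= X1 by rewrite prodr_ge0// => j _; rewrite invr_ge0 ltW.
  have -> : q%:R * (2 ^+ s)^-1 * (ax x t)^-1 * (q%:R ^+ c1 * X1) = q%:R ^+ c1.+1 * (2 ^+ s)^-1 * ((ax x t)^-1 * X1).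
    by rewrite exprS; ring.
  rewrite ler_wpM2r ?mulr_ge0 ?invr_ge0// ler_wpM2r ?invr_ge0 ?exprn_ge0// ler_weXn2l// ler1n//.
have prod2 : \prod_(j | j != t) h t `|pt e 0%R t|%N `|pt e 0%R j|%N <=
   Kh' ^+ d * \prod_(j | j \notin B) h t (2 ^ s * u0)%N `|pt e 0%R j|%N.
  have hh u v : 0 <= h t u v <= 1 by exact: h01.
  have hh0 u v : 0 <= h t u v by case/andP: (h01 t u v).
  rewrite (bigID (fun j => j \notin B)) /=.
  apply: (@le_trans _ _ (\prod_(j | j \notin B) (Kh' * h t (2 ^ s * u0)%N `|pt e 0%R j|%N) * 1)).
    apply: ler_pM; rewrite ?prodr_ge0//; last by apply: prodr_ile1 => j _.
    rewrite [leLHS](eq_bigl (fun j => j \notin B)); last first.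
      by move=> j; have [->|] := eqVneq j t; rewrite ?tB.
    apply: ler_prod => j jB; rewrite hh0 /=.
    apply: (@le_trans _ _ (Kh * h t (2 ^ s * u0)%N `|pt e 0%R j|%N)).
      by apply: h_dbl; rewrite sl su.
    by rewrite ler_wpM2r// le_max lexx orbT.
  rewrite mulr1 big_split /= prodr_const ler_wpM2r ?prodr_ge0// ler_weXn2l//.
  by rewrite -[leqRHS]card_ord; exact: max_card.
have Tt : T t `|pt e 0%R t|%N <= `|CT| * `|Cq| * T t `|x 0%R t|%N.
  have h1 : (`|x 0%R t| %/ q <= `|pt e 0%R t|)%N by apply: ltnW.
  apply: (le_trans (T_dec t h1)).
  apply: (@le_trans _ _ (`|CT| * T t (`|x 0%R t| %/ q))); first by rewrite ler_wpM2r ?(ltW (T_gt0 _ _))// ler_norm.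
  rewrite -mulrA ler_wpM2l//; apply: (le_trans (hCq _ _)).
  by rewrite ler_wpM2r ?(ltW (T_gt0 _ _))// ler_norm.
have PB0 : 0 <= \prod_(j in B) (Num.max (ax x j) (a n j))^-1 by rewrite prodr_ge0// => j _; rewrite invr_ge0 ltW.
have T0 k : 0 <= T t k by exact: ltW.
rewrite big_split /=.
set PB := \prod_(j in B) _ in PB0 prod1 *.
set H1 := \prod_(j | j \notin B) _ in prod2 *.
set H2 := \prod_(j | j \notin B) _ in prod1 *.
have H10 : 0 <= H1 by rewrite prodr_ge0// => j _; case/andP: (h01 t (2 ^ s * u0) `|pt e 0%R j|%N).
have H20 : 0 <= H2 by rewrite prodr_ge0// => j _; rewrite invr_ge0 addr_ge0.
apply: (@le_trans _ _ ((1 + `|CH|) * (`|CT| * `|Cq| * T t `|x 0%R t|%N) * (q%:R ^+ d * (2 ^+ s)^-1 * PB * H2) * (Kh' ^+ d * H1))).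
  apply: (@le_trans _ _ ((1 + `|CH|) * T t `|pt e 0%R t|%N * \prod_j (1 + `|pt e 0%R j|%N%:R)^-1 *
    \prod_(j | j != t) h t `|pt e 0%R t|%N `|pt e 0%R j|%N)).
    rewrite ler_wpM2r ?prodr_ge0//; first by move=> j _; case/andP: (h01 t `|pt e 0%R t|%N `|pt e 0%R j|%N).
    apply: ler_wpM2r; first by apply: prodr_ge0 => j _; rewrite invr_ge0 addr_ge0.
    rewrite ler_wpM2r// (le_trans (ler_norm _))// lerDr//.
  apply: ler_pM => //.
  - rewrite !mulr_ge0 ?addr_ge0// prodr_ge0// => j _; by rewrite invr_ge0 addr_ge0.
  - by rewrite prodr_ge0// => j _; case/andP: (h01 t `|pt e 0%R t|%N `|pt e 0%R j|%N).
  apply: ler_pM => //.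
  - by rewrite mulr_ge0 ?addr_ge0.
  - by rewrite prodr_ge0// => j _; rewrite invr_ge0 addr_ge0.
  by rewrite ler_wpM2l ?addr_ge0.
rewrite 4![in leRHS]mulrDl mul1r.
rewrite -[leLHS]addr0; apply: lerD; last by rewrite !mulr_ge0 ?invr_ge0 ?exprn_ge0.
by rewrite le_eqVlt; apply/orP; left; apply/eqP; ring.
Qed.

(** If [i] is in [B], then [t = i] and m T_i(x_i) is itself the tail gain. If not, m T_t(x_t) is
    merely bounded and the gain in coordinate [i] comes from the rest of the path, since the removed
    step is small in that coordinate. *)
Lemma block_bound (k q : nat) (C0 : R) : (2 <= q)%N -> 1 <= C0 -> prescribed k ->
  exists C c : R, [/\ 0 < C, 0 < c & forall M (A B : {set 'I_d}) i t n m b x,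
    (#|A| <= k.+1)%N -> i \in A -> (0 < n)%N -> (0 < m)%N -> (m <= n <= m + (d - #|A|))%N -> centred n b ->
    C0 * a n i < ax x i -> t \in B -> (i \in B -> t = i) ->
    m%:R * \sum_(e | Bof q C0 n A x (pt e) == B) wt M e *
      Ex (@pt d M) (wt M) m.-1 (fun y => (agree A (pt e + y) (x + b))%:R)
    <= C * Dn n A x * W c n (Some i) x].
Proof.
move=> q2 C01 [CI [cI [CI0 cI0 IH]]].
have [Cs Cs0 hCs] := step_weight q2.
have [Ch Ch1 hCh] := W_half.
have [CN CN1 hCN] := nT_bounded.
have CN0 : 0 < CN by exact: lt_le_trans CN1.
have Ch0 : 0 < Ch by exact: lt_le_trans Ch1.
have C00 : 0 < C0 by exact: lt_le_trans C01.
pose H := Num.max 1 (2 * Hs); have H1 : 1 <= H by rewrite le_max lexx.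
have H0 : 0 < H by exact: lt_le_trans H1.
pose C1 := 2 * Cs * (CI * (2 * C0) ^+ d * Ch) * H ^+ d.
have C10 : 0 < C1 by rewrite !mulr_gt0 ?exprn_gt0 ?mulr_gt0.
exists (C1 * CN), (cI / 4); split; [by rewrite mulr_gt0|by rewrite divr_gt0|].
move=> M A B i t n m b x Ak iA n0 m0 /andP[mn nm] hb xi tB iB.
(* An empty block contributes nothing; otherwise any of its steps shows that [B] consists of large
   coordinates of [A]. *)
have [->|[e0 /eqP e0B]] : \sum_(e | Bof q C0 n A x (pt e) == B) wt M e *
      Ex (@pt d M) (wt M) m.-1 (fun y => (agree A (pt e + y) (x + b))%:R) = 0 \/
      exists e : box d M, Bof q C0 n A x (pt e) == B.
- have [h1|h1] := pselect (exists e : box d M, Bof q C0 n A x (pt e) == B); first by right.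
  left; rewrite big1// => e eB; exfalso; apply: h1; by exists e.
- by rewrite mulr0 mulr_ge0// mulr_ge0 ?ltW// mulr_gt0.
have BJ j : j \in B -> (j \in A) && (C0 * a n j < ax x j).
  by rewrite -e0B !inE => /andP[].
have BA : B \subset A by apply/fintype.subsetP => j /BJ/andP[].
pose D := J C0 n A x :\: B.
pose A' := A :\: B.
have A'B : A' :|: B = A.
  apply/setP => j; rewrite !inE; have [/BJ/andP[-> _]|] := boolP (j \in B); first by rewrite orbT.
  by rewrite orbF.
have cA : (#|A'| < #|A|)%N.
  apply: proper_card; apply/fintype.properP; split; first by apply: finset.subsetDl.
  by exists t; rewrite ?inE ?tB//; case/andP: (BJ t tB).
pose o := if i \in B then None else Some i.
have oA' j : o = Some j -> j \in A'.
  by rewrite /o; case: ifP => // iB' [<-]; rewrite !inE iB' iA.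
pose bound := CI * ((2 * C0) ^+ d * Dn n A' x) * (Ch * W (cI / 4) n o x).
have bound0 : 0 <= bound by rewrite !mulr_ge0 ?(ltW CI0) ?exprn_ge0 ?(ltW Ch0) ?(ltW (Dn_gt0 _ _ _))// mulr_ge0// ltW.
have hbound (z : 'rV[int]_d) : [forall j in D, (`|z 0%R j| <= `|x 0%R j| %/ q)%N] ->
    Ex (@pt d M) (wt M) m.-1 (fun y => (agree A' y (x + b - z))%:R) <= bound.
  move=> smz; rewrite addrAC.
  have cd : (#|A| <= d)%N by rewrite -[leqRHS]card_ord max_card.
  apply: (le_trans (IH M A' o n m.-1 b (x - z) _ oA' n0 _ hb)).
  - by rewrite -ltnS (leq_trans cA).
  (* The missing step is compensated by at least one coordinate fewer to prescribe. *)
  - by move: cA cd m0 mn nm; clear; lia.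
  apply: ler_pM => //.
  - by rewrite mulr_ge0 ?(ltW CI0) ?(ltW (Dn_gt0 _ _ _)).
  - rewrite ler_wpM2l ?(ltW CI0)//; apply: (@Dn_near C0 q n A' D) => // j.
    by rewrite !inE => /andP[-> ->] ->.
  apply: hCh; first exact: ltW.
  move=> j; rewrite /o; case: ifP => // iB' [<-].
  have := forallP smz i; rewrite !inE iB' iA xi /= => zi.
  have : (`|x 0%R i| %/ q <= `|x 0%R i| %/ 2)%N by apply: leq_div2l.
  by move: zi; move: `|x 0%R i|%N `|z 0%R i|%N => u v; clear; lia.
pose g s (l : 'I_d) v : R := h t (2 ^ s * (`|x 0%R t| %/ q).+1)%N v / (1 + v%:R).
have g0 s l v : 0 <= g s l v by rewrite /g divr_ge0//; case/andP: (h01 t (2 ^ s * (`|x 0%R t| %/ q).+1) v).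
pose PB := \prod_(j in B) (Num.max (ax x j) (a n j))^-1.
have PB0 : 0 <= PB by rewrite prodr_ge0// => j _; rewrite invr_ge0 ltW.
pose Ks s := Cs * T t `|x 0%R t|%N * (2 ^+ s)^-1 * PB.
have Ks0 s : 0 <= Ks s by rewrite !mulr_ge0 ?invr_ge0 ?exprn_ge0 ?(ltW Cs0) ?(ltW (T_gt0 _ _)).
have main : \sum_(e | Bof q C0 n A x (pt e) == B) wt M e *
      Ex (@pt d M) (wt M) m.-1 (fun y => (agree A (pt e + y) (x + b))%:R)
   <= \sum_(s < M.+1) Ks s * (bound * H ^+ d).
  apply: (@le_trans _ _ (\sum_(s < M.+1) Ks s * (\sum_(e : box d M)
     [forall j in D, (`|pt e 0%R j| <= `|x 0%R j| %/ q)%N]%:R *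
     \prod_(l | l \notin B) g s l `|pt e 0%R l|%N *
     Ex (@pt d M) (wt M) m.-1 (fun y => (agree (A' :|: B) (pt e + y) (x + b))%:R)))).
    under [leRHS]eq_bigr do rewrite mulr_sumr.
    rewrite exchange_big /= big_mkcond /=; apply: ler_sum => e _.
    have pos s : 0 <= Ks s * ([forall j in D, (`|pt e 0%R j| <= `|x 0%R j| %/ q)%N]%:R *
     \prod_(l | l \notin B) g s l `|pt e 0%R l|%N *
     Ex (@pt d M) (wt M) m.-1 (fun y => (agree (A' :|: B) (pt e + y) (x + b))%:R)).
      by rewrite mulr_ge0// !mulr_ge0 ?prodr_ge0// Ex_ge0.
    case: eqP => eB; last by apply: sumr_ge0.
    (* Each step is charged to its own dyadic scale; the terms of the other scales are
       nonnegative. *)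
    have [s sM hs] := hCs C0 M e n A B t x C01 eB tB.
    rewrite (bigD1 (Ordinal sM))//= -[leLHS]addr0; apply: lerD; last by apply: sumr_ge0.
    have -> : [forall j in D, (`|pt e 0%R j| <= `|x 0%R j| %/ q)%N].
      apply/forallP => j; apply/implyP; rewrite inE -eB !inE => /andP[h1 /andP[jA jx]].
      by move: h1; rewrite jA jx /= -leqNgt.
    rewrite mul1r A'B mulrA; apply: ler_wpM2r; first exact: Ex_ge0.
    exact: hs.
  apply: ler_sum => s _; apply: ler_wpM2l => //.
  apply: (le_trans (@pinned_sum _ _ M (wt M) m.-1 A' B D _ (g s) bound (x + b) _ _ _ _ _ hbound)) => //.
  - by move=> j; rewrite !inE => /andP[].
  - by move=> j; rewrite !inE => /andP[].
  apply: ler_wpM2l => //.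
  apply: (@le_trans _ _ (\prod_(l | l \notin B) H)).
    by apply: ler_prod => l _; rewrite sumr_ge0//=; exact: h_sum_le.
  rewrite prodr_const ler_weXn2l// -[leqRHS]card_ord; exact: max_card.
apply: (le_trans (ler_wpM2l _ main)) => //.
rewrite -mulr_suml.
have sumK : \sum_(s < M.+1) Ks s <= 2 * (Cs * T t `|x 0%R t|%N * PB).
  have -> : \sum_(s < M.+1) Ks s = (Cs * T t `|x 0%R t|%N * PB) * \sum_(s < M.+1) (2 ^+ s)^-1.
    by rewrite mulr_sumr; apply: eq_bigr => s _; rewrite /Ks mulrAC.
  rewrite mulrC ler_wpM2r ?mulr_ge0 ?(ltW Cs0) ?(ltW (T_gt0 _ _))//.
  have geo N : \sum_(s < N.+1) (2 ^+ s)^-1 = 2 - (2 ^+ N)^-1 :> R.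
    elim: N => [|N IHM]; first by rewrite big_ord_recr big_ord0 /= expr0 add0r; lra.
    rewrite big_ord_recr /= IHM exprS; have : (2 ^+ N : R) != 0 by rewrite expf_neq0.
    by move=> h2; field.
  by rewrite geo lerBlDr lerDl invr_ge0 exprn_ge0.
have DnE : Dn n A x = Dn n A' x * PB.
  rewrite /Dn /PB (big_setID B) /= mulrC; congr (_ * _).
  by move/finset.setIidPr: BA => ->.
(* The number of positions of the removed step times its tail: the gain itself if [i] is in [B], a
   bounded factor otherwise. *)
have key : m%:R * T t `|x 0%R t|%N * W (cI / 4) n o x <= CN * W (cI / 4) n (Some i) x.
  have mT : m%:R * T t `|x 0%R t|%N <= n%:R * T t `|x 0%R t|%N by rewrite ler_wpM2r ?ler_nat// ltW.
  have xt : a n t <= ax x t.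
    have /andP[_ /ltW] := BJ t tB; apply: le_trans; rewrite ler_peMl// ltW//.
  rewrite /o; case: ifP => iB'; last first.
    apply: ler_wpM2r; first exact: W_ge0.
    by apply: (le_trans mT); exact: hCN.
  rewrite [W _ _ None _]/= mulr1; apply: (le_trans mT); rewrite (iB iB') /=.
  apply: (@le_trans _ _ (1 * (n%:R * T i `|x 0%R i|%N + expR (- (cI / 4) * (ax x i / a n i) ^+ 2) * (gs i)%:R))).
    by rewrite mul1r lerDl mulr_ge0// expR_ge0.
  by rewrite ler_wpM2r// (W_ge0 (cI / 4) n (Some i) x).
apply: (@le_trans _ _ (m%:R * (2 * (Cs * T t `|x 0%R t|%N * PB) * (bound * H ^+ d)))).
  rewrite ler_wpM2l// ler_wpM2r// mulr_ge0// exprn_ge0// ltW//.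
have -> : m%:R * (2 * (Cs * T t `|x 0%R t|%N * PB) * (bound * H ^+ d)) =
   C1 * Dn n A x * (m%:R * T t `|x 0%R t|%N * W (cI / 4) n o x).
  by rewrite /bound /C1 DnE; ring.
have -> : C1 * CN * Dn n A x * W (cI / 4) n (Some i) x = C1 * Dn n A x * (CN * W (cI / 4) n (Some i) x) by ring.
by rewrite ler_wpM2l// mulr_ge0 ?(ltW C10) ?(ltW (Dn_gt0 _ _ _)).
Qed.

(** There are finitely many blocks; in each of them [t] is taken to be [i] whenever [i] belongs to
    the block. *)
Lemma big_part (k q : nat) (C0 : R) : (2 <= q)%N -> 1 <= C0 -> prescribed k ->
  exists C c : R, [/\ 0 < C, 0 < c & forall M (A : {set 'I_d}) i n m b x,
    (#|A| <= k.+1)%N -> i \in A -> (0 < n)%N -> (m <= n <= m + (d - #|A|))%N -> centred n b ->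
    C0 * a n i < ax x i ->
    m%:R * \sum_(e | ~~ small q (J C0 n A x) x (pt e)) wt M e *
      Ex (@pt d M) (wt M) m.-1 (fun y => (agree A (pt e + y) (x + b))%:R)
    <= C * Dn n A x * W c n (Some i) x].
Proof.
move=> q2 C01 hk; have [C [c [C_0 c0 hC]]] := block_bound q2 C01 hk.
exists (#|{set 'I_d}|%:R * C + 1), c; split=> //.
  by rewrite ltr_wpDl// mulr_ge0// ltW.
move=> M A i n m b x Ak iA n0 mn hb xi.
have W0 := W_ge0 c n (Some i) x; have D0 := Dn_gt0 n A x.
set WW := W c n (Some i) x in W0 *.
case: m mn => [|m] mn.
  rewrite mul0r; apply: mulr_ge0 => //; apply: mulr_ge0; last exact: ltW.
  by rewrite addr_ge0// mulr_ge0// ltW.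
rewrite (partition_big (fun e => Bof q C0 n A x (pt e)) (fun B => B != finset.set0)) /=; last first.
  move=> e; rewrite negb_forall => /existsP[j]; rewrite negb_imply -ltnNge => /andP[jJ je].
  by apply/set0Pn; exists j; rewrite inE jJ.
rewrite mulr_sumr.
apply: (@le_trans _ _ (\sum_(B : {set 'I_d} | B != finset.set0) C * Dn n A x * WW)); last first.
  apply: (@le_trans _ _ (\sum_(B : {set 'I_d}) C * Dn n A x * WW)).
    rewrite [leRHS](bigID (fun B => B != finset.set0)) /= lerDl sumr_ge0// => B _.
    by rewrite !mulr_ge0 ?(ltW C_0) ?(ltW D0).
  rewrite sumr_const -[leLHS]mulr_natl !mulrA ler_wpM2r// ler_wpM2r ?(ltW D0)//.
  by rewrite lerDl.
apply: ler_sum => B Bn.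
apply: (@le_trans _ _ (m.+1%:R * \sum_(e | Bof q C0 n A x (pt e) == B) wt M e *
      Ex (@pt d M) (wt M) m.+1.-1 (fun y => (agree A (pt e + y) (x + b))%:R))).
  rewrite ler_wpM2l// big_mkcond [leRHS]big_mkcond; apply: ler_sum => e _.
  case: (_ == B); rewrite ?andbF ?andbT//; case: ifP => // _.
  by rewrite mulr_ge0// Ex_ge0.
have [iB|iB] := boolP (i \in B); first exact: (hC M A B i i).
have /set0Pn[t tB] := Bn.
by apply: (hC M A B i t) => // iB'; rewrite iB' in iB.
Qed.

(** If no coordinate is large, the local bound suffices and the tail factor is bounded below. If the
    coordinate of the tail factor is large, the step decomposition is applied with it. If only
    another one is large, the decomposition with that one gives the denominators, and its gain is
    discarded. *)
Lemma prescribedS k : prescribed k -> prescribed k.+1.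
Proof.
move=> hk.
have [q [C0 [Cs [cs [q2 C01 Cs0 cs0 hs]]]]] := small_part.
have [Cb [cb [Cb0 cb0 hb]]] := big_part q2 C01 hk.
have [Cu Cu1 hu] := W_up.
have C00 : 0 < C0 by exact: lt_le_trans C01.
pose c := Num.min cs cb.
have c0 : 0 < c by rewrite lt_min cs0.
have [w w0 hw] := W_low C0 (ltW c0).
pose w1 := Num.min 1 w.
have w10 : 0 < w1 by rewrite lt_min ltr01.
have w11 : w1 <= 1 by rewrite ge_min lexx.
have Cu0 : 0 < Cu by exact: lt_le_trans Cu1.
pose C := ((Cs + Cb) * Cu + (1 + CL) * C0 ^+ d) / w1.
have CSB : 0 < Cs + Cb by rewrite addr_gt0.
have CLd : 0 < (1 + CL) * C0 ^+ d by rewrite mulr_gt0 ?exprn_gt0// ltr_wpDr.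
exists C, c; split=> //; first by rewrite divr_gt0// addr_gt0// mulr_gt0.
move=> M A o n m b x Ak oA n0 mn hcb.
have D0 := Dn_gt0 n A x; have Wo0 := W_ge0 c n o x.
(* Paths with small steps only, plus the sum over a distinguished large step. *)
have large i : i \in A -> C0 * a n i < ax x i ->
    Ex (@pt d M) (wt M) m (fun y => (agree A y (x + b))%:R) <= (Cs + Cb) * Dn n A x * W c n (Some i) x.
  move=> iA xi.
  apply: (le_trans (@Ex_big_step _ _ _ (@pt d M) (wt M) (fun e => small q (J C0 n A x) x (pt e)) m _ _ _)) => //.
  rewrite !mulrDl; apply: lerD.
    apply: (le_trans (hs M A i n m b x iA n0 _ hcb xi)).
      by case/andP: mn => -> /leq_trans; apply; rewrite leq_add2l leq_subr.
    by rewrite ler_wpM2l ?mulr_ge0 ?(ltW Cs0) ?(ltW D0)// W_mono// ge_min lexx.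
  apply: (le_trans (hb M A i n m b x Ak iA n0 mn hcb xi)).
  by rewrite ler_wpM2l ?mulr_ge0 ?(ltW Cb0) ?(ltW D0)// W_mono// ge_min lexx orbT.
have fin u : Ex (@pt d M) (wt M) m (fun y => (agree A y (x + b))%:R) <= u * Dn n A x -> 0 <= u ->
    u <= (Cs + Cb) * Cu + (1 + CL) * C0 ^+ d -> w1 <= W c n o x ->
    Ex (@pt d M) (wt M) m (fun y => (agree A y (x + b))%:R) <= C * Dn n A x * W c n o x.
  move=> h1 u0 hu1 hw1; apply: (le_trans h1).
  rewrite mulrAC ler_wpM2r ?(ltW D0)// /C mulrAC ler_pdivlMr//.
  by apply: ler_pM => //; exact: ltW.
have [iL|/existsP none] := boolP [exists j in A, C0 * a n j < ax x j]; last first.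
  have sml j : j \in A -> ax x j <= C0 * a n j.
    by move=> jA; rewrite leNgt; apply/negP => xj; apply: none; exists j; rewrite jA.
  apply: (fin ((1 + CL) * C0 ^+ d)); [|exact: ltW|by rewrite lerDr mulr_ge0 ?(ltW CSB) ?(ltW Cu0)|]; last first.
    case: o oA {fin Wo0} => [i|] oA; last exact: w11.
    by rewrite ge_min; apply/orP; right; apply: hw => //; apply: sml; exact: oA.
  have pa0 : 0 < \prod_(j in A) a n j by apply: prodr_gt0.
  have nm : (n <= 2 * m + d + 1)%N.
    case/andP: mn => _ /leq_trans; apply; rewrite -addnA leq_add//; first by rewrite leq_pmull.
    by rewrite (leq_trans (leq_subr _ _))// leq_addr.
  have h1 := llt M A (x + b) n0 nm; rewrite -ler_pdivlMr// in h1.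
  apply: (le_trans h1); rewrite -[leRHS]mulrA; apply: ler_pM => //; first by rewrite invr_ge0 ltW.
    by rewrite lerDr.
  rewrite -ler_pdivrMl ?exprn_gt0// -invfM /Dn prodfV lef_pV2 ?posrE ?mulr_gt0 ?exprn_gt0 ?prodr_gt0//.
  apply: (@le_trans _ _ (\prod_(j in A) (C0 * a n j))).
    apply: ler_prod => j jA; rewrite (ltW (mx_gt0 _ _ _))/= ge_max sml//=.
    by rewrite ler_peMl// ltW.
  rewrite big_split /= prodr_const ler_wpM2r ?(ltW pa0)// ler_weXn2l//.
  by rewrite -[leqRHS]card_ord; exact: max_card.
case/existsP: iL => j /andP[jA xj].
(* The gain in coordinate [j] is bounded by [Cu], and the tail factor that is asked for is at least
   [w1]. *)
have viaj : w1 <= W c n o x -> Ex (@pt d M) (wt M) m (fun y => (agree A y (x + b))%:R) <= C * Dn n A x * W c n o x.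
  apply: (fin ((Cs + Cb) * Cu)); rewrite ?mulr_ge0 ?(ltW CSB) ?(ltW Cu0)//; last by rewrite lerDl ltW.
  apply: (le_trans (large j jA xj)); rewrite mulrAC ler_wpM2r ?(ltW D0)// ler_wpM2l ?(ltW CSB)//.
  apply: hu => //; first exact: ltW.
  by apply: le_trans (ltW xj); rewrite ler_peMl// ltW.
case: o oA fin viaj Wo0 => [i|] oA fin viaj Wo0; last exact: viaj.
have [xi|xi] := leP (ax x i) (C0 * a n i).
  by apply: viaj; rewrite ge_min; apply/orP; right; exact: hw.
apply: (le_trans (large i (oA i erefl) xi)).
rewrite ler_wpM2r// ler_wpM2r ?(ltW D0)//.
rewrite /C ler_pdivlMr// (@le_trans _ _ (Cs + Cb))//.
  by rewrite ler_piMr// ltW.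
by rewrite -[leLHS]addr0; apply: lerD; [rewrite ler_peMr// ltW|exact: ltW].
Qed.

Lemma prescribed0 : prescribed 0.
Proof.
exists (1 + CL), 1; split=> //; first by rewrite ltr_wpDr.
move=> M A o n m b x; rewrite leqn0 cards_eq0 => /eqP -> oA n0 mn _.
case: o oA => [i /(_ i erefl)|_]; first by rewrite inE.
have nm : (n <= 2 * m + d + 1)%N.
  case/andP: mn => _ /leq_trans; apply; rewrite -addnA leq_add//; first by rewrite leq_pmull.
  by rewrite (leq_trans (leq_subr _ _))// leq_addr.
have := @llt M finset.set0 n m (x + b) n0 nm.
rewrite /Dn !big1 ?mulr1 => [/le_trans|j|j]; rewrite ?inE//.
by apply; rewrite /= lerDr.
Qed.

Lemma local_deviation_bound : exists C c : R, [/\ 0 < C, 0 < c & forall M n b x i, (0 < n)%N -> centred n b ->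
  Ex (@pt d M) (wt M) n (fun y => (y == x + b)%:R) <=
  C * (\prod_j (Num.max (ax x j) (a n j))^-1) *
    (n%:R * T i `|x 0%R i|%N + expR (- c * (ax x i / a n i) ^+ 2) * (gs i)%:R)].
Proof.
have hc k : prescribed k by elim: k => [|k]; [exact: prescribed0|exact: prescribedS].
have [C [c [C_0 c0 h1]]] := hc d.
exists C, c; split=> // M n b x i n0 hb.
have := h1 M [set: 'I_d]%SET (Some i) n n b x _ _ n0 _ hb.
rewrite cardsT card_ord leqnn leqnn subnn addn0 leqnn /= => /(_ isT).
have E1 y : agree [set: 'I_d]%SET y (x + b) = (y == x + b).
  apply/forallP/eqP => [hy|-> j]; last by rewrite eqxx implybT.
  by apply/rowP => j; have := hy j; rewrite inE => /eqP.
under eq_fun do rewrite E1.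
rewrite /Dn (eq_bigl xpredT); last by move=> j; rewrite inE.
by apply => // j _; rewrite inE.
Qed.

End core.

(** * Karamata bounds *)

Section regular_variation.
Context {R : realType}.

(** Regular variation of index -rho with slowly varying part [f]. *)
Definition rv (f : R -> R) (rho x : R) : R := f x * x `^ (- rho).

Lemma powR_ratio (rho x y : R) : 0 < x -> 0 < y -> y `^ rho = (y / x) `^ rho * x `^ rho.
Proof. by move=> x0 y0; rewrite -powRM ?divr_ge0 ?(ltW x0) ?(ltW y0)// divfK// gt_eqF. Qed.

Lemma rv_potter f (rho delta : R) : slowly_varying f -> 0 < delta ->
  exists2 x0 : R, 1 <= x0 & forall x y, x0 <= x -> x <= y ->
    [/\ 0 < rv f rho x, rv f rho y <= 16 * (y / x) `^ (delta - rho) * rv f rho x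
      & rv f rho x <= 16 * (y / x) `^ (delta + rho) * rv f rho y].
Proof.
move=> fv d0; have [x0 x01 h] := slowly_varying_potter fv d0.
exists x0 => // x y x0x xy; have [fx fyx fxy] := h x y x0x xy.
have px : 0 < x by apply: lt_le_trans x0x; exact: lt_le_trans x01.
have py : 0 < y by exact: lt_le_trans xy.
have r0 : y / x != 0 by rewrite gt_eqF// divr_gt0.
have p (z s : R) : 0 < z -> 0 <= z `^ s by move=> z0; rewrite powR_ge0.
split; first by rewrite mulr_gt0// powR_gt0.
- rewrite /rv powRD ?r0 ?implybT// (powR_ratio _ px py).
  rewrite [leRHS](_ : _ = 16 * (y / x) `^ delta * f x * ((y / x) `^ (- rho) * x `^ (- rho))); last by ring.
  by rewrite ler_wpM2r// mulr_ge0// powR_ge0.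
- rewrite /rv powRD ?r0 ?implybT// (powR_ratio (- rho) px py).
  have E : (y / x) `^ rho * (y / x) `^ (- rho) = 1 by rewrite powRN divff// gt_eqF// powR_gt0// divr_gt0.
  rewrite [leRHS](_ : _ = 16 * (y / x) `^ delta * f y * x `^ (- rho) * ((y / x) `^ rho * (y / x) `^ (- rho))); last by ring.
  by rewrite E mulr1 ler_wpM2r// powR_ge0.
Qed.

Lemma powR_choose (A s : R) : 0 < s -> exists2 M : nat, (2 <= M)%N & A <= M%:R `^ s.
Proof.
move=> s0; pose r := `|A| `^ s^-1.
exists (Num.truncn r).+2 => //.
have r0 : 0 <= r by exact: powR_ge0.
have h1 : r <= (Num.truncn r).+2%:R by rewrite (le_trans (ltW (truncnS_gt r)))// ler_nat.
apply: (le_trans (ler_norm A)).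
rewrite -[leLHS]powRr1// -[X in _ `^ X](@mulVf _ s) ?gt_eqF// powRrM.
by apply: ge0_ler_powR; rewrite ?nnegrE ?(ltW s0).
Qed.

End regular_variation.

(** * Regularly varying sequences frozen below a threshold *)

Section quasi_monotone.
Context {R : realType}.
Variables (T : nat -> R) (x0 : nat) (rho delta : R).
Hypothesis x0_gt0 : (0 < x0)%N.
Hypothesis delta_gt0 : 0 < delta.
Hypothesis delta_le : delta <= rho.
Hypothesis T_potter : forall u v, (x0 <= u)%N -> (u <= v)%N ->
  [/\ 0 < T u, T v <= 16 * (v%:R / u%:R) `^ (delta - rho) * T u
    & T u <= 16 * (v%:R / u%:R) `^ (delta + rho) * T v].
Hypothesis T_low : forall k, (k <= x0)%N -> T k = T x0.

Lemma quasi_gt0 k : 0 < T k.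
Proof.
have [kx|kx] := leqP x0 k; first by case: (T_potter kx (leqnn k)).
by rewrite T_low ?(ltnW kx)//; case: (T_potter (leqnn x0) (leqnn x0)).
Qed.

Let ratio_ge1 (u v : nat) : (0 < u)%N -> (u <= v)%N -> 1 <= v%:R / u%:R :> R.
Proof. by move=> u0 uv; rewrite ler_pdivlMr ?ltr0n// mul1r ler_nat. Qed.

(** As [delta <= rho], the Potter exponent [delta - rho] is nonpositive. *)
Lemma quasi_dec u v : (u <= v)%N -> T v <= 16 * T u.
Proof.
have base u' v' : (x0 <= u')%N -> (u' <= v')%N -> T v' <= 16 * T u'.
  move=> xu uv; have [_ h _] := T_potter xu uv; apply: (le_trans h).
  rewrite ler_wpM2r ?(ltW (quasi_gt0 _))// ler_piMr//.
  rewrite -[leRHS](powRr0 (v'%:R / u'%:R)); apply: ler_powR; last by rewrite subr_le0.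
  by apply: ratio_ge1 => //; exact: leq_trans xu.
move=> uv; have [xu|ux] := leqP x0 u; first exact: base.
rewrite (T_low (ltnW ux)); have [xv|vx] := leqP x0 v; first exact: base.
by rewrite (T_low (ltnW vx)) ler_peMl ?(ltW (quasi_gt0 _))// ler1n.
Qed.

(** The lower Potter bound with exponent rho + delta <= s. The successors make the bound valid at 0
    as well, at the cost of a factor 2 in the ratio of the arguments. *)
Lemma quasi_poly s u v : rho + delta <= s%:R -> (u <= v)%N ->
  T u * u.+1%:R ^+ s <= 16 * 2 ^+ s * T v * v.+1%:R ^+ s.
Proof.
move=> hs uv.
have key u' v' : (x0 <= u')%N -> (u' <= v')%N -> (v'%:R / u'%:R <= 2 * (v.+1%:R / u.+1%:R) :> R) ->
    T u' <= 16 * (2 * (v.+1%:R / u.+1%:R)) ^+ s * T v'.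
  move=> xu uv' hr; have [_ _ h] := T_potter xu uv'; apply: (le_trans h).
  rewrite ler_wpM2r ?(ltW (quasi_gt0 _))// ler_wpM2l//.
  have r1 : 1 <= v'%:R / u'%:R :> R by apply: ratio_ge1 => //; exact: leq_trans xu.
  apply: (@le_trans _ _ ((v'%:R / u'%:R) `^ s%:R)); first by apply: ler_powR => //; rewrite addrC.
  rewrite powR_mulrn ?(le_trans _ r1)//; apply: lerXn2r => //; rewrite nnegrE ?(le_trans _ r1)//.
suff h : T u <= 16 * (2 * (v.+1%:R / u.+1%:R)) ^+ s * T v.
  apply: (le_trans (ler_wpM2r _ h)); first exact: exprn_ge0.
  rewrite exprMn expr_div_n le_eqVlt; apply/orP; left; apply/eqP.
  by field; rewrite expf_neq0// nat1r pnatr_eq0.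
have u1 : 0 < u.+1%:R :> R by [].
have [xu|ux] := leqP x0 u.
  have u0 : (0 < u)%N by exact: leq_trans xu.
  apply: key => //; rewrite ler_pdivrMr ?ltr0n// [2 * _]mulrC mulrAC -mulrA mulrAC.
  rewrite ler_pdivlMr// -!natrM ler_nat; nia.
have [xv|vx] := leqP x0 v.
  rewrite (T_low (ltnW ux)); apply: key => //.
  have xr : 0 < x0%:R :> R by rewrite ltr0n.
  rewrite ler_pdivrMr// [2 * _]mulrC mulrAC -mulrA mulrAC.
  rewrite ler_pdivlMr// -!natrM ler_nat; nia.
rewrite (T_low (ltnW ux)) (T_low (ltnW vx)) ler_peMl ?(ltW (quasi_gt0 _))//.
have r1 : 1 <= 2 * (v.+1%:R / u.+1%:R) :> R.
  by rewrite mulr_ege1 ?ler1n// ratio_ge1.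
by rewrite mulr_ege1 ?ler1n// exprn_ege1.
Qed.

Lemma quasi_div q : (0 < q)%N -> exists C : R, forall x, T (x %/ q) <= C * T x.
Proof.
move=> q0; pose s := (Num.truncn (rho + delta)).+1.
have hs : rho + delta <= s%:R by apply: ltW; exact: truncnS_gt.
exists (16 * 2 ^+ s * q%:R ^+ s) => x.
have h := quasi_poly hs (leq_div x q).
rewrite -ler_pdivlMr ?exprn_gt0// in h; apply: (le_trans h).
rewrite ler_pdivrMr ?exprn_gt0//.
rewrite [leRHS](_ : _ = 16 * 2 ^+ s * T x * (q%:R * (x %/ q).+1%:R) ^+ s); last by rewrite exprMn; ring.
apply: ler_wpM2l; first by rewrite !mulr_ge0 ?exprn_ge0 ?(ltW (quasi_gt0 _)).
apply: lerXn2r; rewrite ?nnegrE ?mulr_ge0// -natrM ler_nat mulnC.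
by rewrite -ltn_divLR.
Qed.

(** * Truncated moments against the tail *)

Section moments.
Context {d : nat} {dO : measure_display} {Omega : measurableType dO}.
Variables (P : probability Omega R) (X : nat -> Omega -> 'rV[int]_d).
Hypothesis hX : iid discrete_sets P X.
Variable i : 'I_d.
Variable CG : R.
Hypothesis tail_le : forall k, tail P X i k <= CG * T k.

Let CG_ge0 : 0 <= CG.
Proof. by rewrite -(pmulr_lge0 _ (quasi_gt0 0)); apply: le_trans (tail_le 0); exact: tail_ge0. Qed.

Definition moment (p : R) (k : nat) : R := step_exp P X i (fun j => `|j|%N%:R `^ p * (`|j| <= k)%N%:R).

(** Strong induction on k: the moment at k is at most the moment at k / M plus k^p times the tail at
    k / M, and for large M the first term is at most half of the target. *)
Lemma karamata (p : R) : 0 < p -> rho + delta < p ->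
  exists2 C, 0 < C & forall k, moment p k <= C * k%:R `^ p * T k.
Proof.
move=> p0 hp.
(* 16 is the Potter constant, 2 halves the induction term, and 2^(delta + rho) accounts for k <= 2 M
   m with m the integer part of k / M. *)
have [M M2 hM] := powR_choose (32 * 2 `^ (delta + rho)) (s := p - (rho + delta)) ltac:(rewrite subr_gt0; exact: hp).
have M0 : (0 < M)%N by exact: leq_trans M2.
have MR : 0 < M%:R :> R by rewrite ltr0n.
pose B := 16 * (2 * M%:R) `^ (delta + rho).
have B0 : 0 <= B by rewrite mulr_ge0 ?powR_ge0.
have BM : B <= 2^-1 * M%:R `^ p.
  have -> : M%:R `^ p = M%:R `^ (p - (rho + delta)) * M%:R `^ (delta + rho).
    by rewrite -powRD ?(gt_eqF MR) ?implybT//; congr (_ `^ _); ring.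
  rewrite /B powRM// mulrA -[16](_ : 2^-1 * 32 = 16 :> R); last by field.
  rewrite -2!mulrA ler_wpM2l ?invr_ge0// mulrA ler_wpM2r ?powR_ge0//.
have bm (F : int -> R) k : bdd (fun j => F j * (`|j| <= k)%N%:R) by exact: bdd_trunc.
have momle k : moment p k <= k%:R `^ p.
  rewrite -(EX_cst P X i (k%:R `^ p)); apply: (le_EX hX) => //; first exact: bdd_cst.
  move=> j; case: leqP => jk; last by rewrite mulr0 powR_ge0.
  by rewrite mulr1; apply: ge0_ler_powR; rewrite ?nnegrE ?(ltW p0) ?ler_nat.
pose C := 1 + 2 * CG * B + 16 / T (M * x0)%N.
have t0 := quasi_gt0 (M * x0).
have C0 : 0 < C by rewrite addr_gt0 ?divr_gt0// ltr_wpDr// !mulr_ge0.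
exists C => // k; have [n] := ubnP k; elim: n k => // n IH k; rewrite ltnS => kn.
have [kx|kx] := ltnP k (M * x0).
  apply: (le_trans (momle k)); rewrite mulrAC ler_peMl ?powR_ge0//.
  have h1 : 1 <= 16 / T (M * x0)%N * T k.
    by rewrite mulrAC ler_pdivlMr// mul1r quasi_dec// ltnW.
  apply: (le_trans h1); rewrite ler_wpM2r ?(ltW (quasi_gt0 _))// lerDr addr_ge0// !mulr_ge0//.
have k0 : (0 < k)%N by apply: leq_trans kx; rewrite muln_gt0 M0.
pose m := (k %/ M)%N.
have mx : (x0 <= m)%N by rewrite /m leq_divRL// mulnC.
have m0 : (0 < m)%N by exact: leq_trans mx.
have mk : (m < k)%N by rewrite /m ltn_Pdiv.
have mR : 0 < m%:R :> R by rewrite ltr0n.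
have Tm : T m <= B * T k.
  have [_ _ h] := T_potter mx (ltnW mk); apply: (le_trans h).
  rewrite ler_wpM2r ?(ltW (quasi_gt0 _))// ler_wpM2l//; apply: ge0_ler_powR; rewrite ?nnegrE ?divr_ge0 ?mulr_ge0//.
    by rewrite addr_ge0 ?(ltW delta_gt0)// (le_trans (ltW delta_gt0)).
  rewrite ler_pdivrMr// -!natrM ler_nat.
  have : (k < m.+1 * M)%N by rewrite -ltn_divLR.
  by move: m0; clear; nia.
have split_m : moment p k <= moment p m + k%:R `^ p * tail P X i m.
  rewrite /moment /tail -(EXZ hX); last by apply: bdd_bool.
  rewrite -(EXD hX)//; last by apply: bddZ; exact: bdd_bool.
  apply: (le_EX hX) => //; first by apply: bddD => //; apply: bddZ; exact: bdd_bool.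
  move=> j; have [jm|mj] := leqP `|j| m.
    by rewrite (leq_trans jm (ltnW mk)) !mulr1 mulr0 addr0.
  rewrite !mulr0 add0r mulr1; case: leqP => jk; last by rewrite mulr0 powR_ge0.
  by rewrite mulr1; apply: ge0_ler_powR; rewrite ?nnegrE ?(ltW p0) ?ler_nat.
apply: (le_trans split_m).
have kp : 0 <= k%:R `^ p :> R by exact: powR_ge0.
have h1 : moment p m <= C / 2 * k%:R `^ p * T k.
  apply: (le_trans (IH m (leq_trans mk kn))).
  have mp : m%:R `^ p <= k%:R `^ p / M%:R `^ p.
    rewrite ler_pdivlMr ?powR_gt0// -powRM//; apply: ge0_ler_powR; rewrite ?nnegrE ?mulr_ge0 ?(ltW p0)//.
    by rewrite -natrM ler_nat leq_divM.
  apply: (@le_trans _ _ (C * (k%:R `^ p / M%:R `^ p) * (2^-1 * M%:R `^ p * T k))).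
    apply: ler_pM; rewrite ?mulr_ge0 ?(ltW C0) ?powR_ge0 ?(ltW (quasi_gt0 _))//.
      by rewrite ler_wpM2l ?(ltW C0).
    by apply: (le_trans Tm); rewrite ler_wpM2r ?(ltW (quasi_gt0 _)).
  have Mp0 : M%:R `^ p != 0 :> R by rewrite gt_eqF// powR_gt0.
  by rewrite le_eqVlt; apply/orP; left; apply/eqP; field.
have h2 : k%:R `^ p * tail P X i m <= CG * B * k%:R `^ p * T k.
  rewrite [leRHS](_ : _ = k%:R `^ p * (CG * (B * T k))); last ring.
  by rewrite ler_wpM2l//; apply: (le_trans (tail_le m)); rewrite ler_wpM2l.
apply: (le_trans (lerD h1 h2)); rewrite -!mulrDl ler_wpM2r ?(ltW (quasi_gt0 _))// ler_wpM2r//.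
have : 0 <= 16 / T (M * x0)%N by rewrite divr_ge0// ltW.
rewrite /C; lra.
Qed.

Definition ring_mean (y N : nat) : R := step_exp P X i (fun j => `|j|%N%:R * (y < `|j|)%N%:R * (`|j| <= N)%N%:R).

(** Karamata upwards: the range beyond y is the range beyond M y plus a part bounded by M y times
    the tail at y. As rho - delta > 1, multiplying y by a large M at least halves the bound C y
    T(y), and the truncation at [N] stops the recursion. *)
Lemma tail_mean : 1 < rho - delta -> exists2 C, 0 < C & forall y N, (0 < y)%N ->
  ring_mean y N <= C * y%:R * T y.
Proof.
move=> hrd.
have [M M2 hM] := powR_choose 32 (s := rho - delta - 1) ltac:(rewrite subr_gt0; exact: hrd).
have M0 : (0 < M)%N by exact: leq_trans M2.
have MR : 0 < M%:R :> R by rewrite ltr0n.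
have split_y y z N : (y <= z)%N -> ring_mean y N <= ring_mean z N + z%:R * tail P X i y.
  move=> yz; rewrite /ring_mean /tail -(EXZ hX); last by apply: bdd_bool.
  rewrite -(EXD hX); [|exact: bdd_trunc|by apply: bddZ; exact: bdd_bool].
  apply: (le_EX hX); [exact: bdd_trunc| |].
    by apply: bddD; [exact: bdd_trunc|apply: bddZ; exact: bdd_bool].
  move=> j; have [yj|jy] := ltnP y `|j|; last by rewrite mulr0 mul0r addr_ge0// !mulr_ge0.
  case: (leqP `|j| N) => jN; last by rewrite !mulr0 add0r mulr_ge0.
  have [zj|jz] := ltnP z `|j|; first by rewrite lerDl mulr_ge0.
  by rewrite !mulr1 mulr0 add0r ler_nat.
have far y N : (N <= y)%N -> ring_mean y N = 0.
  move=> Ny; rewrite -(EX_cst P X i 0) /ring_mean; congr step_exp; apply/funext => j.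
  have [yj|jy] := ltnP y `|j|; last by rewrite mulr0 mul0r.
  by rewrite leqNgt (leq_ltn_trans Ny yj) mulr0.
pose C := 1 + 2 * M%:R * CG.
have C0 : 0 < C by rewrite ltr_wpDr// !mulr_ge0.
have main y N : (x0 <= y)%N -> ring_mean y N <= C * y%:R * T y.
  have [n] := ubnP (N - y); elim: n y => // n IH y nN yx.
  have y0 : (0 < y)%N by exact: leq_trans yx.
  have [Ny|yN] := leqP N y; first by rewrite far// !mulr_ge0 ?(ltW C0) ?(ltW (quasi_gt0 _)).
  have yM : (y < M * y)%N by rewrite ltn_Pmull.
  apply: (le_trans (split_y y (M * y)%N N (ltnW yM))).
  have Tz := IH (M * y)%N ltac:(move: nN yM yN; clear; lia) (leq_trans yx (ltnW yM)).
  have [_ hT _] := T_potter yx (ltnW yM).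
  have E1 : (M * y)%N%:R / y%:R = M%:R :> R by rewrite natrM mulfK// pnatr_eq0 -lt0n.
  rewrite E1 in hT.
  have small : 16 * M%:R * M%:R `^ (delta - rho) <= 2^-1 :> R.
    have -> : 16 * M%:R * M%:R `^ (delta - rho) = 16 / M%:R `^ (rho - delta - 1) :> R.
      rewrite -powRN -mulrA; congr (_ * _); rewrite -{1}[M%:R]powRr1//.
      by rewrite -powRD ?(gt_eqF MR) ?implybT//; congr (_ `^ _); ring.
    rewrite ler_pdivrMr ?powR_gt0// mulrC ler_pdivlMr//; apply: le_trans hM; lra.
  have yT : 0 <= y%:R * T y by rewrite mulr_ge0 ?(ltW (quasi_gt0 _)).
  have h1 : C * (M * y)%N%:R * T (M * y)%N <= C / 2 * (y%:R * T y).
    rewrite natrM; apply: (@le_trans _ _ (C * (M%:R * y%:R) * (16 * M%:R `^ (delta - rho) * T y))).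
      by rewrite ler_wpM2l// !mulr_ge0// ltW.
    rewrite [leLHS](_ : _ = C * (16 * M%:R * M%:R `^ (delta - rho)) * (y%:R * T y)); last ring.
    by rewrite ler_wpM2r// ler_wpM2l// ltW.
  have h2 : (M * y)%N%:R * tail P X i y <= M%:R * CG * (y%:R * T y).
    rewrite natrM [leRHS](_ : _ = M%:R * y%:R * (CG * T y)); last ring.
    by rewrite ler_wpM2l ?mulr_ge0.
  apply: (le_trans (lerD (le_trans Tz h1) h2)).
  rewrite -mulrDl -[leRHS]mulrA ler_wpM2r// /C; lra.
exists ((C + CG) * x0%:R) => [|y N y0]; first by rewrite mulr_gt0 ?ltr0n// ltr_wpDr.
have [xy|yx] := leqP x0 y.
  apply: (le_trans (main y N xy)); rewrite ler_wpM2r ?(ltW (quasi_gt0 _))// ler_wpM2r//.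
  rewrite (@le_trans _ _ (C + CG))// ?lerDl// ler_peMr ?ler1n// addr_ge0// ltW//.
apply: (le_trans (split_y y x0 N (ltnW yx))).
apply: (@le_trans _ _ ((C + CG) * x0%:R * T y)).
  rewrite mulrDl mulrDl; apply: lerD; first by rewrite (T_low (ltnW yx)) main.
  by rewrite [leRHS]mulrAC mulrC ler_wpM2r.
rewrite ler_wpM2r ?(ltW (quasi_gt0 _))// ler_peMr ?ler1n// mulr_ge0// addr_ge0// ltW//.
Qed.

End moments.
End quasi_monotone.

(** * Scaling sequences against the tail *)

Section scales.
Context {R : realType}.
Variables (V : R -> R) (alpha xV c1 c2 CV : R) (a : nat -> R) (T : nat -> R) (x0 : nat).
Hypothesis alpha_gt0 : 0 < alpha.
Hypothesis xV_ge1 : 1 <= xV.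
Hypothesis V_potter : forall x y, xV <= x -> x <= y -> [/\ 0 < V x,
  V y <= 16 * (y / x) `^ (alpha / 2 - alpha) * V x & V x <= 16 * (y / x) `^ (alpha / 2 + alpha) * V y].
Hypothesis a_ge : forall n, xV <= a n.
Hypothesis a_x0 : forall n, x0%:R <= a n.
Hypothesis c1_gt0 : 0 < c1.
Hypothesis nV : forall n, (0 < n)%N -> c1 <= n%:R * V (a n) <= c2.
Hypothesis T_gt0 : forall k, 0 < T k.
Hypothesis T_dec : forall u v, (u <= v)%N -> T v <= 16 * T u.
Hypothesis T_le : forall k, (x0 <= k)%N -> T k <= CV * V k%:R.

Let a_gt0 n : 0 < a n. Proof. by apply: lt_le_trans (a_ge n); exact: lt_le_trans xV_ge1. Qed.

Let c2_gt0 : 0 < c2.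
Proof. by have /andP[h1 h2] := nV (isT : (0 < 1)%N); apply: lt_le_trans c1_gt0 (le_trans h1 h2). Qed.

Let a_powN n x : a n <= x -> (x / a n) `^ (alpha / 2 - alpha) = (x / a n) `^ (- (alpha / 2)).
Proof. by move=> _; congr (_ `^ _); field. Qed.

(** Potter's bound for V from a_n to x, together with n V(a_n) <= c2. *)
Lemma scale_tail_decay : exists2 C, 0 < C & forall n x, (0 < n)%N -> a n <= x%:R ->
  n%:R * T x <= C * (x%:R / a n) `^ (- (alpha / 2)).
Proof.
exists ((1 + `|CV|) * 16 * c2) => [|n x n0 ax]; first by rewrite !mulr_gt0// ltr_wpDr.
have xx0 : (x0 <= x)%N by rewrite -(ler_nat R); exact: le_trans ax.
have [Va hV _] := V_potter (a_ge n) ax.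
have [Vx _ _] := V_potter (le_trans (a_ge n) ax) (lexx _).
have /andP[_ nv2] := nV n0.
apply: (@le_trans _ _ (n%:R * ((1 + `|CV|) * (16 * (x%:R / a n) `^ (- (alpha / 2)) * V (a n))))).
  rewrite ler_wpM2l//; apply: (le_trans (T_le xx0)); apply: ler_pM; rewrite ?(ltW Vx)//; last 2 first.
  - by rewrite (le_trans (ler_norm _))// lerDr.
  - by rewrite -(a_powN ax).
  - by rewrite -(pmulr_lge0 _ Vx); exact: le_trans (ltW (T_gt0 x)) (T_le xx0).
rewrite [leLHS](_ : _ = (1 + `|CV|) * 16 * (x%:R / a n) `^ (- (alpha / 2)) * (n%:R * V (a n))); last by ring.
by rewrite [leRHS]mulrAC ler_wpM2l// !mulr_ge0 ?powR_ge0// addr_ge0.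
Qed.

(** Once p alpha / 2 >= 1, the power p of the decay yields a full factor a_n / x. *)
Lemma scale_tail_power : exists (C : R) (p0 : nat), forall p n x, (p0 <= p)%N -> (0 < n)%N -> a n <= x%:R ->
  (n%:R * T x) ^+ p * x%:R <= C ^+ p * a n.
Proof.
have [C C0 hC] := scale_tail_decay.
pose p0 := (Num.truncn (2 / alpha)).+1.
exists C, p0 => p n x pp n0 ax.
have r1 : 1 <= x%:R / a n by rewrite ler_pdivlMr// mul1r.
have rp : 0 < x%:R / a n by exact: lt_le_trans r1.
have h1 : (n%:R * T x) ^+ p <= C ^+ p * (x%:R / a n)^-1.
  apply: (@le_trans _ _ ((C * (x%:R / a n) `^ (- (alpha / 2))) ^+ p)).
    by apply: lerXn2r; rewrite ?nnegrE ?mulr_ge0 ?powR_ge0 ?(ltW C0) ?(ltW (T_gt0 _))//; exact: hC.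
  rewrite exprMn ler_wpM2l ?exprn_ge0 ?(ltW C0)//.
  rewrite -[leLHS]powR_mulrn ?powR_ge0// -powRrM -[leRHS]powR_inv1 ?(ltW rp)//; apply: ler_powR => //.
  rewrite mulNr lerN2; apply: (@le_trans _ _ (alpha / 2 * p0%:R)).
    by rewrite mulrC -ler_pdivrMr ?divr_gt0// mul1r invf_div ltW// truncnS_gt.
  by rewrite ler_wpM2l ?divr_ge0 ?(ltW alpha_gt0)// ler_nat.
apply: (le_trans (ler_wpM2r _ h1)) => //.
rewrite invf_div -mulrA ler_wpM2l ?exprn_ge0 ?(ltW C0)// divfK//.
by rewrite gt_eqF// (lt_le_trans (a_gt0 n)).
Qed.

Lemma scale_tail_small (e : R) : 0 < e -> exists2 C0, 1 <= C0 & forall n x, (0 < n)%N ->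
  C0 * a n <= x%:R -> n%:R * T x <= e.
Proof.
move=> e0; have [C C_0 hC] := scale_tail_decay.
have [M M2 hM] := powR_choose (C / e) (s := alpha / 2) ltac:(by rewrite divr_gt0).
have M0 : 0 < M%:R :> R by rewrite ltr0n ltnW.
exists M%:R => [|n x n0 ax]; first by rewrite ler1n ltnW.
have ax' : a n <= x%:R by apply: le_trans ax; rewrite ler_peMl ?(ltW (a_gt0 _))// ler1n ltnW.
apply: (le_trans (hC n x n0 ax')).
have Mx : M%:R <= x%:R / a n by rewrite ler_pdivlMr.
have p1 : M%:R `^ (alpha / 2) <= (x%:R / a n) `^ (alpha / 2).
  by apply: ge0_ler_powR; rewrite ?nnegrE ?divr_ge0 ?(ltW alpha_gt0) ?(ltW (a_gt0 _)).
rewrite powRN ler_pdivrMr ?(lt_le_trans _ p1) ?powR_gt0// mulrC -ler_pdivrMr//.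
exact: le_trans hM p1.
Qed.

(** T is compared with V at a point z that is at least both x and a_n and at most a constant times
    a_n; almost monotonicity brings the bound back to x. *)
Lemma scale_tail_low (cT : R) : 0 < cT -> (forall k, (x0 <= k)%N -> cT * V k%:R <= T k) ->
  forall K : R, exists2 c : R, 0 < c & forall n x, (0 < n)%N -> x%:R <= K * a n -> c <= n%:R * T x.
Proof.
move=> cT0 T_ge K.
pose K' := (Num.truncn `|K|).+2.
exists (c1 * cT / (16 * (16 * K'%:R `^ (alpha / 2 + alpha)))) => [|n x n0 xK].
  by rewrite divr_gt0 ?mulr_gt0 ?powR_gt0.
pose y := (Num.truncn (a n)).+1.
have y1 : a n <= y%:R by apply: ltW; exact: truncnS_gt.
have a1 : 1 <= a n by exact: le_trans (a_ge n).
pose z := (maxn x y).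
have az : a n <= z%:R by apply: (le_trans y1); rewrite ler_nat leq_maxr.
have zx0 : (x0 <= z)%N by rewrite -(ler_nat R); exact: le_trans az.
have zK : z%:R / a n <= K'%:R.
  rewrite ler_pdivrMr// /z /maxn; case: ifP => _.
    have : y%:R <= a n + 1 by rewrite /y -natr1 lerD2r truncn_le// ltW.
    move=> /le_trans; apply; apply: (@le_trans _ _ (2 * a n)); first by rewrite mulr2n mulrDl !mul1r lerD2l.
    by rewrite ler_wpM2r ?(ltW (a_gt0 _))// ler_nat.
  apply: (le_trans xK); rewrite ler_wpM2r ?(ltW (a_gt0 _))// (le_trans (ler_norm _))//.
  by rewrite (le_trans (ltW (truncnS_gt _)))// ler_nat.
have z1 : 1 <= z%:R / a n by rewrite ler_pdivlMr// mul1r.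
have [Va _ hV] := V_potter (a_ge n) az.
have [Vz _ _] := V_potter (le_trans (a_ge n) az) (lexx _).
have /andP[nv1 _] := nV n0.
have h1 : V (a n) <= 16 * K'%:R `^ (alpha / 2 + alpha) * V z%:R.
  apply: (le_trans hV); rewrite ler_wpM2r ?(ltW Vz)// ler_wpM2l//.
  have al0 := ltW alpha_gt0.
  apply: ge0_ler_powR; rewrite ?nnegrE ?addr_ge0 ?divr_ge0//; exact: ltW.
have h2 : T z <= 16 * T x by apply: T_dec; rewrite leq_maxl.
have h3 := T_ge z zx0.
set D := 16 * K'%:R `^ (alpha / 2 + alpha) in h1 *.
have D0 : 0 < D by rewrite mulr_gt0 ?powR_gt0.
rewrite ler_pdivrMr ?mulr_gt0 ?powR_gt0//.
apply: (@le_trans _ _ (n%:R * V (a n) * cT)); first by rewrite ler_wpM2r ?(ltW cT0).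
apply: (@le_trans _ _ (n%:R * (D * V z%:R) * cT)); first by rewrite ler_wpM2r ?(ltW cT0)// ler_wpM2l.
rewrite [leLHS](_ : _ = n%:R * D * (cT * V z%:R)); last by ring.
apply: (@le_trans _ _ (n%:R * D * (16 * T x))).
  by rewrite ler_wpM2l ?mulr_ge0 ?(ltW D0)//; exact: le_trans h2.
by rewrite le_eqVlt; apply/orP; left; apply/eqP; ring.
Qed.

(** From c1 <= n V(a_n) and m V(a_m) <= c2, the decay of V between a_m and a_n bounds (a_n /
    a_m)^(alpha / 2) by a multiple of n / m. *)
Lemma scale_growth : exists (Cg : R) (kap : nat), 1 <= Cg /\ forall m n, (0 < m)%N -> (m <= n)%N ->
  a n <= Cg * (n%:R / m%:R) ^+ kap * a m.
Proof.
pose B := Num.max 1 (16 * c2 / c1).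
have B1 : 1 <= B by rewrite le_max lexx.
have B0 : 0 <= B by exact: le_trans B1.
have al2 : 0 < alpha / 2 by rewrite divr_gt0.
pose kap := (Num.truncn (2 / alpha)).+1.
exists (B `^ (2 / alpha)), kap; split.
  by rewrite -[leLHS](powRr0 B); apply: ler_powR => //; rewrite divr_ge0// ltW.
move=> m n m0 mn.
have mR : 0 < m%:R :> R by rewrite ltr0n.
have n0 : (0 < n)%N by exact: leq_trans mn.
have nm1 : 1 <= n%:R / m%:R :> R by rewrite ler_pdivlMr// mul1r ler_nat.
have B2 : 1 <= B `^ (2 / alpha) by rewrite -[leLHS](powRr0 B); apply: ler_powR => //; rewrite divr_ge0// ltW.
have [anm|amn] := leP (a n) (a m).
  apply: (le_trans anm); rewrite ler_peMl ?(ltW (a_gt0 _))// mulr_ege1// exprn_ege1//.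
have [Vm hV _] := V_potter (a_ge m) (ltW amn).
have /andP[nv1 _] := nV n0; have /andP[_ mv2] := nV m0.
have r1 : 1 <= a n / a m by rewrite ler_pdivlMr// mul1r ltW.
have rp : 0 < a n / a m by exact: lt_le_trans r1.
rewrite (a_powN (ltW amn)) in hV.
have h1 : (a n / a m) `^ (alpha / 2) <= B * (n%:R / m%:R).
  have rp' : 0 < (a n / a m) `^ (alpha / 2) by exact: powR_gt0.
  apply: (@le_trans _ _ (16 * c2 / c1 * (n%:R / m%:R))); last first.
    by rewrite ler_wpM2r ?divr_ge0// le_max lexx orbT.
  rewrite mulrAC ler_pdivlMr// mulrA ler_pdivlMr//.
  rewrite powRN in hV.
  have h2 : c1 * (a n / a m) `^ (alpha / 2) <= n%:R * 16 * V (a m).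
    rewrite -ler_pdivlMr//; apply: (le_trans nv1).
    rewrite [leRHS](_ : _ = n%:R * (16 / (a n / a m) `^ (alpha / 2) * V (a m))); last by ring.
    by rewrite ler_wpM2l.
  rewrite [leLHS](_ : _ = c1 * (a n / a m) `^ (alpha / 2) * m%:R); last by ring.
  apply: (le_trans (ler_wpM2r _ h2)) => //.
  rewrite [leLHS](_ : _ = n%:R * 16 * (m%:R * V (a m))); last by ring.
  rewrite [leRHS](_ : _ = n%:R * 16 * c2); last by ring.
  by rewrite ler_wpM2l.
have nm0 : 0 <= n%:R / m%:R :> R by exact: le_trans nm1.
rewrite -ler_pdivrMr//.
have -> : a n / a m = ((a n / a m) `^ (alpha / 2)) `^ (2 / alpha).
  rewrite -powRrM (_ : alpha / 2 * (2 / alpha) = 1) ?powRr1 ?(ltW rp)//.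
  by field; rewrite gt_eqF.
apply: (@le_trans _ _ ((B * (n%:R / m%:R)) `^ (2 / alpha))).
  by apply: ge0_ler_powR; rewrite ?nnegrE ?powR_ge0 ?(mulr_ge0 B0) ?divr_ge0 ?(ltW alpha_gt0).
rewrite powRM ?(le_trans _ B1)// ler_wpM2l ?powR_ge0//.
rewrite -powR_mulrn//; apply: ler_powR => //.
by apply: ltW; exact: truncnS_gt.
Qed.

End scales.

(** * Moments of one coordinate *)

Section coordinate_moments.
Context {R : realType} {d : nat} {dO : measure_display} {Omega : measurableType dO}.
Variables (P : probability Omega R) (X : nat -> Omega -> 'rV[int]_d).
Hypothesis hX : iid discrete_sets P X.
Variable i : 'I_d.

Local Notation EX := (step_exp P X i).

Lemma step_fun_meas (F : int -> R) : measurable_fun setT (fun w => F (X 0%N w 0 i)).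
Proof.
by move=> _ B mB; rewrite setTI; exact: (@step_rv _ _ _ _ P X hX 0%N [set z | B (F (z 0 i))]).
Qed.

Lemma EX_integral F : bdd F -> (\int[P]_w (F (X 0%N w 0 i))%:E = (EX F)%:E)%E.
Proof.
move=> bF; rewrite /EX ErE fineK//; apply: integrable_fin_num => //.
by apply: bmf_integrable; exact: (bdd_bmf hX i bF).
Qed.

Lemma abs_le_trunc (k : int) (x : R) : 0 <= x -> (`|k%:~R| <= x) = (`|k| <= Num.truncn x)%N.
Proof.
by move=> x0; rewrite truncn_ge_nat// -intr_norm -[`|k|%R]abszE -pmulrn.
Qed.

Lemma trunc_second_momentE x : 0 <= x -> trunc_second_moment P X i x = mom2 P X i (Num.truncn x).
Proof.
move=> x0; rewrite /trunc_second_moment /mom2 /step_exp /Er; congr (fine 'E_P[_]%E); apply/funext => w.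
by rewrite /step_coord abs_le_trunc.
Qed.

Lemma trunc_meanE x : 0 <= x -> trunc_mean P X i x = mom1 P X i (Num.truncn x).
Proof.
move=> x0; rewrite /trunc_mean /mom1 /step_exp /Er; congr (fine 'E_P[_]%E); apply/funext => w.
by rewrite /step_coord abs_le_trunc.
Qed.

Lemma EX_event (B : pred int) : EX (fun j => (B j)%:R) = fine (P [set w | B (X 0%N w 0 i)]).
Proof.
rewrite -Er_indic; last exact: (@step_rv _ _ _ _ P X hX 0%N [set z | B (z 0 i)]).
congr (Er P _); apply/funext => w; rewrite indicE; congr (_%:R); congr nat_of_bool.
by apply/idP/idP; rewrite inE.
Qed.

Lemma right_tailE (x : R) : fine (right_tail P X i x) = EX (fun j => (x < j%:~R)%R%:R).
Proof. by rewrite (EX_event (fun j => x < j%:~R)). Qed.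

Lemma left_tailE (x : R) : fine (left_tail P X i x) = EX (fun j => (j%:~R <= - x)%R%:R).
Proof. by rewrite (EX_event (fun j => j%:~R <= - x)). Qed.

Lemma tails_fin x : left_tail P X i x \is a fin_num /\ right_tail P X i x \is a fin_num.
Proof.
by split; apply: fin_num_measure;
  [exact: (@step_rv _ _ _ _ P X hX 0%N [set z | (z 0 i)%:~R <= - x])
  |exact: (@step_rv _ _ _ _ P X hX 0%N [set z | x < (z 0 i)%:~R])].
Qed.

Lemma tail_le_sum (k : nat) : tail P X i k <= fine (left_tail P X i k%:R) + fine (right_tail P X i k%:R).
Proof.
rewrite left_tailE right_tailE -(EXD hX); [|exact: bdd_bool|exact: bdd_bool].
apply: (le_EX hX); [exact: bdd_bool|by apply: bddD; exact: bdd_bool|].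
move=> j; have [kj|_] := ltnP; last by rewrite addr_ge0.
have [kl|kl] := ltP (k%:R : R) j%:~R; first by rewrite lerDr.
rewrite addr0 ler1n lt0b -[- _]mulrN1 (_ : - 1 = (- 1)%:~R)// pmulrn -intrM ler_int.
by move: kl; rewrite pmulrn ler_int => kl; lia.
Qed.

(** The predecessor appears because the left tail includes the value -k. *)
Lemma sum_tails_le (k : nat) : (0 < k)%N ->
  fine (left_tail P X i k%:R) + fine (right_tail P X i k%:R) <= 2 * tail P X i k.-1.
Proof.
move=> k0; rewrite left_tailE right_tailE mulr_natl mulr2n.
have b (B : pred int) : (forall j, B j -> (k.-1 < `|j|)%N) -> EX (fun j => (B j)%:R) <= tail P X i k.-1.
  move=> hB; apply: (le_EX hX); [exact: bdd_bool|exact: bdd_bool|move=> j].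
  by case: (boolP (B j)) => // /hB ->.
apply: lerD; [apply: (b (fun j => j%:~R <= - k%:R))|apply: (b (fun j => k%:R < j%:~R))] => j.
  by rewrite pmulrn -[- _]mulrN1 (_ : - 1 = (- 1)%:~R)// -intrM ler_int => h; lia.
by rewrite pmulrn ltr_int => h; lia.
Qed.

Lemma EX_le_expectation (F H : int -> R) : bdd F -> (forall j, 0 <= F j <= H j) ->
  ((EX F)%:E <= 'E_P[fun w => H (X 0%N w 0%R i)])%E.
Proof.
move=> bF FH; rewrite unlock -EX_integral//.
apply: ge0_le_integral => //.
- by move=> w _; rewrite lee_fin; case/andP: (FH (X 0%N w 0 i)).
- by apply/measurable_EFinP; exact: step_fun_meas.
- by apply/measurable_EFinP; exact: step_fun_meas.
- by move=> w _; rewrite lee_fin; case/andP: (FH (X 0%N w 0 i)).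
Qed.

(** Bounded truncated absolute moments give integrability by monotone convergence, then dominated
    convergence identifies the limit. Integrability also ensures that the [fine] in [mean] is
    applied to a finite expectation. *)
Lemma mean_cvg (B : R) : (forall N, EX (fun j => `|j|%N%:R * (`|j| <= N)%N%:R) <= B) ->
  mom1 P X i N @[N --> \oo] --> mean P X i.
Proof.
move=> hB.
pose gN N w : \bar R := (`|X 0%N w 0%R i|%N%:R * (`|X 0%N w 0%R i| <= N)%N%:R)%:E.
pose fN N w : \bar R := ((X 0%N w 0 i)%:~R * (`|X 0%N w 0%R i| <= N)%N%:R)%:E.
have mg N : measurable_fun setT (gN N).
  by apply/measurable_EFinP; exact: (step_fun_meas (fun j => `|j|%N%:R * (`|j| <= N)%N%:R)).
have mf N : measurable_fun setT (fN N).
  by apply/measurable_EFinP; exact: (step_fun_meas (fun j => j%:~R * (`|j| <= N)%N%:R)).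
have mono := @cvg_monotone_convergence _ _ _ P setT measurableT gN mg
  (fun N w _ => ltac:(by rewrite /gN lee_fin mulr_ge0)).
have {}mono := mono (fun w _ N N' NN' => ltac:(by rewrite /gN lee_fin ler_wpM2l// ler_nat; case: (leqP _ N) => // h; rewrite (leq_trans h NN'))).
have lim_g w : limn (gN^~ w) = (`|X 0%N w 0%R i|%N%:R)%:E.
  apply/cvg_lim => //; apply: cvg_near_cst; near=> N.
  rewrite /gN; congr EFin; suff -> : (`|X 0%N w 0%R i| <= N)%N by rewrite mulr1.
  by near: N; exact: nbhs_infty_ge.
have int_abs : (\int[P]_w (`|X 0%N w 0%R i|%N%:R)%:E <= B%:E)%E.
  under eq_integral => w _ do rewrite -lim_g.
  rewrite -(cvg_lim _ mono)//; apply: lime_le; first by apply/cvg_ex; eexists; exact: mono.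
  apply: nearW => N.
  rewrite /gN (EX_integral (F := fun j => `|j|%N%:R * (`|j| <= N)%N%:R)); last exact: bdd_trunc.
  by rewrite lee_fin.
have int_g : P.-integrable setT (fun w => (`|X 0%N w 0%R i|%N%:R)%:E).
  apply/integrableP; split.
    by apply/measurable_EFinP; exact: (step_fun_meas (fun j => `|j|%N%:R)).
  apply: le_lt_trans (ltry B); apply: le_trans int_abs.
  by rewrite le_eqVlt; apply/orP; left; apply/eqP; apply: eq_integral => w _; rewrite gee0_abs// lee_fin.
have dom := @dominated_cvg _ _ _ P setT measurableT fN (fun w => (step_coord X i w)%:E)
  (fun w => (`|X 0%N w 0%R i|%N%:R)%:E) mf.
have {}dom : (\int[P]_w fN N w @[N --> \oo] --> \int[P]_w (step_coord X i w)%:E)%E.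
  apply: dom => //.
  - move=> w _; apply: cvg_near_cst; near=> N.
    rewrite /fN /step_coord; congr EFin; suff -> : (`|X 0%N w 0%R i| <= N)%N by rewrite mulr1.
    by near: N; exact: nbhs_infty_ge.
  - move=> N w _; rewrite /fN lee_fin normrM -intr_norm -[`|X _ _ _ _|%R]abszE -pmulrn.
    by rewrite ler_piMr//; case: (_ <= _)%N; rewrite ?normr1 ?normr0.
have fin_int : (\int[P]_w (step_coord X i w)%:E)%E \is a fin_num.
  apply: integrable_fin_num => //; apply: (le_integrable measurableT _ _ int_g).
    by apply/measurable_EFinP; exact: (step_fun_meas (fun j => j%:~R)).
  move=> w _; rewrite lee_fin /step_coord -intr_norm -[`|X _ _ _ _|%R]abszE -pmulrn.
  by rewrite ger0_norm.
have -> : mean P X i = fine (\int[P]_w (step_coord X i w)%:E)%E by rewrite /mean unlock.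
rewrite (_ : (fun N => _) = fine \o (fun N => \int[P]_w fN N w)%E); last first.
  apply/funext => N /=; rewrite /fN (EX_integral (F := fun j => j%:~R * (`|j| <= N)%N%:R))//.
  exact: bdd_trunc.
by apply: fine_cvg; rewrite fineK.
Unshelve. all: by end_near.
Qed.

Lemma mean_trunc (B : nat -> R) : (forall y N, (0 < y)%N -> ring_mean P X i y N <= B y) ->
  forall y, (0 < y)%N -> `|mom1 P X i y - mean P X i| <= B y.
Proof.
move=> hB y y0.
have bm (F : int -> R) k : bdd (fun j => F j * (`|j| <= k)%N%:R) by exact: bdd_trunc.
have cvg_m : mom1 P X i N @[N --> \oo] --> mean P X i.
  apply: (@mean_cvg (1 + B 1%N)) => N; rewrite -[X in X + B 1%N](EX_cst P X i 1).
  apply: (@le_trans _ _ (EX (fun=> 1) + ring_mean P X i 1 N)); last by rewrite lerD2l hB.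
  rewrite -(EXD hX)//; last exact: bdd_cst.
  apply: (le_EX hX) => //; first by apply: bddD => //; exact: bdd_cst.
  move=> j; have [j1|j1] := leqP `|j| 1.
    rewrite mulr0 mul0r addr0 (@le_trans _ _ (`|j|%N%:R))// ?lern1//.
    by rewrite ler_piMr// lern1 leq_b1.
  by rewrite mulr1 lerDr.
have near_y N : (y <= N)%N -> `|mom1 P X i y - mom1 P X i N| <= B y.
  move=> yN; apply: le_trans (hB y N y0).
  have -> : mom1 P X i y - mom1 P X i N = EX (fun j => (- j%:~R * (y < `|j|)%N%:R) * (`|j| <= N)%N%:R).
    rewrite -[- mom1 _ _ _ N]mulN1r /mom1 -(EXZ hX)// -(EXD hX)//; last exact: bddZ.
    congr step_exp; apply/funext => j; have [jy|yj] := leqP `|j| y.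
      by rewrite (leq_trans jy yN) mulr0 mul0r !mulr1; ring.
    by rewrite mulr0 add0r mulr1; ring.
  apply: (le_trans (Er_norm _ _)); first exact: (bdd_bmf hX i (bm (fun j => - j%:~R * (y < `|j|)%N%:R) N)).
  rewrite le_eqVlt; apply/orP; left; apply/eqP; congr (Er P _); apply/funext => w.
  rewrite !normrM normrN -intr_norm -[`|X _ _ _ _|%R]abszE -pmulrn.
  by rewrite [X in _ * X * _]ger0_norm// [X in _ * X]ger0_norm.
have c2 : `|mom1 P X i y - mom1 P X i N| @[N --> \oo] --> `|mom1 P X i y - mean P X i|.
  by apply: cvg_norm; apply: cvgB => //; exact: cvg_cst.
rewrite -(cvg_lim _ c2)//; apply: limr_le; first by apply/cvg_ex; eexists; exact: c2.
by near=> N; apply: near_y; near: N; exact: nbhs_infty_ge.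
Unshelve. all: by end_near.
Qed.

End coordinate_moments.

(** * Control of one coordinate *)

(** The finitely many remaining values are positive, and are absorbed by the sums of these values
    and of their inverses. *)
Lemma eventually_pinched (R : realType) (u : nat -> R) : (forall n, (0 < n)%N -> 0 < u n) ->
  (\forall n \near \oo, 2^-1 <= u n <= 2) ->
  exists c1 c2, 0 < c1 /\ forall n, (0 < n)%N -> c1 <= u n <= c2.
Proof.
move=> u0 [N0 _ hN].
pose S1 := \sum_(0 <= n < N0) `|u n|; pose S2 := \sum_(0 <= n < N0) `|(u n)^-1|.
have S10 : 0 <= S1 by apply: sumr_ge0.
have S20 : 0 <= S2 by apply: sumr_ge0.
exists (2 + S2)^-1, (2 + S1); split=> [|n n0]; first by rewrite invr_gt0 ltr_wpDr.
have un := u0 n n0.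
have [nN|Nn] := ltnP n N0.
  have h1 : u n <= S1.
    rewrite /S1 big_mkord (bigD1 (Ordinal nN))//= (le_trans (ler_norm _))// lerDl.
    exact: sumr_ge0.
  have h2 : (u n)^-1 <= S2.
    rewrite /S2 big_mkord (bigD1 (Ordinal nN))//= (le_trans (ler_norm _))// lerDl.
    exact: sumr_ge0.
  apply/andP; split; last by rewrite (le_trans h1)// lerDr.
  by rewrite -[leRHS]invrK lef_pV2 ?posrE ?invr_gt0 ?ltr_wpDr// (le_trans h2)// lerDr.
have /andP[h1 h2] := hN n Nn.
apply/andP; split; last by rewrite (le_trans h2)// lerDl.
by apply: le_trans h1; rewrite lef_pV2 ?posrE ?ltr_wpDr// lerDl.
Qed.

Section coordinate.
Context {R : realType} {d : nat} {dO : measure_display} {Omega : measurableType dO}.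
Variables (P : probability Omega R) (X : nat -> Omega -> 'rV[int]_d).
Hypothesis hX : iid discrete_sets P X.
Variable i : 'I_d.
Variables (alpha p q gamma : R) (L phi : R -> R) (a : nat -> R).
Hypothesis halpha : 0 < alpha <= 2.
Local Notation sigma := (trunc_second_moment P X i).
Hypothesis htails : (alpha < 2 ->
      [/\ slowly_varying L, forall x, 0 < x -> 0 < L x,
          [/\ 0 <= p, 0 <= q & p + q = 1],
          fine (right_tail P X i x) / (L x * x `^ (- alpha)) @[x --> +oo] --> p &
          fine (left_tail P X i x) / (L x * x `^ (- alpha)) @[x --> +oo] --> q]) /\
    (alpha = 2 -> slowly_varying sigma).
Hypothesis ha : [/\ forall n, (0 < n)%N -> 0 < a n,
        alpha < 2 -> n%:R * (L (a n) * a n `^ (- alpha)) @[n --> \oo] --> (1 : R) &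
        alpha = 2 -> n%:R * (sigma (a n) * (a n) ^- 2) @[n --> \oo] --> (1 : R)].
Hypothesis a_cvgy : a @ \oo --> +oo.
Hypothesis hphi : [/\ slowly_varying phi /\ (forall x, 0 <= x -> 0 < phi x),
        alpha <= gamma,
        forall k : nat, (0 < k)%N ->
          (left_tail P X i k%:R + right_tail P X i k%:R <= (phi k%:R * k%:R `^ (- gamma))%:E)%E,
        second_moment P X i = +oo%E ->
          [/\ gamma = alpha,
              alpha < 2 -> exists c : R, forall x, 0 < x -> phi x = c * L x &
              alpha = 2 -> exists K : R, \forall x \near +oo, phi x <= K * sigma x] &
        (second_moment P X i < +oo)%E ->
          (\sum_(1 <= n <oo) (phi n%:R * n%:R `^ (1 - gamma))%:E < +oo)%E].

Let alpha_gt0 : 0 < alpha. Proof. by case/andP: halpha. Qed.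

Let alpha_le2 : alpha <= 2. Proof. by case/andP: halpha. Qed.

(** One slowly varying function for both regimes: with V x = f0 x x^(-alpha), n V(a_n) tends to 1 in
    all cases. *)
Let f0 (x : R) := if alpha < 2 then L x else sigma x.

Let alpha2 : (alpha < 2) = false -> alpha = 2.
Proof. by move=> h; apply/eqP; rewrite eq_le alpha_le2 /= leNgt h. Qed.

Let f0_sv : slowly_varying f0.
Proof.
rewrite /f0; have [h1 h2] := htails.
case: (boolP (alpha < 2)) => al; first by have [] := h1 al.
by apply: h2; apply: alpha2; exact/negbTE.
Qed.

Let V := rv f0 alpha.

Let V_powR2 x : 0 <= x -> alpha = 2 -> V x = sigma x * x ^- 2.
Proof.
by move=> x0 al; rewrite /V /rv /f0 al ltxx powRN -[in RHS]powR_mulrn.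
Qed.

Let nV_cvg : n%:R * V (a n) @[n --> \oo] --> (1 : R).
Proof.
have [an0 h1 h2] := ha.
have [al|al] := ltP alpha 2.
  by rewrite /V /rv /f0 al; exact: h1.
have al2 : alpha = 2 by apply: alpha2; rewrite ltNge al.
apply: cvg_trans (h2 al2); apply: near_eq_cvg; near=> n.
rewrite V_powR2//; apply: ltW; apply: an0; near: n; exact: nbhs_infty_gt.
Unshelve. all: by end_near.
Qed.

Lemma EX_sqr_tail_le k : (second_moment P X i < +oo)%E ->
  k%:R ^+ 2 * tail P X i k.-1 <= fine (second_moment P X i).
Proof.
move=> fin.
have F0 : (0 <= second_moment P X i)%E.
  by rewrite /second_moment unlock; apply: integral_ge0 => w _; rewrite lee_fin sqr_ge0.
have Ffin : second_moment P X i \is a fin_num by rewrite ge0_fin_numE.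
rewrite -lee_fin fineK// /tail -(EXZ hX); last exact: bdd_bool.
apply: (le_trans (@EX_le_expectation _ _ _ _ P X hX i _ (fun j => j%:~R ^+ 2) _ _)) => //.
  by apply: bddZ; exact: bdd_bool.
move=> j; rewrite mulr_ge0 ?sqr_ge0//=; have [kj|_] := ltnP; last by rewrite mulr0 sqr_ge0.
rewrite mulr1 -[leRHS]real_normK ?num_real//; apply: lerXn2r; rewrite ?nnegrE//.
rewrite -intr_norm -[`|j|%R]abszE -pmulrn ler_nat; move: kj; case: k => //.
Qed.

(** Chebyshev's inequality would bound k^2 V(k), which by Potter grows at least like k^((2 - alpha)
    / 2). This gives access to gamma = alpha and to the relation between phi and L. *)
Lemma infinite_second_moment : alpha < 2 -> second_moment P X i = +oo%E.
Proof.
move=> al; have [h _] := htails; have [Lsv L0 [p0 q0 pq1] hr hl] := h al.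
have [//|fin] := eqVneq (second_moment P X i) +oo%E; exfalso.
have {}fin : (second_moment P X i < +oo)%E by rewrite ltey.
set S := fine (second_moment P X i).
have al0 : 0 < 2 - alpha by rewrite subr_gt0.
have [xL xL1 hV] := rv_potter alpha Lsv (divr_gt0 al0 (ltr0n _ 2)).
have hsum : (fine (left_tail P X i x) + fine (right_tail P X i x)) / rv L alpha x @[x --> +oo] --> (1 : R).
  rewrite -pq1 [p + q]addrC.
  have -> : (fun x => (fine (left_tail P X i x) + fine (right_tail P X i x)) / rv L alpha x) =
    (fun x => fine (left_tail P X i x) / (L x * x `^ (- alpha)) + fine (right_tail P X i x) / (L x * x `^ (- alpha))).
    by apply/funext => x; rewrite mulrDl.
  exact: cvgD.
have [x1 [_ hx1]] : \forall x \near +oo, 2^-1 <= (fine (left_tail P X i x) + fine (right_tail P X i x)) / rv L alpha x.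
  by apply: (cvgr_ge (1 : R)) => //; rewrite invf_lt1// ltr1n.
have [Vx _ _] := hV xL xL (lexx _) (lexx _).
pose B := 4 * S * 16 * xL `^ (- ((2 - alpha) / 2 + alpha)) / rv L alpha xL.
have [M M2 hM] := powR_choose (B + 1) (divr_gt0 al0 (ltr0n _ 2)).
pose k := (M + (Num.truncn xL).+1 + (Num.truncn `|x1|).+1)%N.
have xL0 : 0 < xL by exact: lt_le_trans xL1.
have kM : M%:R <= k%:R :> R by rewrite ler_nat /k -addnA leq_addr.
have kL : xL <= k%:R.
  by apply: (le_trans (ltW (truncnS_gt _))); rewrite ler_nat /k addnAC leq_addl.
have kx1 : x1 < k%:R.
  apply: (le_lt_trans (ler_norm _)); apply: (lt_le_trans (truncnS_gt _)).
  by rewrite ler_nat /k leq_addl.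
have k0 : (0 < k)%N by rewrite -(ltr_nat R) (lt_le_trans xL0).
have k0R : 0 < k%:R :> R by rewrite ltr0n.
have [Vk _ hVk] := hV xL k%:R (lexx _) kL.
have [Vk0 _ _] := hV k%:R k%:R kL (lexx _).
have h1 := hx1 k%:R kx1; rewrite ler_pdivlMr// in h1.
have h2 := le_trans h1 (sum_tails_le hX i k0).
have h3 := EX_sqr_tail_le k fin.
have h4 : k%:R ^+ 2 * rv L alpha k%:R <= 4 * S.
  have : k%:R ^+ 2 * (2^-1 * rv L alpha k%:R) <= k%:R ^+ 2 * (2 * tail P X i k.-1) by rewrite ler_wpM2l ?exprn_ge0.
  rewrite /S; lra.
have h5 : k%:R `^ ((2 - alpha) / 2) <= B.
  rewrite /B ler_pdivlMr; last exact: Vx.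
  have kk : k%:R `^ ((2 - alpha) / 2) * k%:R `^ ((2 - alpha) / 2 + alpha) = k%:R ^+ 2 :> R.
    by rewrite -powRD ?(gt_eqF k0R) ?implybT//; rewrite -powR_mulrn//; congr (_ `^ _); field.
  apply: (@le_trans _ _ (k%:R `^ ((2 - alpha) / 2) * (16 * (k%:R / xL) `^ ((2 - alpha) / 2 + alpha) * rv L alpha k%:R))).
    by rewrite ler_wpM2l ?powR_ge0.
  have -> : (k%:R / xL) `^ ((2 - alpha) / 2 + alpha) = k%:R `^ ((2 - alpha) / 2 + alpha) * xL `^ (- ((2 - alpha) / 2 + alpha)).
    rewrite powRM ?invr_ge0 ?(ltW xL0)//; congr (_ * _).
    by rewrite -[X in X `^ _]powR_inv1 ?(ltW xL0)// -powRrM mulN1r.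
  rewrite [leLHS](_ : _ = (k%:R ^+ 2 * rv L alpha k%:R) * (16 * xL `^ (- ((2 - alpha) / 2 + alpha)))); last first.
    by rewrite -kk; ring.
  rewrite [leRHS](_ : _ = 4 * S * (16 * xL `^ (- ((2 - alpha) / 2 + alpha)))); last by ring.
  by rewrite ler_wpM2r// mulr_ge0 ?powR_ge0.
have h6 : M%:R `^ ((2 - alpha) / 2) <= k%:R `^ ((2 - alpha) / 2).
  by apply: ge0_ler_powR; rewrite ?nnegrE// divr_ge0// ltW.
lra.
Qed.

Lemma gamma_eq : alpha < 2 -> gamma = alpha.
Proof.
by move=> al; have [_ _ _ h _] := hphi; have [] := h (infinite_second_moment al).
Qed.

(** Room left to the Potter exponent by each moment estimate: the first moment for alpha < 1, the
    moment of order 5/4 for alpha = 1, the discarded part of the mean for alpha > 1, the second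
    moment for alpha < 2. *)
Lemma delta_exists : exists delta : R, [/\ 0 < delta, delta <= gamma &
  [/\ alpha < 1 -> gamma + delta < 1, alpha = 1 -> gamma + delta < 5 / 4,
      1 < alpha -> 1 < gamma - delta & alpha < 2 -> gamma + delta < 2]].
Proof.
have [_ ag _ _ _] := hphi; have al0 := alpha_gt0.
have [al1|al1|al1] := ltgtP alpha 1.
- have := gamma_eq (lt_trans al1 (ltr1n _ 2)) => gE.
  have [m|/ltW m] := leP (alpha / 2) ((1 - alpha) / 2).
    by exists (alpha / 2); split; [lra|lra|split=> // ?; lra].
  by exists ((1 - alpha) / 2); split; [lra|lra|split=> // ?; lra].
- have [al2|al2] := ltP alpha 2.
    have gE := gamma_eq al2.
    have [m|/ltW m] := leP ((alpha - 1) / 2) ((2 - alpha) / 2).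
      by exists ((alpha - 1) / 2 / 2); split; [lra|lra|split=> // ?; lra].
    by exists ((2 - alpha) / 2 / 2); split; [lra|lra|split=> // ?; lra].
  by exists ((alpha - 1) / 2); split; [lra|lra|split=> // ?; lra].
- have gE := gamma_eq ltac:(rewrite al1; exact: ltr1n).
  by exists (1 / 8); split; [lra|lra|split=> // ?; lra].
Qed.

Let phi_pos k : 0 < phi k%:R.
Proof. by have [[_ h] _ _ _ _] := hphi; exact: h. Qed.

(** In the summable series of n T(n), the terms with n between y / 2 and y are all at least of order
    y T(y). *)
Lemma summable_tail_bound (T : nat -> R) (x0 : nat) : (0 < x0)%N -> (forall k, 0 < T k) ->
  (forall u v, (u <= v)%N -> T v <= 16 * T u) -> (forall k, (x0 <= k)%N -> T k = rv phi gamma k%:R) ->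
  (second_moment P X i < +oo)%E -> exists B, forall y, (2 * x0 <= y)%N -> y%:R ^+ 2 * T y <= B.
Proof.
move=> x00 T0 Td TE fin; have [_ _ _ _ h] := hphi; have {}h := h fin.
pose F n := phi n%:R * n%:R `^ (1 - gamma).
have F0 n : 0 <= F n by rewrite mulr_ge0 ?powR_ge0// ltW.
pose S := (\sum_(1 <= n <oo) (F n)%:E)%E.
have S0 : (0 <= S)%E by apply: nneseries_ge0 => n _ _; rewrite lee_fin.
have Sfin : S \is a fin_num by rewrite ge0_fin_numE.
(* 128 = 2 * 4 * 16: at least y / 2 terms, n >= y / 4, and almost monotonicity. *)
exists (128 * fine S) => y xy.
pose m := (y - y./2)%N.
have y20 : (x0 <= y./2)%N by rewrite -[x0]doubleK half_leq// -mul2n.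
have ymE : (y./2 + m = y)%N by rewrite /m subnKC// -divn2 leq_div.
have part : \sum_(y./2 <= n < y) F n <= fine S.
  rewrite -lee_fin fineK// -sumEFin.
  apply: le_trans (@nneseries_lim_ge _ (fun n => (F n)%:E) xpredT 1 y _); last first.
    by move=> n _ _; rewrite lee_fin.
  rewrite [leRHS](@big_cat_nat _ _ _ y./2)/=.
  - by rewrite leeDr// sume_ge0// => n _; rewrite lee_fin.
  - by rewrite (leq_trans x00).
  - exact: (leq_trans (leq_addr m _) (eq_leq ymE)).
have low n : (y./2 <= n < y)%N -> (y%:R / 4) * T y / 16 <= F n.
  move=> /andP[yn ny].
  have n0 : (0 < n)%N by rewrite (leq_trans x00)// (leq_trans y20).
  have nR : 0 < n%:R :> R by rewrite ltr0n.
  have -> : F n = n%:R * T n.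
    rewrite TE ?(leq_trans y20)// /rv /F mulrCA; congr (_ * _).
    by rewrite powRD ?(gt_eqF nR) ?implybT// powRr1// ltW.
  rewrite -mulrA; apply: ler_pM => //.
  - by rewrite divr_ge0// ltW.
  - rewrite ler_pdivrMr// -natrM ler_nat; have := odd_double_half y; rewrite -mul2n.
    by case: (odd y); move: yn y20 x00; move: (y./2) => z; clear; lia.
  - by rewrite ler_pdivrMr// mulrC; apply: Td; exact: ltnW.
have : \sum_(y./2 <= n < y) (y%:R / 4 * T y / 16) <= \sum_(y./2 <= n < y) F n.
  by apply: ler_sum_nat => n nn; exact: low.
rewrite sumr_const_nat => h1.
have h2 : y%:R / 2 <= m%:R :> R.
  rewrite ler_pdivrMr// -natrM ler_nat /m; have := odd_double_half y; rewrite -mul2n.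
  by case: (odd y); move: (y./2) => z; clear; lia.
have h3 : (y%:R / 2) * (y%:R / 4 * T y / 16) <= fine S.
  apply: le_trans part; apply: le_trans h1; rewrite -[leRHS]mulr_natl ler_wpM2r// !mulr_ge0// ltW//.
have -> : y%:R ^+ 2 * T y = 128 * ((y%:R / 2) * (y%:R / 4 * T y / 16)) by field.
by rewrite ler_wpM2l.
Qed.

(** Beyond a large multiple of the scale n T is small, so an error C y T(y) in each of n steps is
    negligible against y. *)
Lemma scale_mean_zero (T a' : nat -> R) (C : R) : 0 < C ->
  (forall e, 0 < e -> exists2 C0, 1 <= C0 & forall n x, (0 < n)%N -> C0 * a' n <= x%:R -> n%:R * T x <= e) ->
  forall D : nat -> R, (forall y, (0 < y)%N -> `|D y| <= C * y%:R * T y) ->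
  (forall n, 1 <= a' n) ->
  forall e, 0 < e -> exists C0, forall n y, (0 < n)%N -> C0 * a' n <= y%:R -> n%:R * `|D y| <= e * y%:R.
Proof.
move=> C0 small D hD a1 e e0.
have [K K1 hK] := small (e / C) (divr_gt0 e0 C0).
exists K => n y n0 Ky.
have y0 : (0 < y)%N.
  rewrite -(ltr_nat R); apply: lt_le_trans Ky; rewrite mulr_gt0 ?(lt_le_trans _ K1) ?(lt_le_trans _ (a1 n))//.
have := hK n y n0 Ky; rewrite ler_pdivlMr// => h1.
apply: (le_trans (ler_wpM2l _ (hD y y0))) => //.
rewrite [leLHS](_ : _ = n%:R * T y * C * y%:R); last by ring.
by rewrite ler_wpM2r.
Qed.

(** The interface between one coordinate and the multivariate argument. All scales are
    [Num.max (a n) A0], above the Potter thresholds; [T] is equivalent to the tail bound given by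
    [phi]; [be n] is a drift per step, so that [n%:R * be n] is the prescribed centring up to the
    order of the scale. *)
Record coordinate_control (A0 C : R) (T : nat -> R) (p0 : nat) : Prop := CoordinateControl {
  cc_A0 : 1 <= A0;
  cc_C : 0 <= C;
  cc_gt0 : forall k, 0 < T k;
  cc_dec : forall u v, (u <= v)%N -> T v <= 16 * T u;
  cc_div : forall q, (0 < q)%N -> exists C' : R, forall x : nat, T (x %/ q)%N <= C' * T x;
  cc_pow : forall p n x, (p0 <= p)%N -> (0 < n)%N -> Num.max (a n) A0 <= x%:R ->
    (n%:R * T x) ^+ p * x%:R <= C ^+ p * Num.max (a n) A0;
  cc_low : alpha != 2 -> forall K : R, exists2 c : R, 0 < c & forall n x, (0 < n)%N ->
    x%:R <= K * Num.max (a n) A0 -> c <= n%:R * T x;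
  cc_growth : exists (Cg : R) (kap : nat), 1 <= Cg /\ forall m n, (0 < m)%N -> (m <= n)%N ->
    Num.max (a n) A0 <= Cg * (n%:R / m%:R) ^+ kap * Num.max (a m) A0;
  cc_phi0 : forall k, phi k%:R * (1 + k%:R) `^ (- gamma) <= C * T k;
  cc_phi : forall k, (0 < k)%N -> T k <= C * (phi k%:R * k%:R `^ (- gamma));
  cc_mean : exists be : nat -> R, [/\ forall n, (0 < n)%N -> `|be n| <= C * Num.max (a n) A0,
    forall n, (0 < n)%N -> `|n%:R * be n - (if alpha < 1 then 0 else if alpha == 1 then n%:R * trunc_mean P X i (a n)
      else n%:R * mean P X i)| <= C * Num.max (a n) A0 &
    forall p, (0 < p)%N -> exists (q : nat) (C0 C c : R), [/\ (0 < q)%N, 0 < C, 0 < c &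
      forall M n m (x : nat) q', (0 < n)%N -> (m <= n)%N -> C0 * Num.max (a n) A0 <= x%:R -> (q <= q')%N ->
      Ex (@pt d M) (@smallw _ _ _ _ P X i M (x %/ q')) m (fun z => (x%:R / 4 <= `|(z 0 i)%:~R - m%:R * be n|)%R%:R) <=
      C * ((n%:R * T x) ^+ p + expR (- c * (x%:R / Num.max (a n) A0) ^+ 2) * (alpha == 2)%:R)]] }.

Lemma coordinate_facts : exists A0 C T p0, coordinate_control A0 C T p0.
Proof.
have [[phi_sv phi0] ag hdom hinf hfin] := hphi.
have [a0 _ _] := ha.
have [delta [d0 dg [d1 d2 d3 d4]]] := delta_exists.
have g0 : 0 < gamma by exact: lt_le_trans alpha_gt0 ag.
have [xT xT1 hT] := rv_potter gamma phi_sv d0.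
pose x0 := (Num.truncn xT).+1.
have xTx0 : xT <= x0%:R by apply: ltW; exact: truncnS_gt.
(* Frozen below the Potter threshold, so that [T] is positive and almost decreasing on all integers,
   0 included. *)
pose T k := rv phi gamma (maxn k x0)%:R.
have TE k : (x0 <= k)%N -> T k = rv phi gamma k%:R by move=> h; rewrite /T (maxn_idPl h).
have x00 : (0 < x0)%N by [].
have T_pot u v : (x0 <= u)%N -> (u <= v)%N ->
  [/\ 0 < T u, T v <= 16 * (v%:R / u%:R) `^ (delta - gamma) * T u
    & T u <= 16 * (v%:R / u%:R) `^ (delta + gamma) * T v].
  move=> xu uv; rewrite !TE ?(leq_trans xu)//; apply: hT; last by rewrite ler_nat.
  by apply: (le_trans xTx0); rewrite ler_nat.
have T_low k : (k <= x0)%N -> T k = T x0 by move=> h; rewrite /T (maxn_idPr h) maxnn.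
have T0 := quasi_gt0 T_pot T_low.
have Td := quasi_dec x00 dg T_pot T_low.
have Tdiv := quasi_div x00 d0 dg T_pot T_low.
have [xV xV1 hV] := rv_potter alpha f0_sv (divr_gt0 alpha_gt0 (ltr0n _ 2)).
(* Three cases: for alpha < 2, phi is a multiple of L; for alpha = 2 with infinite variance, phi is
   O(sigma); with finite variance, y^2 T(y) is bounded while sigma is bounded below. *)
have [x1 [CV [cT [cT0 T_le T_ge]]]] : exists (x1 : nat) (CV cT : R), [/\ 0 < cT,
    forall k, (x1 <= k)%N -> T k <= CV * V k%:R &
    alpha < 2 -> forall k, (x1 <= k)%N -> cT * V k%:R <= T k].
  have [al|al] := ltP alpha 2.
    have [gE hc _] := hinf (infinite_second_moment al); have [c hc'] := hc al.
    have [hL _] := htails; have [_ L0 _ _ _] := hL al.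
    have c0 : 0 < c.
      have := phi0 1 ler01; rewrite hc'// pmulr_lgt0//; exact: L0.
    have E k : (x0 <= k)%N -> T k = c * V k%:R.
      move=> xk; rewrite TE// /V /rv /f0 al hc' ?gE ?mulrA// ltr0n; exact: leq_trans xk.
    by exists x0, c, c; split=> [//|k xk|_ k xk]; rewrite E.
  have al2 : alpha = 2 by apply: alpha2; rewrite ltNge al.
  have [inf2|fin2] := eqVneq (second_moment P X i) +oo%E.
    have [gE _ hK] := hinf inf2; have [K [xK [_ hK']]] := hK al2.
    exists (maxn x0 (Num.truncn `|xK|).+1), K, 1; split=> // k.
    rewrite geq_max => /andP[xk xKk]; rewrite TE// /V /rv /f0 al2 ltxx gE al2 mulrA ler_wpM2r ?powR_ge0//.
    apply: hK'; apply: (le_lt_trans (ler_norm _)); apply: (lt_le_trans (truncnS_gt _)).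
    by rewrite ler_nat.
  have {}fin2 : (second_moment P X i < +oo)%E by rewrite ltey.
  have [B hB] := summable_tail_bound x00 T0 Td TE fin2.
  pose x2 := (Num.truncn xV).+1.
  have xVx2 : xV <= x2%:R by apply: ltW; exact: truncnS_gt.
  have [V2 _ _] := hV x2%:R x2%:R xVx2 (lexx _).
  have x2R : 0 < x2%:R :> R by [].
  have s0 : 0 < mom2 P X i x2.
    move: V2; rewrite -/V V_powR2// trunc_second_momentE// natrK.
    by rewrite pmulr_lgt0// invr_gt0 exprn_gt0.
  exists (maxn (2 * x0) x2), (B / mom2 P X i x2), 1; split=> // k.
  rewrite geq_max => /andP[xk x2k].
  have k0 : 0 < k%:R :> R by rewrite ltr0n (leq_trans _ x2k).
  rewrite V_powR2 ?(ltW k0)// trunc_second_momentE ?(ltW k0)// natrK.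
  have hk := hB k xk.
  have B0 : 0 <= B by apply: le_trans hk; rewrite mulr_ge0// ltW.
  have m2 : mom2 P X i x2 <= mom2 P X i k.
    apply: (le_EX hX); [exact: bdd_trunc|exact: bdd_trunc|move=> j].
    by rewrite ler_wpM2l ?sqr_ge0// ler_nat; case: (leqP `|j| x2) => // h; rewrite (leq_trans h).
  rewrite mulrA ler_pdivlMr ?exprn_gt0// [leLHS]mulrC; apply: (le_trans hk).
  by rewrite mulrAC ler_pdivlMr// ler_wpM2l.
(* Above [A0] both Potter's bounds for V and the comparison of T with V hold. *)
pose A0 := Num.max xV x1%:R.
have A01 : 1 <= A0 by rewrite le_max xV1.
pose a' n := Num.max (a n) A0.
have a'_xV n : xV <= a' n by rewrite /a' !le_max lexx orbT.
have a'_x1 n : x1%:R <= a' n by rewrite /a' !le_max lexx !orbT.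
have a'1 n : 1 <= a' n by exact: le_trans (a'_xV n).
have a'0 n : 0 < a' n by exact: lt_le_trans (a'1 n).
have a_A0 : \forall n \near \oo, A0 <= a n by move/cvgryPge: a_cvgy; apply.
have [c1 [c2 [c10 nV]]] : exists c1 c2, 0 < c1 /\ forall n, (0 < n)%N -> c1 <= n%:R * V (a' n) <= c2.
  apply: eventually_pinched => [n n0|].
    by rewrite mulr_gt0 ?ltr0n//; case: (hV _ _ (a'_xV n) (lexx _)).
  near=> n; have aA : A0 <= a n by near: n.
  have -> : a' n = a n by apply/max_idPl.
  apply/andP; split; near: n.
    by apply: (cvgr_ge (1 : R)) => //; rewrite invf_lt1// ltr1n.
  by apply: (cvgr_le (1 : R)) => //; rewrite ltr1n.
have small := scale_tail_small alpha_gt0 xV1 hV a'_xV a'_x1 c10 nV T0 T_le.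
have [Cp [p0 hp]] := scale_tail_power alpha_gt0 xV1 hV a'_xV a'_x1 c10 nV T0 T_le.
have [Cd Cd0 decay] := scale_tail_decay hV a'_xV a'_x1 c10 nV T0 T_le.
have low al := scale_tail_low alpha_gt0 xV1 hV a'_xV a'_x1 c10 nV Td cT0 (T_ge al).
have growth := scale_growth alpha_gt0 xV1 hV a'_xV c10 nV.
have tailT k : (x0 <= k)%N -> tail P X i k <= T k.
  move=> xk; have k0 : (0 < k)%N by exact: leq_trans xk.
  apply: (le_trans (tail_le_sum hX i k)).
  have [f1 f2] := tails_fin hX i (k%:R : R).
  by rewrite -lee_fin EFinD !fineK// TE//; exact: hdom.
pose CG := 1 + (T x0)^-1.
have CG0 : 0 < CG by rewrite addr_gt0 ?invr_gt0.
have tail_CG k : tail P X i k <= CG * T k.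
  have [xk|kx] := leqP x0 k.
    by apply: (le_trans (tailT k xk)); rewrite ler_peMl ?(ltW (T0 _))// lerDl invr_ge0 ltW.
  rewrite (T_low _ (ltnW kx)) mulrDl mul1r mulVf ?gt_eqF//.
  apply: (@le_trans _ _ 1); last by rewrite lerDr ltW.
  rewrite -(EX_cst P X i 1); apply: (le_EX hX); [exact: bdd_bool|exact: bdd_cst|].
  by move=> j; rewrite lern1 leq_b1.
have kar p := karamata x00 d0 dg T_pot T_low hX tail_CG (p := p).
have tmean := tail_mean x00 T_pot T_low hX tail_CG.
have bm (F : int -> R) k : bdd (fun j => F j * (`|j| <= k)%N%:R) by exact: bdd_trunc.
(* The truncation is at [a'] instead of [a]; the two centrings agree once [A0 <= a n], hence for all
   but finitely many n. *)
pose be n : R := if alpha < 1 then 0 else if alpha == 1 then trunc_mean P X i (a' n) else mean P X i.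
have mom1_abs k (F : int -> R) (B : R) : (forall j, `|F j| <= `|j|%N%:R) ->
    moment P X i 1 k <= B -> `|step_exp P X i (fun j => F j * (`|j| <= k)%N%:R)| <= B.
  move=> hF; apply: le_trans; apply: (le_trans (Er_norm _ _)); first exact: (bdd_bmf hX i (bm F k)).
  apply: le_Er; [apply: bmf_norm; exact: (bdd_bmf hX i (bm F k))|exact: (bdd_bmf hX i (bm (fun j => `|j|%N%:R `^ 1) k))|move=> w].
  by rewrite normrM [X in _ * X]ger0_norm// powRr1// ler_wpM2r.
(* The quantity to control is the truncated mean itself for alpha < 1, the discarded part of the
   mean for alpha > 1, and the part of the mean between the truncations at a' and y for alpha =
   1. *)
have mom1_le : forall e : R, 0 < e -> exists C0, forall n y, (0 < n)%N -> C0 * a' n <= y%:R ->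
    n%:R * `|mom1 P X i y - be n| <= e * y%:R.
  rewrite /be; have [al1|al1|al1] := ltgtP alpha 1.
  - have [C C0 hC] := kar 1 ltr01 (d1 al1).
    apply: (@scale_mean_zero T a' C C0 small (fun y => mom1 P X i y - 0)) => // y y0.
    rewrite subr0; apply: mom1_abs; last by have := hC y; rewrite powRr1.
    by move=> j; rewrite -intr_norm -[`|j|%R]abszE -pmulrn.
  - have [C C0 hC] := tmean (d3 al1).
    apply: (@scale_mean_zero T a' C C0 small (fun y => mom1 P X i y - mean P X i)) => // y y0.
    by apply: (mean_trunc hX (B := fun y => C * y%:R * T y)).
  - have [C C0 hC] := kar (5 / 4) ltac:(lra) (d2 al1).
    move=> e e0.
    have [M M2 hM] := powR_choose (C * Cd / e) (s := 1 / 4) ltac:(lra).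
    have M0 : 0 < M%:R :> R by rewrite ltr0n ltnW.
    exists M%:R => n y n0 My.
    have ay : a' n <= y%:R by apply: le_trans My; rewrite ler_peMl ?(ltW (a'0 _))// ler1n ltnW.
    have y0 : 0 < y%:R :> R by exact: lt_le_trans ay.
    rewrite trunc_meanE ?(ltW (a'0 n))//.
    set z := Num.truncn (a' n).
    have zy : (z <= y)%N by rewrite -(ler_nat R); apply: le_trans ay; rewrite truncn_le// ltW.
    have az : a' n < z.+1%:R by exact: truncnS_gt.
    (* [a' < |xi|] gives [|xi| <= a'^(-1/4) |xi|^(5/4)], and 5/4 > gamma = 1 so that Karamata applies *)
    have split_z : `|mom1 P X i y - mom1 P X i z| <= a' n `^ (- (1 / 4)) * moment P X i (5 / 4) y.
      have -> : mom1 P X i y - mom1 P X i z = step_exp P X i (fun j => (j%:~R * (z < `|j|)%N%:R) * (`|j| <= y)%N%:R).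
        rewrite -[- mom1 _ _ _ z]mulN1r /mom1 -(EXZ hX)// -(EXD hX)//; last exact: bddZ.
        congr step_exp; apply/funext => j; have [jz|zj] := leqP `|j| z.
          by rewrite (leq_trans jz zy) mulr0 mul0r !mulr1; ring.
        by rewrite mulr0 mulr1; ring.
      apply: (le_trans (Er_norm _ _)); first exact: (bdd_bmf hX i (bm (fun j => j%:~R * (z < `|j|)%N%:R) y)).
      rewrite /moment -(EXZ hX)//; apply: le_Er.
      + by apply: bmf_norm; exact: (bdd_bmf hX i (bm (fun j => j%:~R * (z < `|j|)%N%:R) y)).
      + by apply: bmfZ; exact: (bdd_bmf hX i (bm (fun j => `|j|%N%:R `^ (5 / 4)) y)).
      move=> w; set j := X 0%N w 0 i; rewrite !normrM -intr_norm -[`|j|%R]abszE -pmulrn mulrA.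
      rewrite [X in _ * _ * X <= _]ger0_norm// [X in _ * X * _]ger0_norm//; apply: ler_wpM2r => //.
      have [zj|_] := ltnP z `|j|; last by rewrite mulr0 mulr_ge0 ?powR_ge0.
      rewrite mulr1 powRN mulrC ler_pdivlMr ?powR_gt0//.
      have aj : a' n <= `|j|%N%:R by apply: (le_trans (ltW az)); rewrite ler_nat.
      have j0 : 0 < `|j|%N%:R :> R by exact: lt_le_trans aj.
      have -> : `|j|%N%:R `^ (5 / 4) = `|j|%N%:R * `|j|%N%:R `^ (1 / 4) :> R.
        by rewrite -{2}[`|j|%N%:R](powRr1 (ltW j0)) -powRD ?(gt_eqF j0) ?implybT//; congr (_ `^ _); field.
      by rewrite ler_wpM2l//; apply: ge0_ler_powR; rewrite ?nnegrE ?(ltW (a'0 _)) ?(ltW j0)//; lra.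
    have h1 := le_trans split_z (ler_wpM2l (powR_ge0 _ _) (hC y)).
    apply: (le_trans (ler_wpM2l _ h1)) => //.
    have h2 := decay n y n0 ay; rewrite al1 in h2.
    have r0 : 0 < y%:R / a' n by rewrite divr_gt0.
    have E1 : y%:R `^ (5 / 4) = y%:R * ((y%:R / a' n) `^ (1 / 4) * a' n `^ (1 / 4)) :> R.
      by rewrite -(powR_ratio _ (a'0 n) y0) -{2}[y%:R](powRr1 (ltW y0)) -powRD ?(gt_eqF y0) ?implybT//; congr (_ `^ _); field.
    have E2 : a' n `^ (- (1 / 4)) * a' n `^ (1 / 4) = 1 by rewrite powRN mulVf// gt_eqF// powR_gt0.
    rewrite E1 [leLHS](_ : _ = (a' n `^ (- (1 / 4)) * a' n `^ (1 / 4)) * C * (y%:R / a' n) `^ (1 / 4) * y%:R * (n%:R * T y)); last by ring.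
    rewrite E2 mul1r; apply: (le_trans (ler_wpM2l _ h2)); first by rewrite !mulr_ge0 ?powR_ge0 ?(ltW C0).
    have E3 : (y%:R / a' n) `^ (1 / 4) * (y%:R / a' n) `^ (- (1 / 2)) = (y%:R / a' n) `^ (- (1 / 4)).
      by rewrite -powRD ?(gt_eqF r0) ?implybT//; congr (_ `^ _); field.
    rewrite [leLHS](_ : _ = C * Cd * ((y%:R / a' n) `^ (1 / 4) * (y%:R / a' n) `^ (- (1 / 2))) * y%:R); last by ring.
    have p4 : 0 < (y%:R / a' n) `^ (1 / 4) by exact: powR_gt0.
    rewrite E3 ler_wpM2r ?(ltW y0)// powRN (ler_pdivrMr _ _ p4) [leRHS]mulrC -ler_pdivrMr//.
    apply: (le_trans hM); apply: ge0_ler_powR; rewrite ?nnegrE ?(ltW r0)//.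
    by rewrite ler_pdivlMr.
have mom2_nongauss : exists C5, alpha != 2 -> forall k, mom2 P X i k <= C5 * k%:R ^+ 2 * T k.
  have [_|al2] := eqVneq alpha 2; first by exists 0.
  have al : alpha < 2 by rewrite lt_neqAle al2.
  have [C C0 hC] := kar 2 ltac:(lra) (d4 al).
  exists C => _ k; have := hC k; rewrite powR_mulrn//; apply: le_trans.
  rewrite le_eqVlt; apply/orP; left; apply/eqP; congr step_exp; apply/funext => j.
  by rewrite powR_mulrn// -[j%:~R ^+ 2]real_normK ?num_real// -intr_norm -[`|j|%R]abszE -pmulrn.
(* For alpha = 2 the truncated second moment at k is V(k) k^2: beyond the scale V is almost
   decreasing, and below it the moment is at most its value at the scale. *)
have mom2_gauss : exists C5, alpha == 2 -> forall n k, (0 < n)%N -> n%:R * mom2 P X i k <= C5 * (k%:R ^+ 2 + a' n ^+ 2).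
  exists (16 * c2) => /eqP al2 n k n0.
  have /andP[h1 h2] := nV n n0; have c20 : 0 < c2 by exact: lt_le_trans (le_trans h1 h2).
  have [Va hVa _] := hV _ _ (a'_xV n) (lexx _).
  have [ak|ka] := leP (a' n) k%:R.
    have k0 : 0 < k%:R :> R by exact: lt_le_trans ak.
    have [_ hVk _] := hV _ _ (a'_xV n) ak.
    have mE : mom2 P X i k = V k%:R * k%:R ^+ 2.
      by rewrite V_powR2// trunc_second_momentE// natrK divfK// expf_neq0// gt_eqF.
    rewrite mE; apply: (@le_trans _ _ (n%:R * (16 * V (a' n) * k%:R ^+ 2))).
      rewrite ler_wpM2l// ler_wpM2r ?sqr_ge0//; apply: (le_trans hVk).
      rewrite -/V ler_wpM2r ?(ltW Va)// ler_piMr//.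
      rewrite -[leRHS](powRr0 (k%:R / a' n)); apply: ler_powR; last by rewrite al2; lra.
      by rewrite ler_pdivlMr// mul1r.
    rewrite [leLHS](_ : _ = 16 * (n%:R * V (a' n)) * k%:R ^+ 2); last by ring.
    apply: (@le_trans _ _ (16 * c2 * k%:R ^+ 2)); first by rewrite ler_wpM2r ?sqr_ge0// ler_wpM2l.
    by rewrite ler_wpM2l ?mulr_ge0 ?(ltW c20)// lerDl sqr_ge0.
  have kz : (k <= Num.truncn (a' n))%N by rewrite truncn_ge_nat ?(ltW (a'0 n))// ltW.
  have m2 : mom2 P X i k <= mom2 P X i (Num.truncn (a' n)).
    apply: (le_EX hX) => // j.
    by rewrite ler_wpM2l ?sqr_ge0// ler_nat; case: (leqP `|j| k) => // h; rewrite (leq_trans h).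
  have mE : mom2 P X i (Num.truncn (a' n)) = V (a' n) * a' n ^+ 2.
    by rewrite V_powR2 ?(ltW (a'0 n))// trunc_second_momentE ?(ltW (a'0 n))// divfK// expf_neq0// gt_eqF.
  apply: (le_trans (ler_wpM2l _ m2)) => //; rewrite mE mulrA.
  apply: (@le_trans _ _ (c2 * a' n ^+ 2)); first by rewrite ler_wpM2r ?sqr_ge0.
  apply: (@le_trans _ _ (16 * c2 * a' n ^+ 2)).
    by rewrite ler_wpM2r ?sqr_ge0// ler_peMl ?(ltW c20)// ler1n.
  by rewrite ler_wpM2l ?mulr_ge0 ?(ltW c20)// lerDr sqr_ge0.
have [C5 hC5] := mom2_nongauss; have [C6 hC6] := mom2_gauss.
have be_le n : (0 < n)%N -> `|be n| <= (1 + `|mean P X i|) * a' n.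
  move=> n0; rewrite /be; case: ifP => _; first by rewrite normr0 mulr_ge0 ?addr_ge0 ?(ltW (a'0 n)).
  case: ifP => _; last first.
    apply: (@le_trans _ _ (1 + `|mean P X i|)); first by rewrite lerDr.
    by rewrite ler_peMr// addr_ge0.
  apply: (@le_trans _ _ (a' n)); last by rewrite ler_peMl ?(ltW (a'0 n))// lerDl.
  rewrite trunc_meanE ?(ltW (a'0 n))//; apply: mom1_abs => [j|].
    by rewrite -intr_norm -[`|j|%R]abszE -pmulrn.
  apply: (@le_trans _ _ (step_exp P X i (fun=> a' n))); last by rewrite EX_cst.
  apply: (le_EX hX) => //; first exact: bdd_cst.
  move=> j; rewrite powRr1//; case: leqP => jz; last by rewrite mulr0 ltW.
  by rewrite mulr1; apply: (@le_trans _ _ (Num.truncn (a' n))%:R); rewrite ?ler_nat// truncn_le// ltW.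
pose bn n : R := if alpha < 1 then 0 else if alpha == 1 then n%:R * trunc_mean P X i (a n) else n%:R * mean P X i.
have [Kb Kb0 hKb] : exists2 Kb, 0 <= Kb & forall n, (0 < n)%N -> `|n%:R * be n - bn n| <= Kb * a' n.
  have [N0 _ hN0] := a_A0.
  exists (\sum_(0 <= n < N0) `|n%:R * be n - bn n|) => [|n n0]; first exact: sumr_ge0.
  have [nN|Nn] := ltnP n N0.
    apply: (@le_trans _ _ (\sum_(0 <= n < N0) `|n%:R * be n - bn n|)).
      by rewrite big_mkord (bigD1 (Ordinal nN))//= lerDl sumr_ge0.
    by rewrite ler_peMr// sumr_ge0.
  have -> : n%:R * be n - bn n = 0.
    have aE : a' n = a n by apply/max_idPl; exact: hN0.
    by rewrite /be /bn aE; case: ifP => _; [rewrite mulr0 subrr|case: ifP => _; rewrite subrr].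
  by rewrite normr0 mulr_ge0 ?(ltW (a'0 n))// sumr_ge0.
pose ph k := phi k%:R * k%:R `^ (- gamma).
have ph0 k : (0 < k)%N -> 0 < ph k by move=> k0; rewrite mulr_gt0 ?powR_gt0 ?ltr0n.
have [Cf Cf1 hCf] : exists2 Cf, 1 <= Cf & forall k, (0 < k)%N -> T k <= Cf * ph k.
  exists (1 + \sum_(0 <= k < x0) `|T x0 / ph k|) => [|k k0]; first by rewrite lerDl sumr_ge0.
  have [xk|kx] := leqP x0 k.
    by rewrite TE// /rv -/(ph k) ler_peMl ?(ltW (ph0 _ k0))// lerDl sumr_ge0.
  rewrite (T_low _ (ltnW kx)) -ler_pdivrMr ?ph0// big_mkord (bigD1 (Ordinal kx))//=.
  by rewrite (le_trans (ler_norm _))// addrCA lerDl addr_ge0// sumr_ge0.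
have [Ch Ch1 hCh] : exists2 Ch, 1 <= Ch & forall k, phi k%:R * (1 + k%:R) `^ (- gamma) <= Ch * T k.
  exists (1 + \sum_(0 <= k < x0) phi k%:R / T x0) => [|k]; first by rewrite lerDl sumr_ge0// => k _; rewrite divr_ge0// ltW.
  have [xk|kx] := leqP x0 k.
    have k0 : 0 < k%:R :> R by rewrite ltr0n (leq_trans _ xk).
    apply: (@le_trans _ _ (T k)); last first.
      rewrite ler_peMl ?(ltW (T0 k))// lerDl sumr_ge0// => j _.
      by rewrite divr_ge0// ltW.
    rewrite (TE k xk) /rv ler_wpM2l ?(ltW (phi_pos _))// !powRN lef_pV2 ?posrE ?powR_gt0//.
    by apply: ge0_ler_powR; rewrite ?nnegrE ?(ltW g0)// lerDr.
  rewrite (T_low _ (ltnW kx)) mulrDl mul1r.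
  apply: (@le_trans _ _ (phi k%:R)).
    rewrite ler_piMr ?(ltW (phi_pos _))// powRN invf_le1 ?powR_gt0 ?ltr_wpDr//.
    by rewrite -[leLHS](powRr0 (1 + k%:R)); apply: ler_powR; rewrite ?lerDl// ltW.
  rewrite -[leLHS]add0r; apply: lerD; first exact: ltW.
  rewrite -ler_pdivrMr// big_mkord (bigD1 (Ordinal kx))//= lerDl sumr_ge0// => j _.
  by rewrite divr_ge0// ltW.
pose C := `|Cp| + (1 + `|mean P X i|) + Kb + Cf + Ch.
have Cf0 : 0 <= Cf by exact: le_trans Cf1.
have Ch0 : 0 <= Ch by exact: le_trans Ch1.
have C_0 : 0 <= C by rewrite !addr_ge0.
exists A0, C, T, p0; split=> //.
- move=> pe n x pp n0 ax; apply: (le_trans (hp pe n x pp n0 ax)); rewrite ler_wpM2r ?(ltW (a'0 n))//.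
  apply: (le_trans (ler_norm _)); rewrite normrX; apply: lerXn2r; rewrite ?nnegrE// /C -!addrA lerDl.
  by rewrite !addr_ge0.
- by move=> al2; apply: low; rewrite lt_neqAle al2.
- by move=> k; apply: (le_trans (hCh k)); rewrite ler_wpM2r ?(ltW (T0 _))// /C lerDr !addr_ge0.
- move=> k k0; apply: (le_trans (hCf k k0)); rewrite ler_wpM2r ?(ltW (ph0 _ k0))// /C -addrA addrCA lerDl.
  by rewrite !addr_ge0.
exists be; split.
- move=> n n0; apply: (le_trans (be_le n n0)); rewrite ler_wpM2r ?(ltW (a'0 n))//.
  have := normr_ge0 Cp; rewrite /C; lra.
- move=> n n0; apply: (le_trans (hKb n n0)); rewrite ler_wpM2r ?(ltW (a'0 n))//.
  have := normr_ge0 Cp; have := normr_ge0 (mean P X i); rewrite /C; lra.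
pose p1 := (p0.+1)%N.
pose s := (Num.truncn (gamma + delta)).+1.
have hs : gamma + delta <= s%:R by apply: ltW; exact: truncnS_gt.
apply: (@fuk_nagaev _ _ _ _ P X hX i T a' be (alpha == 2) T0 a'1 CG (16 * 2 ^+ s) (Cp ^+ p1)
  (Num.max C5 C6) s p1 tail_CG _ _ _ _ _ mom1_le) => //.
- by move=> k y ky; exact: (quasi_poly x00 d0 dg T_pot T_low hs ky).
- by move=> n x n0 ax; apply: hp.
- move=> al2 k; apply: (le_trans (hC5 al2 k)); rewrite ler_wpM2r ?(ltW (T0 _))// ler_wpM2r ?sqr_ge0//.
  by rewrite le_max lexx.
- move=> al2 n k n0; apply: (le_trans (hC6 al2 n k n0)); rewrite ler_wpM2r ?addr_ge0 ?sqr_ge0//.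
  by rewrite le_max lexx orbT.
Unshelve. all: by end_near.
Qed.

End coordinate.

(** * Local large deviations *)

Lemma le_mul_bigmin (R : realType) (I : finType) (p A : R) (f : I -> \bar R) : 0 < A ->
  (forall i, (p%:E <= A%:E * f i)%E) -> (p%:E <= A%:E * \big[mine/+oo]_i f i)%E.
Proof.
move=> A0 h; elim/big_ind: _ => [|x y hx hy|i _]; last exact: h.
  by rewrite gt0_muley ?lte_fin// leey.
by rewrite /mine; case: ifP.
Qed.

Section walk_bounds.
Context {R : realType} {d : nat} {dO : measure_display} {Omega : measurableType dO}.
Variables (P : probability Omega R) (X : nat -> Omega -> 'rV[int]_d).
Hypothesis hX : iid discrete_sets P X.

Local Notation psi := (cf2 P (fun w => realv (walk X 1 w) : 'rV[R]_d)).

(** The compactness argument is applied to the constant sequence equal to one step, which converges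
    in law to itself; aperiodicity gives the strict inequality. *)
Lemma aperiodic_far_bound (haper : aperiodic (step_support P X)) (r1 : R) : 0 < r1 ->
  exists rho : R, [/\ 0 < rho, rho < 1 & forall th : 'rV[R]_d, (forall j, `|th 0 j| <= pi) ->
   (exists j, r1 <= `|th 0 j|) -> psi th <= rho].
Proof.
move=> r10.
have bY (F : 'rV[R]_d -> R) : (exists K : R, forall z, `|F z| <= K) -> bmf (F \o (fun w => realv (walk X 1 w))).
  move=> [K hK]; apply: (@discrete_bmf _ _ _ _ (walk X 1) (fun z => F (realv z))); first exact: walk_rv hX 1.
  by exists K => z; exact: hK.
have cvgc : cvg_in_law P (fun _ w => realv (walk X 1 w) : 'rV[R]_d) P (fun w => realv (walk X 1 w) : 'rV[R]_d).
  by move=> f _ _; exact: cvg_cst.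
have := @annulus R d dO Omega P _ (fun f K _ hK => bY f (ex_intro _ K hK)) dO Omega P _ (fun _ => bY) cvgc r1 pi r10.
case=> [th hth th0|rho [n0 [rho0 rho1 h]]]; first exact: cf2_lt1.
by exists rho; split=> // th; exact: (h n0).
Qed.

(** The power n of the one-step modulus at [th] is the modulus of the normalized walk at the
    frequency th_i a_n i, which lies in a fixed annulus. *)
Lemma scaled_ring_bound (dZ : measure_display) (OmegaZ : measurableType dZ)
  (Q : probability OmegaZ R) (Z : OmegaZ -> 'rV[R]_d) (g : 'rV[R]_d -> R)
  (hZ : random_element borel_sets Z) (hg : has_density Q Z g)
  (a a' b : nat -> 'I_d -> R) (a_gt0 : forall n i, (0 < n)%N -> 0 < a n i)
  (hcvg : cvg_in_law P (normalized_walk X a b) Q Z) :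
  (\forall n \near \oo, forall i, a' n i = a n i) ->
  forall r1 r2 : R, 0 < r1 -> exists (rho : R) (n0 : nat), [/\ 0 < rho, rho < 1 &
  forall n (th : 'rV[R]_d), (n0 <= n)%N -> (forall j, `|th 0 j| * a' n j <= r2) ->
   (exists j, r1 <= `|th 0 j| * a' n j) -> psi th ^+ n <= rho].
Proof.
move=> [N _ hN] r1 r2 r10.
have lt1 (th : 'rV[R]_d) : (forall j, `|th 0 j| <= r2) -> th != 0 -> cf2 Q Z th < 1.
  by move=> _; exact: (cf2_density_lt1 hZ hg).
have [rho [n0 [rho0 rho1 h]]] := annulus (continuous_bmf hZ) (normalized_walk_bmf hX a b) hcvg r10 lt1.
exists rho, (maxn 1 (maxn n0 N)); split=> // n th; rewrite !geq_max => /and3P[n1 n0n Nn] h2 [j hj].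
have aE i : a' n i = a n i by exact: hN.
pose th' : 'rV[R]_d := \row_i (th 0 i * a n i).
have nth' i : `|th' 0 i| = `|th 0 i| * a' n i.
  by rewrite mxE normrM aE [`|a n i|]gtr0_norm// a_gt0.
have -> : th = \row_i (th' 0 i / a n i).
  by apply/rowP => i; rewrite !mxE mulfK// gt_eqF// a_gt0.
rewrite -(cf2_normalized hX a b); apply: h => // [i|]; first by rewrite nth'.
by exists j; rewrite nth'.
Qed.

Lemma walk_prob_le n y (B : R) : (forall M, Ex (@pt d M) (@boxw _ _ _ _ P X M) n (fun z => (z == y)%:R) <= B) ->
  (P (walk X n @^-1` [set y]) <= B%:E)%E.
Proof.
move=> hB.
have E1 : P (walk X n @^-1` [set y]) = (Er P (fun w => (walk X n w == y)%:R))%:E.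
  have mA : measurable (walk X n @^-1` [set y]) by exact: (walk_rv hX n [set y]).
  have -> : (fun w => (walk X n w == y)%:R) = \1_(walk X n @^-1` [set y]) :> (Omega -> R).
    apply/funext => w; rewrite indicE; congr (_%:R); congr nat_of_bool.
    by apply/eqP/idP => [<-|]; rewrite inE.
  by rewrite Er_indic// fineK// fin_num_measure.
rewrite E1 lee_fin.
have b : exists K : R, forall z, `|(z == y)%:R : R| <= K.
  by exists 1 => z; case: eqP; rewrite ?normr1 ?normr0.
have c := Ex_walk_cvg hX (n := n) b.
rewrite -(cvg_lim _ c)//; apply: limr_le; first by apply/cvg_ex; eexists; exact: c.
exact: nearW.
Qed.

End walk_bounds.

Lemma weight_sum_bound (R : realType) (h : nat -> nat -> R) : admissible_weight h ->
  exists Hs : R, forall u M, \sum_(0 <= v < M) h u v / (1 + v%:R) <= Hs.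
Proof.
move=> [h01 hsup _].
set S := ereal_sup _ in hsup.
have F0 u v : (0 <= (h u v / (1 + v%:R))%:E)%E.
  by rewrite lee_fin divr_ge0//; case/andP: (h01 u v).
have le_S u : (\sum_(0 <= v <oo) (h u v / (1 + v%:R))%:E <= S)%E.
  by apply: ereal_sup_ubound; exists u.
have S0 : (0 <= S)%E.
  by apply: le_trans (le_S 0%N); apply: nneseries_ge0 => v _ _; exact: F0.
have Sfin : S \is a fin_num by rewrite ge0_fin_numE.
exists (fine S) => u M; rewrite -lee_fin fineK// -sumEFin; apply: le_trans (le_S u).
by apply: nneseries_lim_ge => v _ _; exact: F0.
Qed.

Theorem theorem2p3 (R : realType) (d : nat) (hd : (0 < d)%N)
  (dO : measure_display) (Omega : measurableType dO) (P : probability Omega R)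
  (X : nat -> Omega -> 'rV[int]_d)
  (hX : iid discrete_sets P X)
  (haper : aperiodic (step_support P X))
  (alpha : 'I_d -> R) (halpha : forall i, 0 < alpha i <= 2)
  (p q : 'I_d -> R) (L : 'I_d -> R -> R)
  (htails : marginal_tails P X alpha p q L)
  (a : nat -> 'I_d -> R) (ha : scaling P X alpha L a)
  (dZ : measure_display) (OmegaZ : measurableType dZ)
  (Q : probability OmegaZ R) (Z : OmegaZ -> 'rV[R]_d) (g : 'rV[R]_d -> R)
  (hZ : random_element borel_sets Z)
  (hZstable : stable_vector alpha Q Z) (hg : has_density Q Z g)
  (hcvg : cvg_in_law P (normalized_walk X a (recentering P X alpha a)) Q Z)
  (phi : 'I_d -> R -> R) (gamma : 'I_d -> R)
  (hphi : tail_domination P X alpha L phi gamma)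
  (h : 'I_d -> nat -> nat -> R) (hloc : local_assumption P X phi gamma h) :
  exists c2 C2 : R, [/\ 0 < c2, 0 < C2 &
    forall (n : nat) (x : 'rV[int]_d), (0 < n)%N ->
      (P (centered_walk X (recentering P X alpha a) n @^-1` [set x]) <=
       (C2 / \prod_i Num.max `|x 0%R i|%N%:R (a n i))%:E *
       \big[mine/+oo]_i
         (n%:R%:E * tail_term (phi i) (gamma i) `|x 0%R i|%N +
          (expR (- c2 * (`|x 0%R i|%N%:R / a n i) ^+ 2)
             * (alpha i == 2)%:R)%:E))%E].
Proof.
have a_gt0 n i : (0 < n)%N -> 0 < a n i by have [h1 _ _] := ha i; exact: h1.
have a_cvgy i := scaling_cvgy hZ hg hX a_gt0 hcvg i.
have /choice[A0 /choice[Cc /choice[T /choice[p0 hcc]]]] : forall i, exists A0 C T p0,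
    coordinate_control P X i (alpha i) (gamma i) (phi i) (a ^~ i) A0 C T p0.
  by move=> i; exact: (@coordinate_facts R d dO Omega P X hX i (alpha i) (p i) (q i) (gamma i) (L i) (phi i) (a ^~ i)
    (halpha i) (htails i) (ha i) (@a_cvgy i) (hphi i)).
(* Regularized scales, at least 1 and eventually equal to [a]; the whole deviation argument uses
   them. *)
pose a' n i := Num.max (a n i) (A0 i).
have A01 i : 1 <= A0 i by exact: cc_A0 (hcc i).
have a'1 n i : 1 <= a' n i by rewrite /a' le_max A01 orbT.
have a'0 n i : 0 < a' n i by exact: lt_le_trans (a'1 n i).
have T0 i k : 0 < T i k by exact: cc_gt0 (hcc i) k.
have Cc0 i : 0 <= Cc i by exact: cc_C (hcc i).
have sum_ge (F : 'I_d -> R) i : (forall j, 0 <= F j) -> F i <= \sum_j F j.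
  by move=> F0; rewrite (bigD1 i)//= lerDl sumr_ge0.
pose C := \sum_i Cc i.
have CcC i : Cc i <= C by exact: sum_ge.
have C0 : 0 <= C by exact: sumr_ge0.
have /choice[be0 hbe] := fun i => cc_mean (hcc i).
pose be n i := be0 i n.
have /choice[Cg /choice[kap hgrowth]] := fun i => cc_growth (hcc i).
have a_A0 : \forall n \near \oo, forall i, a' n i = a n i.
  have : \forall n \near \oo, forall i, i \in 'I_d -> a' n i = a n i.
    apply: filter_forall => i; near=> n => _; apply/max_idPl.
    by near: n; move/cvgryPge: (@a_cvgy i); apply.
  by apply: filterS => n hn i; exact: hn.
have growth m n i : (1 <= m <= n)%N -> a' n i <= (1 + \sum_i Cg i) * (n%:R / m%:R) ^+ (\max_i kap i) * a' m i.
  move=> /andP[m0 mn]; have [Cg1 hg'] := hgrowth i; apply: (le_trans (hg' m n m0 mn)).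
  rewrite ler_wpM2r ?(ltW (a'0 _ _))//.
  have nm1 : 1 <= n%:R / m%:R :> R by rewrite ler_pdivlMr ?ltr0n// mul1r ler_nat.
  apply: ler_pM; rewrite ?exprn_ge0 ?(le_trans _ Cg1) ?(le_trans _ nm1)//.
    apply: (@le_trans _ _ (\sum_i Cg i)); last by rewrite lerDr.
    by apply: sum_ge => j; case: (hgrowth j) => /(le_trans _)->.
  by apply: ler_weXn2l => //; exact: leq_bigmax.
have Cg1 : 1 <= 1 + \sum_i Cg i.
  by rewrite lerDl sumr_ge0// => j _; case: (hgrowth j) => /(le_trans _)->.
have [CL CL0 hCL] := local_limit_bound hX a'1 (isT : (0 < 1)%N) Cg1 growth
  (scaled_ring_bound hX hZ hg a_gt0 hcvg a_A0) (aperiodic_far_bound hX haper).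
have llt M (A : {set 'I_d}) n m y : (0 < n)%N -> (n <= 2 * m + d + 1)%N ->
    Ex (@pt d M) (@boxw _ _ _ _ P X M) m (fun z => (agree A z y)%:R) * \prod_(j in A) a' n j <= CL.
  move=> n0 nm; apply: le_trans (hCL A n m y n0 nm).
  rewrite ler_wpM2r ?prodr_ge0// => [j _|]; first exact: ltW.
  apply: (Ex_le_Er hX M m (f := fun z => (agree A z y)%:R)) => //.
  by exists 1 => z; case: agree; rewrite ?normr1 ?normr0.
have [hadm [CH hCH]] := hloc.
have /choice[Hs hHs] := fun i => weight_sum_bound (hadm i).
have /choice[Kh hKh] : forall i, exists K : R, forall u u' v, (u <= u' <= 2 * u)%N -> h i u' v <= K * h i u v.
  by move=> i; case: (hadm i).
have h01 i u v : 0 <= h i u v <= 1 by case: (hadm i) => h1 _ _; exact: h1.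
have h0 i u v : 0 <= h i u v by case/andP: (h01 i u v).
pose P0 := (\max_i p0 i).+1.
pose gs i := alpha i == 2.
have nT_le i n x : (0 < n)%N -> a' n i <= x%:R -> (n%:R * T i x) ^+ P0 * x%:R <= C ^+ P0 * a' n i.
  move=> n0 ax; have hp : (p0 i <= P0)%N by rewrite leqW// leq_bigmax.
  apply: (le_trans (cc_pow (hcc i) hp n0 ax)); rewrite ler_wpM2r ?(ltW (a'0 _ _))//.
  by apply: lerXn2r; rewrite ?nnegrE.
have nT_low (K : R) : exists2 c : R, 0 < c & forall i n x, ~~ gs i -> (0 < n)%N ->
    x%:R <= K * a' n i -> c <= n%:R * T i x.
  have /choice[c hc] : forall i, exists c : R, 0 < c /\ (~~ gs i -> forall n x, (0 < n)%N ->
      x%:R <= K * a' n i -> c <= n%:R * T i x).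
    move=> i; have [gi|ngi] := boolP (gs i); first by exists 1.
    by have [c c0 hc] := cc_low (hcc i) ngi K; exists c.
  exists (1 + \sum_i (c i)^-1)^-1 => [|i n x gi n0 xK].
    by rewrite invr_gt0 ltr_wpDr// sumr_ge0// => i _; rewrite invr_ge0; case: (hc i) => /ltW.
  have [ci hci] := hc i; apply: le_trans (hci gi n x n0 xK).
  rewrite -[leRHS]invrK lef_pV2 ?posrE ?invr_gt0//; last first.
    by rewrite ltr_wpDr// sumr_ge0// => j _; rewrite invr_ge0; case: (hc j) => /ltW.
  apply: (@le_trans _ _ (\sum_i (c i)^-1)); last by rewrite lerDr.
  by apply: sum_ge => j; rewrite invr_ge0; case: (hc j) => /ltW.
have local i z : step_pmf P X z <= (`|CH| * C) * T i `|z 0%R i|%N *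
    \prod_j (1 + `|z 0%R j|%N%:R)^-1 * \prod_(j | j != i) h i `|z 0%R i|%N `|z 0%R j|%N.
  have zfin := @step_prob_fin _ _ _ _ P X hX 0 [set z].
  have := hCH i z; rewrite -(fineK zfin) lee_fin => /le_trans; apply.
  rewrite ler_wpM2r ?prodr_ge0// -prodfV ler_wpM2r//.
    by rewrite prodr_ge0// => j _; rewrite invr_ge0 addr_ge0.
  rewrite -!mulrA.
  have p1 : 0 <= phi i `|z 0%R i|%N%:R * (1 + `|z 0%R i|%N%:R) `^ (- gamma i).
    have [[_ phi0] _ _ _ _] := hphi i.
    by rewrite mulr_ge0 ?powR_ge0// ltW// phi0.
  apply: (le_trans (ler_wpM2r p1 (ler_norm CH))); rewrite ler_wpM2l//.
  by apply: (le_trans (cc_phi0 (hcc i) _)); rewrite ler_wpM2r// ltW.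
have T_div (r : nat) : (0 < r)%N -> exists C : R, forall i x, T i (x %/ r)%N <= C * T i x.
  move=> r0; have /choice[D hD] := fun i => cc_div (hcc i) r0.
  exists (\sum_i `|D i|) => i x; apply: (le_trans (hD i x)); rewrite ler_wpM2r ?(ltW (T0 _ _))//.
  by apply: (le_trans (ler_norm _)); exact: (sum_ge (fun i => `|D i|)).
have be_le n i : (0 < n)%N -> `|be n i| <= C * a' n i.
  move=> n0; have [h1 _ _] := hbe i; apply: (le_trans (h1 n n0)).
  by rewrite ler_wpM2r ?(ltW (a'0 _ _)).
have fuk pe (pe0 : (0 < pe)%N) i := let: And3 _ _ h3 := hbe i in h3 pe pe0.
have h_sum i u M : \sum_(0 <= v < M) h i u v / (1 + v%:R) <= \sum_i `|Hs i|.
  apply: (le_trans (hHs i u M)); apply: (le_trans (ler_norm _)).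
  exact: (sum_ge (fun i => `|Hs i|)).
have h_dbl i u u' v : (u <= u' <= 2 * u)%N -> h i u' v <= (\sum_i `|Kh i|) * h i u v.
  move=> uu; apply: (le_trans (hKh i u u' v uu)); rewrite ler_wpM2r//.
  by apply: (le_trans (ler_norm _)); exact: (sum_ge (fun i => `|Kh i|)).
(* The tolerance on the centring: [C] for the change of centring constants, 1 for the integer
   parts. *)
have C10 : 0 <= C + 1 by rewrite addr_ge0.
have [Cf [cf [Cf0 cf0 main]]] := @local_deviation_bound R d dO Omega P X T a' be gs h P0 16 (C ^+ P0) C CL
  (`|CH| * C) (\sum_i `|Hs i|) (\sum_i `|Kh i|) (C + 1) a'1 T0 (fun i => cc_dec (hcc i))
  T_div (ltn0Sn _) nT_le nT_low be_le llt fuk local h01 h_sum h_dbl C10.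
(* The regularized scales exceed the original ones by a bounded factor only, as they coincide for
   large n. *)
have /choice[kr hkr] : forall i, exists kr : R, 0 < kr /\ forall n, (0 < n)%N -> a' n i <= kr * a n i.
  move=> i; have [||c1 [c2 [c10 hc]]] := @eventually_pinched R (fun n => a' n i / a n i).
  - by move=> n n0; rewrite divr_gt0// a_gt0.
  - near=> n; have n0 : (0 < n)%N by near: n; exact: nbhs_infty_gt.
    have -> : a' n i = a n i by move: i; near: n.
    by rewrite divff ?gt_eqF ?a_gt0//; apply/andP; split; lra.
  exists c2; split.
    have /andP[h1 h2] := hc 1%N isT; exact: lt_le_trans c10 (le_trans h1 h2).
  by move=> n n0; have /andP[_] := hc n n0; rewrite ler_pdivrMr// a_gt0.
pose kk := 1 + \sum_i kr i.
have kr0 i : 0 <= kr i by case: (hkr i) => /ltW.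
have kk0 : 0 < kk by rewrite ltr_wpDr// sumr_ge0.
have a'kk n i : (0 < n)%N -> a' n i <= kk * a n i.
  move=> n0; have [_ h1] := hkr i; apply: (le_trans (h1 n n0)); rewrite ler_wpM2r ?(ltW (a_gt0 _ _ _))//.
  by apply: (@le_trans _ _ (\sum_i kr i)); [exact: sum_ge|rewrite lerDr].
pose C1 := 1 + C.
have C1_ge1 : 1 <= C1 by rewrite lerDl.
have C1_gt0 : 0 < C1 by exact: lt_le_trans C1_ge1.
(* As a' <= kk a, the Gaussian factor at the scale a' is at most the one at the scale a with its
   constant divided by kk^2. *)
exists (cf / kk ^+ 2), (Cf * C1); split; [by rewrite divr_gt0// exprn_gt0|by rewrite mulr_gt0|].
move=> n x n0.
(* The integer part of the centring is moved into the target point; rounding costs at most 1, hence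
   at most the scale. *)
pose b : 'rV[int]_d := \row_i Num.floor (recentering P X alpha a n i).
have hb : centred a' be (C + 1) n b.
  move=> j; rewrite mxE; set r := recentering _ _ _ _ _ _.
  have h1 : `|(Num.floor r)%:~R - r| <= 1.
    have f1 := floor_le r; have f2 := floorD1_gt r; rewrite intrD in f2.
    by rewrite ler_norml; apply/andP; split; lra.
  have [_ h2 _] := hbe j; have {}h2 := h2 n n0; rewrite -/(be n j) -/(a' n j) in h2.
  have h3 : `|r - n%:R * be n j| <= C * a' n j.
    rewrite distrC; apply: (le_trans h2); by rewrite ler_wpM2r ?(ltW (a'0 _ _)).
  have -> : (Num.floor r)%:~R - n%:R * be n j = ((Num.floor r)%:~R - r) + (r - n%:R * be n j) by ring.
  apply: (le_trans (ler_normD _ _)); rewrite mulrDl addrC mul1r; apply: lerD => //.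
  exact: le_trans h1 (a'1 n j).
have -> : centered_walk X (recentering P X alpha a) n @^-1` [set x] = walk X n @^-1` [set x + b].
  apply/seteqP; split=> w /=; rewrite /centered_walk -/b; first by move=> <-; rewrite subrK.
  by move=> ->; rewrite addrK.
have Pfin : P (walk X n @^-1` [set x + b]) \is a fin_num.
  by apply: fin_num_measure; exact: (walk_rv hX n [set x + b]).
set Pn := P _ in Pfin *.
rewrite -(fineK Pfin); apply: le_mul_bigmin.
  rewrite divr_gt0 ?mulr_gt0// prodr_gt0// => j _; by rewrite lt_max a_gt0 ?orbT.
move=> i.
pose D := \prod_j (Num.max `|x 0%R j|%N%:R (a n j)).
have D0 : 0 < D by apply: prodr_gt0 => j _; rewrite lt_max a_gt0 ?orbT.
(* [tail_term] is infinite at 0, so the bound is trivial there. *)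
have [x0|x0] := eqVneq `|x 0%R i|%N 0%N.
  rewrite x0 /tail_term eqxx gt0_muley ?lte_fin ?ltr0n// addye// gt0_muley ?leey//.
  by rewrite lte_fin divr_gt0// mulr_gt0.
rewrite /tail_term; case: ifP => [|_]; first by rewrite (negbTE x0).
rewrite -[X in (_ <= _ * (X + _))%E]EFinM -EFinD -EFinM (fineK Pfin).
apply: (le_trans (walk_prob_le hX (fun M => main M n b x i n0 hb))).
rewrite lee_fin -!mulrA ler_wpM2l ?(ltW Cf0)//.
have D' : \prod_j (Num.max `|x 0%R j|%N%:R (a' n j))^-1 <= D^-1.
  rewrite -prodfV; apply: ler_prod => j _.
  have m0 : 0 < Num.max `|x 0%R j|%N%:R (a n j) by rewrite lt_max a_gt0 ?orbT.
  have m1 : Num.max `|x 0%R j|%N%:R (a n j) <= Num.max `|x 0%R j|%N%:R (a' n j).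
    by rewrite ge_max /a' !le_max !lexx/= orbT.
  by rewrite invr_ge0 (le_trans (ltW m0) m1)/= lef_pV2 ?posrE// (lt_le_trans m0).
rewrite mulrA [C1 * _]mulrC -mulrA; apply: ler_pM => //.
- by rewrite prodr_ge0// => j _; rewrite invr_ge0 le_max (ltW (a'0 _ _)) orbT.
- by rewrite addr_ge0 ?mulr_ge0 ?expR_ge0// ltW.
rewrite mulrDr; apply: lerD.
  rewrite mulrCA ler_wpM2l//; apply: (le_trans (cc_phi (hcc i) _)); first by rewrite lt0n.
  have [[_ phi0] _ _ _ _] := hphi i.
  rewrite ler_wpM2r ?mulr_ge0 ?powR_ge0 ?(ltW (phi0 _ _))//.
  by apply: (le_trans (CcC i)); rewrite lerDr.
rewrite [leRHS]mulrA ler_wpM2r//.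
apply: (@le_trans _ _ (expR (- (cf / kk ^+ 2) * (`|x 0%R i|%N%:R / a n i) ^+ 2))); last first.
  by rewrite ler_peMl ?expR_ge0.
rewrite ler_expR !mulNr lerN2 -mulrA ler_wpM2l ?(ltW cf0)// -exprVn -exprMn.
apply: lerXn2r; rewrite ?nnegrE ?mulr_ge0 ?invr_ge0 ?(ltW (a_gt0 _ _ _)) ?(ltW kk0) ?(ltW (a'0 _ _))//.
rewrite mulrCA ler_wpM2l// -invfM lef_pV2 ?posrE ?mulr_gt0 ?a_gt0//.
exact: a'kk.
Unshelve. all: by end_near.
Qed.
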